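(* For $n\ge1$, let $\bm G_n$ be a uniform random labeled cograph with vertex set $\{1,\dots,n\}$ and $\bm G_n^u$ a uniform random unlabeled cograph with $n$ vertices, and let $\bm v$ and $\bm v^u$ be uniform random vertices of $\bm G_n$ and $\bm G_n^u$ respectively. Then, as $n\to+\infty$, $$\tfrac1n\deg_{\bm G_n}(\bm v)\to U,\qquad \tfrac1n\deg_{\bm G_n^u}(\bm v^u)\to U$$ in distribution, where $U$ is uniform on $[0,1]$.
   Context: A labeled cograph is a graph obtainable from single-vertex graphs by repeatedly taking disjoint unions and joins (the join of graphs with disjoint vertex sets is their disjoint union plus all edges between vertices of different graphs); an unlabeled cograph is the isomorphism class of a labeled cograph. $\deg_G(v)$ is the degree of vertex $v$ in $G$. *)

(* Defs.v *)
From HB Require Import structures.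
From mathcomp Require Import all_boot all_order all_algebra all_fingroup.

Set Implicit Arguments.
Unset Strict Implicit.
Unset Printing Implicit Defensive.

(* [cograph V E]: the graph with vertex set V and edge set E is a cograph.
   All label sets are subsets of an ambient finite type T. *)
Inductive cograph (T : finType) : {set T} -> {set {set T}} -> Prop :=
| cograph_vertex (x : T) : cograph [set x] set0
| cograph_union (V1 V2 : {set T}) (E1 E2 : {set {set T}}) :
    [disjoint V1 & V2] -> cograph V1 E1 -> cograph V2 E2 ->
    cograph (V1 :|: V2) (E1 :|: E2)
| cograph_join (V1 V2 : {set T}) (E1 E2 : {set {set T}}) :
    [disjoint V1 & V2] -> cograph V1 E1 -> cograph V2 E2 ->
    cograph (V1 :|: V2)
      (E1 :|: E2 :|: [set [set x; y] | x in V1, y in V2]).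

Definition degree (T : finType) (E : {set {set T}}) (x : T) : nat :=
  #|[set y | [set x; y] \in E]|.

From mathcomp Require Import all_classical all_reals all_analysis.
Import Order.TTheory GRing.Theory Num.Theory.
Import numFieldNormedType.Exports.

Local Open Scope classical_set_scope.
Local Open Scope ring_scope.

(* The vertex set {1, ..., n} is represented by 'I_n; a graph on it is given by
   its edge set. *)
Notation graph_on n := {set {set 'I_n}}.

Definition labeled_cographs (n : nat) : {set graph_on n} :=
  [set E : graph_on n | `[< cograph [set: 'I_n]%SET E >]]%SET.

Definition relabel (n : nat) (s : {perm 'I_n}) (E : graph_on n) : graph_on n :=
  [set s @: e | e : {set 'I_n} in E]%SET.

Definition iso_class (n : nat) (E : graph_on n) : {set graph_on n} :=
  [set relabel s E | s : {perm 'I_n}]%SET.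

Definition unlabeled_cographs (n : nat) : {set {set graph_on n}} :=
  [set iso_class E | E in labeled_cographs n]%SET.

Definition uniform_in d (T : measurableType d) (R : realType)
    (P : probability T R) (A : finType) (S : {set A}) (X : T -> A) : Prop :=
  forall a : A, measurable [set w | X w = a] /\
    P [set w | X w = a] = ((a \in S)%:R / #|S|%:R)%:E.

(* Conditionally on the value of X, v is uniform on 'I_n. *)
Definition uniform_vertex_given d (T : measurableType d) (R : realType)
    (P : probability T R) (A : finType) (X : T -> A) (n : nat)
    (v : T -> 'I_n) : Prop :=
  forall (a : A) (i : 'I_n), measurable [set w | X w = a /\ v w = i] /\
    P [set w | X w = a /\ v w = i] =
      ((n%:R^-1)%:E * P [set w | X w = a])%E.

(* The X k may live on different probability spaces; mu is the law of the
   limit. *)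
Definition cvg_in_distribution (R : realType) (d : nat -> measure_display)
    (T : forall k, measurableType (d k)) (P : forall k, probability (T k) R)
    (X : forall k, T k -> R) (mu : probability (measurableTypeR R) R) : Prop :=
  (forall k, measurable_fun [set: T k] (X k)) /\
  forall f : R -> R, continuous f -> (exists M : R, forall x, `|f x| <= M) ->
    ('E_(P k)[f \o X k] @[k --> \oo] --> 'E_mu[f])%E.

(* Main.v *)
Require Import Defs.
From HB Require Import structures.
From mathcomp Require Import all_boot all_order all_algebra all_fingroup.
From mathcomp Require Import boolp.
From mathcomp Require Import ring lra zify.
Import Order.TTheory GRing.Theory Num.Theory.
Set Implicit Arguments.
Unset Strict Implicit.
Unset Printing Implicit Defensive.

(* By Burnside's lemma both degree laws are of the form cnt_n(d) / sum, where
   cnt counts pairs (E, s) of a cograph E on n + 1 vertices and an automorphism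
   s of E (with s = 1 in the labeled case) such that a marked vertex has degree
   d.  Let N(x, y) be the exponential generating series of cnt, x marking the
   neighbours and y the non-neighbours of the marked vertex, and let A be the
   series of all pairs, so that A' = N(x, x).  Removing from a pair the part
   outside the smallest s-stable union of components (or of co-components)
   containing the marked vertex gives, as a cograph with at least two vertices
   is disconnected or co-disconnected,
     N = F * Core  with  F = (1 + A(x)) (1 + A(y)) / (1 - A(x) A(y)),
   where Core counts the pairs for which both reductions are trivial.  In these
   the automorphism permutes isomorphic components transitively, so there are
   few of them: Core has coefficients much smaller than those of A.

   Put h = (1 - A) / (1 + A), so that F = 2 / (h(x) + h(y)), whence
     (h(x)^2 - h(y)^2) F = 2 (h(x) - h(y)).
   Applying mixed derivatives and restricting to x = y, all the terms but two
   are negligible against powers of B = 1 / (1 - A), and the factorial moments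
   E[C(D, k) C(n - D, l)] of the degree D depend asymptotically only on k + l.
   This is the moment characterisation of the uniform law: sampling K vertices,
   the number of neighbours of the marked one among them is nearly uniform on
   {0, ..., K}, while it is close to K D / n by the variance of the
   hypergeometric law. *)

(** * Cographs with an automorphism *)

(** Everything rests on [A' = g * al], where [g] is the diagonal of Core and
    [al = (1 + A) / (1 - A)]. As [g] is harmless, heuristically [1 - A] behaves like the square root
    of the distance to the singularity, so that a derivative costs a factor [B^2]. No singularity is
    located, since in the unlabeled case [g] is only known through crude bounds: every statement on
    orders is a coefficientwise comparison with powers of [B], obtained from the functional
    equations. The obstacle is that such comparisons express growth but not smallness. [h = 1 / al]
    ought to count as [B^-1], but its coefficients are signed and are only bounded by those of [B];
    its smallness is therefore used algebraically, by cancelling [h] against [al]. This is why the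
    identity is taken with squares: the derivative of [h^2] is [- g] up to terms that keep a factor
    [h^2], so one derivative falling on [h^2] isolates the wanted combination, while a mixed
    derivative kills [h(x) - h(y)]. *)

Section Graphs.
Variable T : finType.
Implicit Types (V W S Z : {set T}) (E : {set {set T}}) (x y v : T) (t : bool).

Definition adj E x y := [set x; y] \in E.

Lemma adjC E x y : adj E x y = adj E y x.
Proof. by rewrite /adj setUC. Qed.

Lemma set2_inj x y a b : [set x; y] = [set a; b] ->
  (x = a /\ y = b) \/ (x = b /\ y = a).
Proof.
move=> e; have h1 := set21 x y; have h2 := set22 x y; have h3 := set21 a b.
have h4 := set22 a b; rewrite e in_set2 in h1; rewrite e in_set2 in h2.
rewrite -e in_set2 in h3; rewrite -e in_set2 in h4.
by move: h1 h2 h3 h4 => /orP[]/eqP-> /orP[]/eqP-> /orP[]/eqP ? /orP[]/eqP ?; subst; auto.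
Qed.

Definition wf V E := forall e, e \in E ->
  exists x y, [/\ x \in V, y \in V, x != y & e = [set x; y]].

Lemma wf_adj V E x y : wf V E -> adj E x y -> [/\ x \in V, y \in V & x != y].
Proof.
move=> w /w [a [b [aV bV ab /set2_inj[[-> ->]|[-> ->]]]]] //.
by rewrite eq_sym.
Qed.

Lemma graph_ext V E E' : wf V E -> wf V E' ->
  (forall x y, x \in V -> y \in V -> adj E x y = adj E' x y) -> E = E'.
Proof.
move=> w w' h; apply/setP => e; apply/idP/idP => eE.
  have [x [y [xV yV _ ee]]] := w _ eE.
  by have := h x y xV yV; rewrite /adj -ee eE.
have [x [y [xV yV _ ee]]] := w' _ eE.
by have := h x y xV yV; rewrite /adj -ee eE.
Qed.

(* t = true is the join, t = false the disjoint union; this convention is kept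
   throughout. *)
Definition glue t V1 V2 (E1 E2 : {set {set T}}) :=
  E1 :|: E2 :|: (if t then [set [set x; y] | x in V1, y in V2] else set0).

Lemma cograph_glue_ind (P : {set T} -> {set {set T}} -> Prop) :
  (forall x, P [set x] set0) ->
  (forall t V1 V2 E1 E2, [disjoint V1 & V2] -> cograph V1 E1 -> P V1 E1 ->
    cograph V2 E2 -> P V2 E2 -> P (V1 :|: V2) (glue t V1 V2 E1 E2)) ->
  forall V E, cograph V E -> P V E.
Proof.
move=> P1 Pg V E; elim=> [x|V1 V2 E1 E2 d c1 p1 c2 p2|V1 V2 E1 E2 d c1 p1 c2 p2] //.
  by have := Pg false _ _ _ _ d c1 p1 c2 p2; rewrite /glue setU0.
exact: Pg true _ _ _ _ d c1 p1 c2 p2.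
Qed.

Lemma cograph_glue t V1 V2 E1 E2 : [disjoint V1 & V2] -> cograph V1 E1 ->
  cograph V2 E2 -> cograph (V1 :|: V2) (glue t V1 V2 E1 E2).
Proof.
by case: t => d c1 c2; rewrite /glue ?setU0; [apply: cograph_join | apply: cograph_union].
Qed.

Lemma wf_glue t V1 V2 E1 E2 : [disjoint V1 & V2] -> wf V1 E1 -> wf V2 E2 ->
  wf (V1 :|: V2) (glue t V1 V2 E1 E2).
Proof.
move=> d w1 w2 e; rewrite !inE -orbA => /or3P[/w1|/w2|].
- by case=> x [y [h1 h2 h3 ->]]; exists x, y; rewrite !inE h1 h2.
- by case=> x [y [h1 h2 h3 ->]]; exists x, y; rewrite !inE h1 h2 !orbT.
case: t; last by rewrite inE.
case/imset2P => x y x1 y2 ->; exists x, y; rewrite !inE x1 y2 orbT; split=> //.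
by apply/eqP => xy; move/disjoint_setI0/setP: d => /(_ x); rewrite !inE x1 xy y2.
Qed.

Lemma cograph_wf V E : cograph V E -> wf V E.
Proof.
elim/cograph_glue_ind => {V E} [x e|t V1 V2 E1 E2 d _ w1 _ w2]; first by rewrite inE.
exact: wf_glue.
Qed.

Lemma cograph_neq0 V E : cograph V E -> V != set0.
Proof.
elim/cograph_glue_ind => {V E} [x|t V1 V2 E1 E2 d _ w1 _ w2].
  by apply/set0Pn; exists x; rewrite inE.
by rewrite setU_eq0 negb_and w1.
Qed.

Lemma adj_glue1 t V1 V2 E1 E2 x y : [disjoint V1 & V2] -> wf V2 E2 ->
  x \in V1 -> y \in V1 -> adj (glue t V1 V2 E1 E2) x y = adj E1 x y.
Proof.
move=> /disjoint_setI0/setP d w2 x1 y1; rewrite /adj /glue !inE -orbA.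
have dF z : z \in V1 -> z \in V2 = false by move=> z1; have := d z; rewrite !inE z1.
have -> : ([set x; y] \in E2) = false.
  by apply/negP => /(wf_adj w2)[]; rewrite dF.
case: t; last by rewrite inE !orbF.
rewrite orbA orbF; apply/orb_idr => /imset2P[a b a1 b2 /set2_inj[[_ yb]|[xb _]]].
  by rewrite -yb dF in b2.
by rewrite -xb dF in b2.
Qed.

Lemma adj_glue2 t V1 V2 E1 E2 x y : [disjoint V1 & V2] -> wf V1 E1 ->
  x \in V2 -> y \in V2 -> adj (glue t V1 V2 E1 E2) x y = adj E2 x y.
Proof.
move=> /disjoint_setI0/setP d w1 x2 y2; rewrite /adj /glue !inE -orbA.
have dF z : z \in V2 -> z \in V1 = false by move=> z2; have := d z; rewrite !inE z2 andbT.
have -> : ([set x; y] \in E1) = false.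
  by apply/negP => /(wf_adj w1)[]; rewrite dF.
case: t; last by rewrite inE !orbF.
rewrite orFb; apply/orb_idr => /imset2P[a b a1 b2 /set2_inj[[xa _]|[_ ya]]].
  by rewrite -xa dF in a1.
by rewrite -ya dF in a1.
Qed.

Lemma adj_glue12 t V1 V2 E1 E2 x y : [disjoint V1 & V2] -> wf V1 E1 -> wf V2 E2 ->
  x \in V1 -> y \in V2 -> adj (glue t V1 V2 E1 E2) x y = t.
Proof.
move=> /disjoint_setI0/setP d w1 w2 x1 y2; rewrite /adj /glue !inE.
have -> : ([set x; y] \in E1) = false.
  by apply/negP => /(wf_adj w1)[_ y1 _]; have := d y; rewrite !inE y1 y2.
have -> : ([set x; y] \in E2) = false.
  by apply/negP => /(wf_adj w2)[x2 _ _]; have := d x; rewrite !inE x1 x2.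
by case: t; rewrite ?inE //; apply/imset2P; exists x y.
Qed.

(** The empty graph is not a cograph, but it occurs as the part left over when an invariant set is
    the whole vertex set. *)
Definition cograph0 V E := cograph V E \/ V = set0 /\ E = set0.

Lemma cograph0_wf V E : cograph0 V E -> wf V E.
Proof. by case=> [/cograph_wf //|[_ ->] e]; rewrite inE. Qed.

Lemma cograph0_neq0 V E v : v \in V -> cograph0 V E -> cograph V E.
Proof. by move=> vV [//|[V0 _]]; rewrite V0 inE in vV. Qed.

Lemma glue0r t V1 V2 E1 : V2 = set0 -> glue t V1 V2 E1 set0 = E1.
Proof.
move=> ->; rewrite /glue setU0; case: t; rewrite ?setU0 //.
apply/setP => e; rewrite inE; apply/orb_idr => /imset2P[a b _].
by rewrite inE.
Qed.

Lemma glue0l t V1 V2 E2 : V1 = set0 -> glue t V1 V2 set0 E2 = E2.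
Proof.
move=> ->; rewrite /glue set0U; case: t; rewrite ?setU0 //.
apply/setP => e; rewrite inE; apply/orb_idr => /imset2P[a b].
by rewrite inE.
Qed.

Lemma cograph0_glue t V1 V2 E1 E2 : [disjoint V1 & V2] -> cograph0 V1 E1 ->
  cograph0 V2 E2 -> cograph0 (V1 :|: V2) (glue t V1 V2 E1 E2).
Proof.
move=> d [c1|[e1 ->]] [c2|[e2 ->]]; first by left; apply: cograph_glue.
- by rewrite glue0r // e2 setU0; left.
- by rewrite glue0l // e1 set0U; left.
by rewrite glue0l // e1 e2 set0U; right.
Qed.

Definition induced E S := [set e in E | e \subset S].

Lemma adj_induced E S x y : adj (induced E S) x y = [&& adj E x y, x \in S & y \in S].
Proof. by rewrite /adj inE subUset !sub1set. Qed.

Lemma wf_induced V E S : wf V E -> wf (S :&: V) (induced E S).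
Proof.
move=> w e; rewrite inE => /andP[/w[x [y [xV yV xy ->]]]].
rewrite subUset !sub1set => /andP[xS yS]; exists x, y.
by rewrite !inE xS yS xV yV.
Qed.

Lemma wf_weaken V V' E : V \subset V' -> wf V E -> wf V' E.
Proof.
move=> VV' w e /w[x [y [xV yV xy ->]]]; exists x, y.
by rewrite !(subsetP VV').
Qed.

(** The restriction of a glued graph is the glue of the two restrictions, either of which may be
    empty; hence [cograph0]. *)
Lemma cograph0_induced V E S : cograph0 V E -> cograph0 (S :&: V) (induced E S).
Proof.
case=> [|[-> ->]]; last by right; rewrite setI0 /induced; split=> //; apply/setP => e; rewrite !inE.
elim/cograph_glue_ind => {V E} [x|t V1 V2 E1 E2 d c1 h1 c2 h2].
  have -> : induced set0 S = set0 by apply/setP => e; rewrite !inE.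
  have [xS|xS] := boolP (x \in S).
    by left; rewrite (setIidPr _) ?sub1set //; apply: cograph_vertex.
  by right; split=> //; apply/eqP; rewrite setI_eq0 disjoint_sym disjoints1.
have w1 := cograph_wf c1; have w2 := cograph_wf c2.
have d' : [disjoint S :&: V1 & S :&: V2].
  rewrite -setI_eq0 -subset0; move/disjoint_setI0: d => <-.
  by apply: setISS; apply: subsetIr.
have -> : induced (glue t V1 V2 E1 E2) S =
    glue t (S :&: V1) (S :&: V2) (induced E1 S) (induced E2 S); last first.
  by rewrite setIUr; apply: cograph0_glue.
apply: (@graph_ext (S :&: (V1 :|: V2))).
- exact/wf_induced/wf_glue.
- by rewrite setIUr; apply: wf_glue => //; apply: wf_induced.
have w1' := wf_induced (S := S) w1; have w2' := wf_induced (S := S) w2.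
move=> x y /setIP[xS /setUP[x1|x2]] /setIP[yS /setUP[y1|y2]]; rewrite adj_induced xS yS !andbT.
- by rewrite !adj_glue1 ?adj_induced ?xS ?yS ?andbT // !inE ?xS ?yS.
- by rewrite !adj_glue12 // !inE ?xS ?yS.
- by rewrite adjC [in RHS]adjC !adj_glue12 // !inE ?xS ?yS.
- by rewrite !adj_glue2 ?adj_induced ?xS ?yS ?andbT // !inE ?xS ?yS.
Qed.

(* A union of components (t = false) or of co-components (t = true). *)
Definition tclosed t V E S :=
  (S \subset V) && [forall x in S, forall y in V :\: S, adj E x y == t].

Lemma tclosedP t V E S : reflect
  (S \subset V /\ forall x y, x \in S -> y \in V -> y \notin S -> adj E x y = t)
  (tclosed t V E S).
Proof.
apply: (iffP andP) => -[SV h]; split=> //.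
  move=> x y xS yV yS; apply/eqP.
  by move/forall_inP: h => /(_ _ xS)/forall_inP; apply; rewrite !inE yS.
apply/forall_inP => x xS; apply/forall_inP => y /setDP[yV yS].
by rewrite h.
Qed.

Lemma tclosedI t V E S S' : tclosed t V E S -> tclosed t V E S' ->
  tclosed t V E (S :&: S').
Proof.
move=> /tclosedP[SV h] /tclosedP[SV' h']; apply/tclosedP; split.
  by apply: subset_trans SV; apply: subsetIl.
move=> x y /setIP[xS xS'] yV; rewrite inE negb_and => /orP[yS|yS]; first exact: h.
exact: h'.
Qed.

Lemma tclosedC t V E S : tclosed t V E S -> tclosed t V E (V :\: S).
Proof.
move=> /tclosedP[SV h]; apply/tclosedP; split; first exact: subsetDl.
move=> x y /setDP[xV xS] yV; rewrite inE yV andbT negbK => yS.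
by rewrite adjC h.
Qed.

Lemma tclosedT t V E : tclosed t V E V.
Proof. by apply/tclosedP; split=> // x y _ ->. Qed.

(* A graph and its complement are not both disconnected. *)
Lemma tclosed_excl t V E S S' : tclosed t V E S -> tclosed (~~ t) V E S' ->
  S != set0 -> S != V -> S' != set0 -> S' = V.
Proof.
move=> cS cS' S0 SV S'0; apply/eqP; apply: contraT => S'V.
(* A vertex in both sets and a vertex in neither would be adjacent both according to [t] and to
   [~~ t]. Complements are closed too, so among the four cells cut out by [S] and [S'] two opposite
   ones are never both inhabited. *)
have key (U U' : {set T}) x y : tclosed t V E U -> tclosed (~~ t) V E U' ->
    x \in U -> x \in U' -> y \in V -> y \notin U -> y \notin U' -> False.
  move=> /tclosedP[_ h] /tclosedP[_ h'] xU xU' yV yU yU'.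
  by have := h _ _ xU yV yU; rewrite h' //; case: (t).
have [SsV _] := tclosedP _ _ _ _ cS; have [S'sV _] := tclosedP _ _ _ _ cS'.
have [a aS] := set0Pn _ S0; have [b bS'] := set0Pn _ S'0.
have [c cV cS1] : exists2 c, c \in V & c \notin S.
  by apply/subsetPn; apply: contraNN SV => h; rewrite eqEsubset SsV.
have [c' cV' cS1'] : exists2 c, c \in V & c \notin S'.
  by apply/subsetPn; apply: contraNN S'V => h; rewrite eqEsubset S'sV.
have CS := tclosedC cS; have CS' := tclosedC cS'.
have aV := subsetP SsV _ aS; have bV := subsetP S'sV _ bS'.
have inC (U : {set T}) x : x \in V -> x \notin U -> x \in V :\: U by move=> xV xU; rewrite inE xU.
have ninC (U : {set T}) x : x \in U -> x \notin V :\: U by move=> xU; rewrite inE xU.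
have [aS'|aS'] := boolP (a \in S').
  have [cS''|cS''] := boolP (c \in S'); last by case: (key _ _ a c cS cS').
  have [c'S|c'S] := boolP (c' \in S); last by case: (key _ _ a c' cS cS').
  by case: (key _ _ c' c cS CS') => //; [exact: inC | exact: ninC].
have [cS''|cS''] := boolP (c \in S').
  by case: (key _ _ a c cS CS') => //; [exact: inC | exact: ninC].
have [bS|bS] := boolP (b \in S); first by case: (key _ _ b c cS cS').
by case: (key _ _ a b cS CS') => //; [exact: inC | exact: ninC].
Qed.

End Graphs.

(** * Decomposition of a pair along the hull of the marked vertex *)

Section Structures.
Variables (sym : bool) (T : finType).
Implicit Types (V W S Z : {set T}) (E : {set {set T}}) (x y v : T) (t : bool).
Implicit Types (s : {perm T}) (p : {set {set T}} * {perm T}).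

Lemma disjointD S V : [disjoint S & V :\: S].
Proof.
by rewrite -setI_eq0; apply/eqP/setP => x; rewrite !inE; case: (x \in S).
Qed.

Definition aut E s := [forall x, forall y, adj E (s x) (s y) == adj E x y].

Lemma autP E s : reflect (forall x y, adj E (s x) (s y) = adj E x y) (aut E s).
Proof.
apply: (iffP forallP) => h x; last by apply/forallP => y; rewrite h.
by move=> y; apply/eqP; move/forallP: (h x).
Qed.

Lemma aut_in V E s : wf V E -> perm_on V s ->
  (forall x y, x \in V -> y \in V -> adj E (s x) (s y) = adj E x y) -> aut E s.
Proof.
move=> w sV h; apply/autP => x y.
have [xV|xV] := boolP (x \in V); last first.
  rewrite (out_perm sV xV); apply/idP/idP => /(wf_adj w)[]; by rewrite (negPf xV).
have [yV|yV] := boolP (y \in V); first exact: h.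
rewrite (out_perm sV yV); apply/idP/idP => /(wf_adj w)[_]; by rewrite (negPf yV).
Qed.

(* The flag sym selects the counting problem: pairs (cograph, automorphism) for
   unlabeled cographs, cographs with the identity for labeled ones. *)
Definition strs V := [set p : {set {set T}} * {perm T} |
  [&& `[< cograph0 V p.1 >], perm_on V p.2, aut p.1 p.2 & sym || (p.2 == 1%g)]].

Lemma strsP V p : reflect
  [/\ cograph0 V p.1, perm_on V p.2, aut p.1 p.2 & sym || (p.2 == 1%g)] (p \in strs V).
Proof. by rewrite inE; apply: (iffP and4P) => -[h1 h2 h3 h4]; split=> //; apply/asboolP. Qed.

(** Stability under the permutation is required besides closedness so that the permutation splits
    into one on [S] and one on its complement. *)
Definition invt t V p S := tclosed t V p.1 S && [forall x in S, p.2 x \in S].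

Lemma stable_mem S s : [forall x in S, s x \in S] -> forall x, (s x \in S) = (x \in S).
Proof.
move/forall_inP => h x; have e : s @: S = S.
  apply/eqP; rewrite eqEcard card_imset ?leqnn ?andbT; last exact: perm_inj.
  by apply/subsetP => _ /imsetP[y yS ->]; apply: h.
by rewrite -{1}e mem_imset //; apply: perm_inj.
Qed.

Lemma invtI t V p S S' : invt t V p S -> invt t V p S' -> invt t V p (S :&: S').
Proof.
move=> /andP[c /stable_mem h] /andP[c' /stable_mem h']; rewrite /invt tclosedI //.
by apply/forall_inP => x; rewrite !inE h h'.
Qed.

Lemma invtC t V p S : p \in strs V -> invt t V p S -> invt t V p (V :\: S).
Proof.
move=> /strsP[_ pV _ _] /andP[c /stable_mem h]; rewrite /invt tclosedC //.
by apply/forall_inP => x; rewrite !inE h perm_closed.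
Qed.

Lemma invtT t V p : p \in strs V -> invt t V p V.
Proof.
move=> /strsP[_ pV _ _]; rewrite /invt tclosedT.
by apply/forall_inP => x; rewrite perm_closed.
Qed.

Definition hull t V v p := [arg min_(S < V | invt t V p S && (v \in S)) #|S|].

(** Invariant closed sets are stable under intersection, so one of least cardinality is contained in
    all the others. *)
Lemma hullP t V v p : p \in strs V -> v \in V ->
  [/\ invt t V p (hull t V v p), v \in hull t V v p &
      forall S, invt t V p S -> v \in S -> hull t V v p \subset S].
Proof.
move=> pV vV; rewrite /hull; case: arg_minnP => [|Z /andP[iZ vZ] min].
  by rewrite invtT.
split=> // S iS vS; have : #|Z| <= #|S :&: Z| by apply: min; rewrite invtI // inE vS.
move=> le; have /eqP <- : S :&: Z == Z by rewrite eqEcard subsetIr.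
exact: subsetIl.
Qed.

Definition irr t V v p := [forall S, (invt t V p S && (v \in S)) ==> (S == V)].

Lemma irrP t V v p :
  reflect (forall S, invt t V p S -> v \in S -> S = V) (irr t V v p).
Proof.
apply: (iffP forallP) => h S; first by move=> i vS; have := h S; rewrite i vS => /eqP.
by apply/implyP => /andP[i vS]; rewrite (h S).
Qed.

Definition gluep t Z W (q : ({set {set T}} * {perm T}) * ({set {set T}} * {perm T})) :=
  (glue t Z W q.1.1 q.2.1, (q.1.2 * q.2.2)%g).

Section Glue.
Variables (t : bool) (Z W : {set T}) (p1 p2 : {set {set T}} * {perm T}).
Hypotheses (dZW : [disjoint Z & W]) (h1 : p1 \in strs Z) (h2 : p2 \in strs W).

Let w1 : wf Z p1.1. Proof. by case/strsP: h1 => /cograph0_wf. Qed.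
Let w2 : wf W p2.1. Proof. by case/strsP: h2 => /cograph0_wf. Qed.

Lemma notin2 x : x \in Z -> x \notin W.
Proof. by move=> xZ; rewrite (disjointFr dZW). Qed.

Lemma notin1 x : x \in W -> x \notin Z.
Proof. by move=> xZ; rewrite (disjointFl dZW). Qed.

Lemma glue_perm1 x : x \in Z -> (gluep t Z W (p1, p2)).2 x = p1.2 x.
Proof.
case/strsP: h1 => _ s1 _ _; case/strsP: h2 => _ s2 _ _.
by move=> xZ; rewrite permM (out_perm s2) // notin2 // perm_closed.
Qed.

Lemma glue_perm2 x : x \in W -> (gluep t Z W (p1, p2)).2 x = p2.2 x.
Proof.
case/strsP: h1 => _ s1 _ _; case/strsP: h2 => _ s2 _ _.
by move=> xW; rewrite permM (out_perm s1) // notin1.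
Qed.

Lemma glue_strs : gluep t Z W (p1, p2) \in strs (Z :|: W).
Proof.
case/strsP: (h1) => c1 s1 a1 m1; case/strsP: (h2) => c2 s2 a2 m2.
have on12 : perm_on (Z :|: W) (p1.2 * p2.2)%g.
  by apply: perm_onM; [apply: subset_trans s1 _ | apply: subset_trans s2 _];
    [apply: subsetUl | apply: subsetUr].
apply/strsP; split=> //=; first exact: cograph0_glue; last first.
  by case: sym m1 m2 => //= /eqP -> /eqP ->; rewrite mulg1.
apply: (aut_in (wf_glue dZW w1 w2) on12) => x y.
have gp1 := glue_perm1; have gp2 := glue_perm2; rewrite /gluep /= in gp1 gp2.
move=> /setUP[xZ|xW] /setUP[yZ|yW].
- by rewrite !gp1 // !adj_glue1 // ?perm_closed //; apply: (autP _ _ a1).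
- by rewrite (gp1 x) // (gp2 y) // !adj_glue12 // ?perm_closed.
- by rewrite (gp1 y) // (gp2 x) // adjC [RHS]adjC !adj_glue12 // ?perm_closed.
- by rewrite !gp2 // !adj_glue2 // ?perm_closed //; apply: (autP _ _ a2).
Qed.

Lemma glue_invt : invt t (Z :|: W) (gluep t Z W (p1, p2)) Z.
Proof.
case/strsP: (h1) => c1 s1 a1 m1.
apply/andP; split; last by apply/forall_inP => x xZ; rewrite glue_perm1 // perm_closed.
apply/tclosedP; split; first exact: subsetUl.
move=> x y xZ /setUP[->//|yW] _; exact: adj_glue12.
Qed.

(** The hull lies in [Z] because [Z] is invariant. Being closed in the glued graph it is closed in
    [p1], and irreducibility makes it all of [Z]. *)
Lemma glue_irr v : v \in Z -> irr t Z v p1 ->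
  hull t (Z :|: W) v (gluep t Z W (p1, p2)) = Z.
Proof.
move=> vZ /irrP i1; have vV : v \in Z :|: W by rewrite inE vZ.
have [/andP[/tclosedP[_ cH] /forall_inP sH] vH min] := hullP t glue_strs vV.
have HZ := min _ glue_invt vZ; set H := hull _ _ _ _ in cH sH vH HZ *.
apply: i1 => //; apply/andP; split.
  apply/tclosedP; split=> // x y xH yZ yH.
  rewrite -(adj_glue1 t p1.1 dZW w2) // ?(subsetP HZ) //.
  by apply: cH => //; rewrite inE yZ.
apply/forall_inP => x xH; rewrite -glue_perm1 ?(subsetP HZ) //; exact: sH.
Qed.

Lemma glue_degree v : v \in Z ->
  degree (gluep t Z W (p1, p2)).1 v = degree p1.1 v + t * #|W|.
Proof.
move=> vZ; rewrite /degree /=.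
have -> : [set y | [set v; y] \in glue t Z W p1.1 p2.1] =
    [set y | [set v; y] \in p1.1] :|: (if t then W else set0).
  have adjE E y : (y \in [set y | [set v; y] \in E]) = adj E v y by rewrite in_set.
  apply/setP => y; rewrite in_setU !adjE.
  have -> : (y \in (if t then W else set0)) = t && (y \in W) by case: t; rewrite ?inE.
  have [yZ|yZ] := boolP (y \in Z).
    by rewrite adj_glue1 // (negPf (notin2 yZ)) andbF orbF.
  have -> : adj p1.1 v y = false.
    by apply/negP => /(wf_adj w1)[_ yZ' _]; rewrite yZ' in yZ.
  have [yW|yW] := boolP (y \in W); first by rewrite adj_glue12 // andbT.
  apply/negP; rewrite andbF => /(wf_adj (wf_glue dZW w1 w2))[_].
  by rewrite inE (negPf yZ) (negPf yW).
rewrite cardsU [X in _ - X](_ : _ = 0) ?subn0; last first.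
  apply/eqP; rewrite cards_eq0 setI_eq0 disjoint_sym; case: t; last by rewrite -setI_eq0 set0I.
  apply/pred0P => y /=; apply/negP => /andP[yW]; rewrite inE => /(wf_adj w1)[_ yZ _].
  by rewrite (negPf (notin2 yZ)) in yW.
by case: t; rewrite ?mul1n ?mul0n ?cards0.
Qed.

Lemma glue_induced1 : induced (gluep t Z W (p1, p2)).1 Z = p1.1.
Proof.
have wg := wf_glue (t := t) dZW w1 w2.
apply: (@graph_ext _ Z) => //.
  by apply: wf_weaken (wf_induced (S := Z) wg); apply: subsetIl.
by move=> x y xZ yZ; rewrite adj_induced xZ yZ !andbT adj_glue1.
Qed.

Lemma glue_induced2 : induced (gluep t Z W (p1, p2)).1 W = p2.1.
Proof.
have wg := wf_glue (t := t) dZW w1 w2.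
apply: (@graph_ext _ W) => //.
  by apply: wf_weaken (wf_induced (S := W) wg); apply: subsetIl.
by move=> x y xZ yZ; rewrite adj_induced xZ yZ !andbT adj_glue2.
Qed.

End Glue.

Lemma gluep_inj t Z W : [disjoint Z & W] ->
  {in setX (strs Z) (strs W) &, injective (gluep t Z W)}.
Proof.
move=> d [p1 p2] [q1 q2] /setXP[/= h1 h2] /setXP[/= g1 g2] e.
have e1 : p1.1 = q1.1 by rewrite -(glue_induced1 t d h1 h2) e (glue_induced1 t d g1 g2).
have e2 : p2.1 = q2.1 by rewrite -(glue_induced2 t d h1 h2) e (glue_induced2 t d g1 g2).
have [_ s1 _ _] := strsP _ _ h1; have [_ s2 _ _] := strsP _ _ h2.
have [_ r1 _ _] := strsP _ _ g1; have [_ r2 _ _] := strsP _ _ g2.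
have e3 : p1.2 = q1.2.
  apply/permP => x; have [xZ|xZ] := boolP (x \in Z); last by rewrite !(out_perm _ xZ).
  by rewrite -(glue_perm1 t d h1 h2) // e (glue_perm1 t d g1 g2).
have e4 : p2.2 = q2.2.
  apply/permP => x; have [xW|xW] := boolP (x \in W); last by rewrite !(out_perm _ xW).
  by rewrite -(glue_perm2 t d h1 h2) // e (glue_perm2 t d g1 g2).
by case: p1 p2 q1 q2 e1 e2 e3 e4 {h1 h2 g1 g2 s1 s2 r1 r2 e} => ? ? [? ?] [? ?] [? ?] /= -> -> -> ->.
Qed.

Definition restr p S : {set {set T}} * {perm T} := (induced p.1 S, restr_perm S p.2).

Lemma restr_perm_mem t V p S x : invt t V p S -> x \in S -> restr_perm S p.2 x = p.2 x.
Proof.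
move=> /andP[_ /stable_mem h] xS; apply: restr_permE => //.
by apply/astabsP => y; rewrite /= apermE h.
Qed.

Lemma restr_strs t V p S : p \in strs V -> invt t V p S -> restr p S \in strs S.
Proof.
move=> /strsP[c s a m] iS; have [/tclosedP[SV _] st] := andP iS.
have e : S :&: V = S by apply/setIidPl.
have c' : cograph0 S (induced p.1 S) by rewrite -{1}e; apply: cograph0_induced.
apply/strsP; split=> //=; first exact: restr_perm_on; last first.
  by case: sym m => //= /eqP ->; rewrite morph1.
apply: (aut_in (cograph0_wf c')); first exact: restr_perm_on.
move=> x y xS yS; rewrite !(restr_perm_mem iS) // !adj_induced !(stable_mem st) xS yS !andbT.
exact: (autP _ _ a).
Qed.

Lemma glue_restr t V p S : p \in strs V -> invt t V p S ->
  gluep t S (V :\: S) (restr p S, restr p (V :\: S)) = p.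
Proof.
move=> hp iS; have iC := invtC hp iS; have [c s a m] := strsP _ _ hp.
have [/tclosedP[SV cS] st] := andP iS.
have d : [disjoint S & V :\: S] by exact: disjointD.
have VE : S :|: V :\: S = V by rewrite -{1}(setIidPr SV) setID.
have r1 := restr_strs hp iS; have r2 := restr_strs hp iC.
have w1 : wf S (restr p S).1 by case/strsP: r1 => /cograph0_wf.
have w2 : wf (V :\: S) (restr p (V :\: S)).1 by case/strsP: r2 => /cograph0_wf.
have gs := glue_strs t d r1 r2; rewrite VE in gs.
have [cg sgl _ _] := strsP _ _ gs.
rewrite [RHS]surjective_pairing; congr (_, _).
  apply: (@graph_ext _ V) => //; [exact: cograph0_wf | exact: cograph0_wf |].
  move=> x y; rewrite -{1 2}VE => /setUP[xS|xC] /setUP[yS|yC].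
  - by rewrite adj_glue1 // adj_induced xS yS !andbT.
  - rewrite adj_glue12 //; case/setDP: yC => yV yS; by rewrite cS.
  - rewrite adjC adj_glue12 //; case/setDP: xC => xV xS; by rewrite adjC cS.
  - by rewrite adj_glue2 // adj_induced xC yC !andbT.
apply/permP => x; have [xV|xV] := boolP (x \in V); last first.
  by rewrite (out_perm s xV); apply: (out_perm sgl xV).
move: xV; rewrite -{1}VE => /setUP[xS|xC].
  by have := glue_perm1 t d r1 r2 xS; rewrite /= => ->; rewrite (restr_perm_mem iS).
by have := glue_perm2 t d r1 r2 xC; rewrite /= => ->; rewrite (restr_perm_mem iC).
Qed.

Definition nstr V v d := #|[set p in strs V | degree p.1 v == d]|.
Definition nirr t V v d := #|[set p in strs V | irr t V v p && (degree p.1 v == d)]|.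

(** Cutting along the hull is a bijection with inverse [gluep]: minimality of the hull is exactly
    irreducibility of the restriction to it. *)
Lemma card_hull t V Z v d : Z \subset V -> v \in Z ->
  #|[set p in strs V | (hull t V v p == Z) && (degree p.1 v == d)]| =
  if t * #|V :\: Z| <= d then nirr t Z v (d - t * #|V :\: Z|) * #|strs (V :\: Z)| else 0.
Proof.
move=> ZV vZ; set W := V :\: Z.
have dis : [disjoint Z & W] by exact: disjointD.
have VE : Z :|: W = V by rewrite -{1}(setIidPr ZV) setID.
pose A := [set p in strs Z | irr t Z v p && (degree p.1 v + t * #|W| == d)].
have -> : [set p in strs V | (hull t V v p == Z) && (degree p.1 v == d)] =
    gluep t Z W @: setX A (strs W).
  apply/setP => p; apply/idP/imsetP.
    rewrite inE => /and3P[hp /eqP hZ /eqP dp].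
    have vV := subsetP ZV _ vZ.
    have [iZ _ min] := hullP t hp vV; rewrite hZ in iZ min.
    have r1 := restr_strs hp iZ; have r2 := restr_strs hp (invtC hp iZ).
    exists (restr p Z, restr p W); last by rewrite glue_restr.
    rewrite inE /= r2 andbT inE r1 /=; apply/andP; split; last first.
      by rewrite -(glue_degree t dis r1 r2) // glue_restr // dp.
    apply/irrP => S /andP[/tclosedP[SZ cS] /forall_inP sS] vS.
    apply/eqP; rewrite eqEsubset SZ /=; apply: min => //.
    have [/tclosedP[_ cZ] stZ] := andP iZ.
    apply/andP; split.
      apply/tclosedP; split; first exact: subset_trans SZ ZV.
      move=> x y xS yV yS; have xZ := subsetP SZ _ xS.
      have [yZ|yZ] := boolP (y \in Z); last exact: cZ.
      by have := cS _ _ xS yZ yS; rewrite adj_induced xZ yZ !andbT.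
    apply/forall_inP => x xS; have xZ := subsetP SZ _ xS.
    by have := sS _ xS; rewrite /= (restr_perm_mem iZ).
  case=> -[p1 p2] /setXP[/=]; rewrite inE => /and3P[h1 i1 d1] h2 ->.
  rewrite inE -VE glue_strs //= glue_irr // eqxx /=.
  by have := glue_degree t dis h1 h2 vZ; rewrite /= => ->.
rewrite card_in_imset; last first.
  move=> [p1 p2] [q1 q2] /setXP[/=]; rewrite inE => /andP[h1 _] h2.
  move=> /setXP[/=]; rewrite inE => /andP[g1 _] g2.
  by apply: gluep_inj => //; apply/setXP.
rewrite cardsX; case: leqP => dW; last first.
  rewrite (_ : A = set0) ?cards0 //; apply/setP => p; rewrite !inE.
  by apply/negP => /and3P[_ _ /eqP e]; move: dW; rewrite -e ltnNge leq_addl.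
congr (_ * _); apply: eq_card => p; rewrite !inE; do 2 congr (_ && _).
by rewrite -[RHS](eqn_add2r (t * #|W|)) subnK.
Qed.

(* The part W outside the hull of v is an arbitrary pair; joining it adds
   t * #|W| to the degree of v. *)
Lemma nstr_decomp t V v d : v \in V ->
  nstr V v d = \sum_(W : {set T} | W \subset V :\ v)
    if t * #|W| <= d then nirr t (V :\: W) v (d - t * #|W|) * #|strs W| else 0.
Proof.
move=> vV; rewrite /nstr -sum1_card.
rewrite (partition_big (hull t V v) (fun Z => (Z \subset V) && (v \in Z))) /=; last first.
  move=> p; rewrite inE => /andP[hp _]; have [iZ -> _] := hullP t hp vV.
  by have /andP[/tclosedP[->]] := iZ.
rewrite (reindex_onto (fun W => V :\: W) (fun Z => V :\: Z)) /=; last first.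
  by move=> Z /andP[ZV _]; rewrite setDDr setDv set0U (setIidPr ZV).
apply: eq_big => [W|W /andP[/andP[WV vW] /eqP eW]].
  rewrite subsetDl inE vV andbT /= setDDr setDv set0U subsetD1.
  rewrite andbC; congr (_ && _); apply/eqP/idP => [<-|/setIidPr //]; exact: subsetIl.
have := card_hull t d WV vW; rewrite eW => <-; rewrite -sum1_card.
by apply: eq_bigl => p; rewrite !inE -andbA; congr (_ && _); rewrite andbC.
Qed.

End Structures.

(** Comparison along an injective correspondence, for maps that are described by a property because
    their value depends on choices. *)
Lemma leq_card_rel (A B : finType) (P : {set A}) (Q : {set B}) (R : A -> B -> Prop) :
  (forall a, a \in P -> exists2 b, b \in Q & R a b) ->
  (forall a a' b, a \in P -> a' \in P -> R a b -> R a' b -> a = a') ->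
  #|P| <= #|Q|.
Proof.
move=> ex inj; pose g a := [pick b in Q | `[< R a b >]].
have gP a : a \in P -> exists b, [/\ g a = Some b, b \in Q & R a b].
  move=> aP; rewrite /g; case: pickP => [b /andP[bQ /asboolP r]|no]; first by exists b.
  by have [b bQ r] := ex a aP; have /asboolP := r; have := no b; rewrite /= bQ /= => ->.
rewrite -(card_in_imset (f := g)); last first.
  move=> a a' aP aP'; have [b [-> bQ r]] := gP _ aP; have [b' [-> bQ' r']] := gP _ aP'.
  by case=> e; apply: inj r _ => //; rewrite e.
have Si : injective (@Some B) by move=> x y [].
rewrite -(card_imset (mem Q) Si); apply: subset_leq_card.
by apply/subsetP => _ /imsetP[a aP ->]; have [b [-> bQ r]] := gP _ aP; apply: imset_f.
Qed.

(** * Counts depend only on the number of vertices *)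

Section Transport.
Variables (T T' : finType) (f : T -> T').
Implicit Types (V : {set T}) (E : {set {set T}}) (x y : T).

Definition map_graph E : {set {set T'}} := [set f @: e | e : {set T} in E].

Lemma imset_set2 x y : f @: [set x; y] = [set f x; f y].
Proof. by rewrite imsetU1 imset_set1. Qed.

Lemma wf_map_graph V E : {in V &, injective f} -> wf V E -> wf (f @: V) (map_graph E).
Proof.
move=> fi w _ /imsetP[e /w[x [y [xV yV xy ->]]] ->]; exists (f x), (f y).
rewrite imset_set2 !imset_f //; split=> //.
by apply: contraNneq xy => /fi ->.
Qed.

Lemma adj_map_graph V E x y : {in V &, injective f} -> wf V E -> x \in V -> y \in V ->
  adj (map_graph E) (f x) (f y) = adj E x y.
Proof.
move=> fi w xV yV; apply/idP/idP; last by move=> h; rewrite /adj -imset_set2 imset_f.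
case/imsetP => e eE; have [a [b [aV bV ab ee]]] := w _ eE.
rewrite ee imset_set2 => /set2_inj[[/fi xa /fi yb]|[/fi xa /fi yb]].
  by rewrite /adj xa // yb // -ee.
by rewrite /adj xa // yb // setUC -ee.
Qed.

Lemma cograph_map_graph V E : {in V &, injective f} -> cograph V E -> cograph (f @: V) (map_graph E).
Proof.
move=> fi c; elim/cograph_glue_ind: c fi => {V E} [x|t V1 V2 E1 E2 d c1 h1 c2 h2] fi.
  by rewrite imset_set1 /map_graph imset0; apply: cograph_vertex.
have f1 : {in V1 &, injective f} by move=> x y x1 y1; apply: fi; rewrite inE ?x1 ?y1.
have f2 : {in V2 &, injective f} by move=> x y x1 y1; apply: fi; rewrite inE ?x1 ?y1 orbT.
have d' : [disjoint f @: V1 & f @: V2].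
  rewrite -setI_eq0; apply/eqP/setP => z; rewrite !inE; apply/negP => /andP[/imsetP[x x1 ->]].
  case/imsetP => y y2 /fi xy; have e : x = y by apply: xy; rewrite inE ?x1 ?y2 ?orbT.
  by rewrite -e (disjointFr d x1) in y2.
rewrite imsetU; have -> : map_graph (glue t V1 V2 E1 E2) = glue t (f @: V1) (f @: V2) (map_graph E1) (map_graph E2).
  rewrite /map_graph /glue !imsetU; congr (_ :|: _); case: t; last by rewrite imset0.
  apply/setP => e; apply/imsetP/imset2P.
    case=> _ /imset2P[x y x1 y2 ->] ->; exists (f x) (f y); rewrite ?imset_f //.
    exact: imset_set2.
  case=> _ _ /imsetP[x x1 ->] /imsetP[y y2 ->] ->; exists [set x; y]; last by rewrite imset_set2.
  by apply/imset2P; exists x y.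
by apply: cograph_glue => //; [apply: h1 | apply: h2].
Qed.

Lemma cograph0_map_graph V E : {in V &, injective f} -> cograph0 V E -> cograph0 (f @: V) (map_graph E).
Proof.
move=> fi [c|[-> ->]]; first by left; apply: cograph_map_graph.
by right; rewrite /map_graph !imset0.
Qed.

Lemma map_graph_inj V E E' : {in V &, injective f} -> wf V E -> wf V E' -> map_graph E = map_graph E' -> E = E'.
Proof.
move=> fi w w' e; apply: (@graph_ext _ V) => // x y xV yV.
by rewrite -(adj_map_graph fi w) // e (adj_map_graph fi w').
Qed.

Lemma degree_map_graph V E x : {in V &, injective f} -> wf V E -> x \in V ->
  degree (map_graph E) (f x) = degree E x.
Proof.
move=> fi w xV; rewrite /degree.
have nV y : [set x; y] \in E -> y \in V by move=> /(wf_adj w)[].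
have -> : [set z | [set f x; z] \in map_graph E] = f @: [set y | [set x; y] \in E].
  apply/setP => z; rewrite inE; apply/idP/imsetP.
    move=> h; have [_ /imsetP[y yV zy] _] := wf_adj (wf_map_graph fi w) h.
    exists y => //; rewrite inE -/(adj E x y) -(adj_map_graph fi w) //.
    by rewrite -zy.
  by case=> y; rewrite inE => xy ->; rewrite -imset_set2 imset_f.
by apply: card_in_imset => y z; rewrite !inE => /nV yV /nV zV; apply: fi.
Qed.

End Transport.

Section TransportStrs.
Variables (sym : bool) (T T' : finType) (f : T -> T') (f' : T' -> T).
Variables (V : {set T}) (V' : {set T'}).
Hypotheses (fK : {in V, cancel f f'}) (f'K : {in V', cancel f' f}).
Hypotheses (fV : forall x, x \in V -> f x \in V') (f'V : forall y, y \in V' -> f' y \in V).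

Lemma transport_inj : {in V &, injective f}.
Proof. by move=> x y xV yV e; rewrite -(fK xV) e fK. Qed.

Lemma transport_img : f @: V = V'.
Proof.
apply/setP => y; apply/imsetP/idP => [[x xV ->]|yV]; first exact: fV.
by exists (f' y); rewrite ?f'V ?f'K.
Qed.

Definition transport_fun (s : {perm T}) y := if y \in V' then f (s (f' y)) else y.

Lemma transport_fun_inj s : perm_on V s -> injective (transport_fun s).
Proof.
move=> sV y z; rewrite /transport_fun.
have st w : w \in V' -> f (s (f' w)) \in V'.
  by move=> wV; apply: fV; rewrite perm_closed // f'V.
have [yV|yV] := boolP (y \in V'); have [zV|zV] := boolP (z \in V') => // e.
- have := transport_inj _ _ e; rewrite !perm_closed // !f'V // => /(_ isT isT) /perm_inj e'.
  by rewrite -(f'K yV) e' f'K.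
- by rewrite -e st in zV.
- by rewrite e st in yV.
Qed.

(** An inequality suffices: the inverse bijection gives the reverse one. *)
Lemma nstr_transport_le v d : v \in V -> nstr sym V v d <= nstr sym V' (f v) d.
Proof.
move=> vV; have fi := transport_inj.
pose R (p : {set {set T}} * {perm T}) (q : {set {set T'}} * {perm T'}) :=
  q.1 = map_graph f p.1 /\ forall x, x \in V -> q.2 (f x) = f (p.2 x).
apply: (@leq_card_rel _ _ _ _ R) => [p|p p' q].
  rewrite in_set => /andP[/strsP[c s a m] /eqP dp].
  exists (map_graph f p.1, perm (transport_fun_inj s)); last first.
    by split=> // x xV; rewrite permE /transport_fun fV // fK.
  have c' := cograph0_map_graph fi c; rewrite transport_img in c'.
  have on' : perm_on V' (perm (transport_fun_inj s)).
    by apply/subsetP => y; rewrite inE permE /transport_fun; case: ifP => //; rewrite eqxx.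
  rewrite in_set /= (degree_map_graph fi (cograph0_wf c)) // dp eqxx andbT; apply/strsP; split=> //=; last first.
    case: sym m => //= /eqP p1; apply/eqP/permP => y; rewrite permE perm1 /transport_fun p1 perm1.
    by case: ifP => // yV; rewrite f'K.
  apply: (aut_in (cograph0_wf c') on') => y z yV zV.
  rewrite !permE /transport_fun yV zV -[y in RHS]f'K // -[z in RHS]f'K //.
  rewrite !(adj_map_graph fi (cograph0_wf c)) ?perm_closed ?f'V //; exact: (autP _ _ a).
rewrite in_set => /andP[/strsP[c s a m] _]; rewrite in_set => /andP[/strsP[c' s' a' m'] _].
move=> [e1 e2] [e1' e2'].
have h1 : p.1 = p'.1.
  by apply: (map_graph_inj fi (cograph0_wf c) (cograph0_wf c')); rewrite -e1.
have h2 : p.2 = p'.2.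
  apply/permP => x; have [xV|xV] := boolP (x \in V); last by rewrite !(out_perm _ xV).
  by apply: fi; rewrite ?perm_closed // -e2 // e2'.
by case: p p' h1 h2 {c s a m c' s' a' m' e1 e2 e1' e2'} => ? ? [? ?] /= -> ->.
Qed.

End TransportStrs.

Section Bijection.
Variables (T T' : finType) (V : {set T}) (V' : {set T'}) (v : T) (v' : T').
Hypotheses (vV : v \in V) (vV' : v' \in V') (cV : #|V| = #|V'|).

(** Matches the enumerations of the two punctured sets and sends [v] to [v']. The same formula with
    the roles exchanged is the inverse. *)
Definition set_map x := if x == v then v' else nth v' (enum (V' :\ v')) (index x (enum (V :\ v))).

Lemma set_map_v : set_map v = v'.
Proof. by rewrite /set_map eqxx. Qed.

Lemma set_map_size : size (enum (V :\ v)) = size (enum (V' :\ v')).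
Proof.
rewrite -!cardE; move: (cardsD1 v V) (cardsD1 v' V'); rewrite vV vV' cV => -> [].
by [].
Qed.

Lemma set_map_neq x : x \in V -> x != v -> set_map x \in V' :\ v'.
Proof.
move=> xV xv; rewrite /set_map (negPf xv) -mem_enum mem_nth // -set_map_size index_mem.
by rewrite mem_enum !inE xv.
Qed.

Lemma set_map_in x : x \in V -> set_map x \in V'.
Proof.
move=> xV; have [->|xv] := eqVneq x v; first by rewrite set_map_v.
by have := set_map_neq xV xv; rewrite inE => /andP[].
Qed.

End Bijection.

Lemma set_mapK (T T' : finType) (V : {set T}) (V' : {set T'}) v v' :
  v \in V -> v' \in V' -> #|V| = #|V'| ->
  {in V, cancel (set_map V V' v v') (set_map V' V v' v)}.
Proof.
move=> vV vV' cV x xV; have [->|xv] := eqVneq x v; first by rewrite !set_map_v.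
have := set_map_neq vV vV' cV xV xv; rewrite !inE => /andP[h _].
rewrite {1}/set_map (negPf h) /set_map (negPf xv) index_uniq ?enum_uniq //.
  by rewrite nth_index // mem_enum !inE xv.
by rewrite -(set_map_size vV vV' cV) index_mem mem_enum !inE xv.
Qed.

Lemma nstr_eq sym (T T' : finType) (V : {set T}) (V' : {set T'}) v v' d :
  v \in V -> v' \in V' -> #|V| = #|V'| -> nstr sym V v d = nstr sym V' v' d.
Proof.
move=> vV vV' cV; have cV' := esym cV.
have h1 := set_mapK vV vV' cV; have h2 := set_mapK vV' vV cV'.
have i1 := set_map_in vV vV' cV; have i2 := set_map_in vV' vV cV'.
have l1 := nstr_transport_le sym h1 h2 i1 i2 d vV.
have l2 := nstr_transport_le sym h2 h1 i2 i1 d vV'.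
by rewrite !set_map_v in l1 l2; apply/eqP; rewrite eqn_leq l1 l2.
Qed.

Section Counts.
Variable sym : bool.

Definition cnt n d := nstr sym [set: 'I_n.+1] ord0 d.
Definition irrcnt t n d := nirr sym t [set: 'I_n.+1] ord0 d.
(** The value 1 at 0 accounts for the empty graph, so the [j = 0] terms of the recurrences are not
    special. *)
Definition strcnt m := if m is m'.+1 then \sum_(d < m) cnt m' d else 1.

Section OneType.
Variable T : finType.
Implicit Types (V W : {set T}) (v : T).

Lemma nstrE V v n d : v \in V -> #|V| = n.+1 -> nstr sym V v d = cnt n d.
Proof. by move=> vV cV; apply: nstr_eq; rewrite ?inE // cardsT card_ord. Qed.

Lemma degree_lt V E v : wf V E -> v \in V -> degree E v < #|V|.
Proof.
move=> w vV; rewrite /degree; apply: proper_card; apply/properP; split.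
  by apply/subsetP => y; rewrite inE => /(wf_adj w)[].
exists v => //; rewrite inE; apply/negP => /(wf_adj w)[_ _].
by rewrite eqxx.
Qed.

Lemma card_strs V : #|strs sym V| = strcnt #|V|.
Proof.
have [->|/set0Pn[v vV]] := eqVneq V set0.
  rewrite cards0 /= (_ : strs sym set0 = [set (set0, 1%g)]) ?cards1 //.
  apply/setP => -[E s]; rewrite [in RHS]inE; apply/strsP/eqP => /= [[c s1 _ _]|[-> ->]].
    congr (_, _).
      by apply/setP => e; rewrite inE; apply/negP => /(cograph0_wf c)[x [y []]]; rewrite inE.
    by apply/permP => x; rewrite perm1 (out_perm s1) // inE.
  split; [by right | by rewrite perm_on1 | | by rewrite eqxx orbT].
  by apply/autP => x y; rewrite !perm1.
have : 0 < #|V| by apply/card_gt0P; exists v.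
case cV : #|V| => [//|n] _ /=.
rewrite -sum1_card (partition_big (fun p => inord (degree p.1 v) : 'I_n.+1) xpredT) //=.
apply: eq_bigr => d _; rewrite -(nstrE _ vV cV) /nstr -sum1_card; apply: eq_bigl => p.
rewrite [in RHS]inE; apply: andb_id2l => /strsP[c _ _ _].
have := degree_lt (cograph0_wf c) vV; rewrite cV => lt.
by rewrite -val_eqE /= inordK.
Qed.

Lemma sum_by_card (A : {set T}) (F : nat -> nat) :
  \sum_(W : {set T} | W \subset A) F #|W| = \sum_(j < #|A|.+1) 'C(#|A|, j) * F j.
Proof.
rewrite (partition_big (fun W : {set T} => inord #|W| : 'I_#|A|.+1) xpredT) //=.
apply: eq_bigr => j _; transitivity (#|[set W : {set T} | W \subset A & #|W| == j]| * F j);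
  last by rewrite cards_draws.
rewrite -[X in _ = X * _]sum1_card big_distrl /=; under [RHS]eq_bigr do rewrite mul1n.
apply: eq_big => [W|W /andP[WA /eqP <-]]; last by rewrite inordK // ltnS subset_leq_card.
rewrite inE; apply: andb_id2l => WA.
by rewrite -val_eqE /= inordK // ltnS subset_leq_card.
Qed.

End OneType.

(** Irreducibility is not transported: [nirr] is the [W = set0] term of [nstr_decomp], whose left
    side depends on the cardinality only, and the other terms are known by induction. *)
Lemma nirrE t n : forall (T : finType) (V : {set T}) v d, v \in V -> #|V| = n.+1 ->
  nirr sym t V v d = irrcnt t n d.
Proof.
elim/ltn_ind: n => n IH.
pose F d j := if t * j <= d then irrcnt t (n - j) (d - t * j) * strcnt j else 0.
have key (T : finType) (V : {set T}) v d : v \in V -> #|V| = n.+1 ->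
    cnt n d = nirr sym t V v d + \sum_(j < n) 'C(n, j.+1) * F d j.+1.
  move=> vV cV; rewrite -(nstrE d vV cV) (nstr_decomp sym t d vV).
  rewrite (bigD1 set0) ?sub0set //= cards0 muln0 leq0n setD0 subn0 card_strs cards0 muln1.
  congr (_ + _).
  have cVv : #|V :\ v| = n by have := cardsD1 v V; rewrite vV cV => -[].
  pose F' d j := if j is 0 then 0 else F d j.
  rewrite (eq_bigr (fun W : {set T} => F' d #|W|)) => [|W /andP[WV W0]]; last first.
    have : 0 < #|W| by rewrite card_gt0.
    case cW : #|W| => [//|j] _; rewrite /F' /F -cW; case: ifP => // _.
    rewrite card_strs; congr (_ * _).
    have [WV' vW] := subsetD1P WV.
    apply: IH; first by rewrite cW; have := subset_leq_card WV; rewrite cVv cW; lia.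
      by rewrite inE vV vW.
    rewrite cardsD (setIidPr WV') cV; have := subset_leq_card WV; rewrite cVv; lia.
  transitivity (\sum_(W : {set T} | W \subset V :\ v) F' d #|W|).
    by rewrite [RHS](bigD1 set0) ?sub0set //= cards0.
  rewrite sum_by_card cVv big_ord_recl /= muln0 add0n.
  by apply: eq_bigr => i _.
move=> T V v d vV cV; apply/eqP.
rewrite -(eqn_add2r (\sum_(j < n) 'C(n, j.+1) * F d j.+1)) -key //.
by rewrite -key ?inE ?cardsT ?card_ord.
Qed.

Lemma cnt_rec (t : bool) n d : cnt n d = \sum_(j < n.+1)
  'C(n, j) * (if t * j <= d then irrcnt t (n - j) (d - t * j) * strcnt j else 0).
Proof.
rewrite /cnt (nstr_decomp sym t d (in_setT ord0)).
have cV : #|[set: 'I_n.+1] :\ ord0| = n.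
  by have := cardsD1 (ord0 : 'I_n.+1) setT; rewrite inE cardsT card_ord => -[].
pose F j := if t * j <= d then irrcnt t (n - j) (d - t * j) * strcnt j else 0.
transitivity (\sum_(W : {set 'I_n.+1} | W \subset setT :\ ord0) F #|W|); last first.
  by rewrite sum_by_card cV.
apply: eq_bigr => W WV; rewrite /F.
case: ifP => // _; rewrite card_strs; congr (_ * _).
have le := subset_leq_card WV; rewrite cV in le.
have [_ vW] := subsetD1P WV.
apply: nirrE; first by rewrite !inE vW.
by have e := cardsC W; rewrite card_ord in e; rewrite setTD -subSn //; apply/esym/eqP; rewrite -(eqn_add2l #|W|) e subnKC // (leq_trans le).
Qed.

Lemma irrcnt_gt t n d : n < d -> irrcnt t n d = 0.
Proof.
move=> nd; apply/eqP; rewrite cards_eq0; apply/eqP/setP => p; rewrite !inE.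
apply/negP => /and3P[/and4P[/asboolP c _ _ _] _ /eqP e].
have := degree_lt (cograph0_wf c) (in_setT ord0); rewrite cardsT card_ord e; lia.
Qed.

End Counts.

(** * Pairs irreducible for both union and join *)

Section Core.
Variables (sym : bool) (T : finType).
Implicit Types (V S : {set T}) (E : {set {set T}}) (v : T) (t : bool).
Implicit Types (p : {set {set T}} * {perm T}).

Lemma cograph_closed V E v : cograph V E -> v \in V -> 1 < #|V| ->
  exists t S, [/\ tclosed t V E S, v \in S & S != V].
Proof.
elim/cograph_glue_ind => {V E} [x|t V1 V2 E1 E2 d c1 _ c2 _]; first by rewrite cards1.
move=> vV _; have w1 := cograph_wf c1; have w2 := cograph_wf c2.
have c : tclosed t (V1 :|: V2) (glue t V1 V2 E1 E2) V1.
  apply/tclosedP; split; first exact: subsetUl.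
  by move=> x y x1 /setUP[->//|y2] _; exact: adj_glue12.
have [a a1] := set0Pn _ (cograph_neq0 c1); have [b b2] := set0Pn _ (cograph_neq0 c2).
have b1 : b \notin V1 by rewrite (disjointFl d).
have a2 : a \notin V2 by rewrite (disjointFr d).
have [v1|v1] := boolP (v \in V1).
  exists t, V1; split=> //; apply: contraNneq b1 => ->.
  by rewrite inE b2 orbT.
exists t, ((V1 :|: V2) :\: V1); split; first exact: tclosedC; first by rewrite inE v1.
apply/eqP => /setP /(_ a); rewrite !inE a1 //.
Qed.

Lemma irr_small t V v p : v \in V -> #|V| <= 1 -> irr t V v p.
Proof.
move=> vV cV; apply/irrP => S /andP[/tclosedP[SV _] _] vS.
by apply/eqP; rewrite eqEcard SV (leq_trans cV) // (cardD1 v) vS.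
Qed.

Lemma irr_neg t V v p S : tclosed t V p.1 S -> v \in S -> S != V -> irr (~~ t) V v p.
Proof.
move=> c vS SV; apply/irrP => S' /andP[c' _] vS'.
by apply: (tclosed_excl c c') SV _; apply/set0Pn; exists v.
Qed.

(** A cograph with at least two vertices has a proper closed set containing [v] for some [t]; by
    [tclosed_excl] the other kind then has only the whole set. *)
Lemma irr_or V v p : p \in strs sym V -> v \in V -> irr false V v p || irr true V v p.
Proof.
move=> /strsP[/(cograph0_neq0 _) c _ _ _] vV; have [cV|cV] := leqP #|V| 1.
  by rewrite irr_small.
have [[] [S [cS vS SV]]] := cograph_closed (c _ vV) vV cV.
  by rewrite (irr_neg cS).
by rewrite (irr_neg cS) ?orbT.
Qed.

Definition ncore V v d :=
  #|[set p in strs sym V | [&& irr false V v p, irr true V v p & degree p.1 v == d]]|.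

(** Inclusion-exclusion: by [irr_or] the two kinds of irreducible pairs cover everything, and
    [ncore] counts the overlap. This is the third relation, next to the two decompositions, that
    determines the series. *)
Lemma nstr_core V v d : v \in V ->
  nstr sym V v d + ncore V v d = nirr sym false V v d + nirr sym true V v d.
Proof.
move=> vV; rewrite /nirr.
set A := [set p in strs sym V | irr false V v p && _].
set B := [set p in strs sym V | irr true V v p && _].
rewrite -cardsUI; congr (_ + _); apply: eq_card => p; rewrite [LHS]in_set.
  rewrite in_setU !in_set -andb_orr -andb_orl; apply: andb_id2l => hp.
  by rewrite (@irr_or V v p) // in_set.
rewrite in_setI !in_set.
move: (irr false V v p) (irr true V v p) (degree p.1 v == d) => [] [] [];
  by rewrite /= ?andbT ?andbF ?andbb.
Qed.

End Core.

(** * Graphs with transitively permuted components *)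

Section Components.
Variables (T : finType) (t : bool).
Implicit Types (S : {set T}) (E : {set {set T}}) (x y : T) (s a : {perm T}).

(** With the identity as permutation the hull is the ordinary component or co-component of [x]. *)
Definition comp E x := hull t setT x (E, 1%g).

Section OneGraph.
Variable E : {set {set T}}.
Hypothesis cE : cograph [set: T] E.

Lemma strs1 : (E, 1%g) \in strs true setT.
Proof.
apply/strsP; split=> //=; [by left | exact: perm_on1 |].
by apply/autP => x y; rewrite !perm1.
Qed.

Lemma invt1 S : invt t setT (E, 1%g) S = tclosed t setT E S.
Proof.
by rewrite /invt /=; apply/andb_idr => _; apply/forall_inP => x; rewrite perm1.
Qed.

Lemma mem_comp x : x \in comp E x.
Proof. by have [] := hullP t strs1 (in_setT x). Qed.

Lemma comp_closed x : tclosed t setT E (comp E x).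
Proof. by have [] := hullP t strs1 (in_setT x); rewrite invt1. Qed.

Lemma comp_min x S : tclosed t setT E S -> x \in S -> comp E x \subset S.
Proof.
by move=> cS xS; have [_ _] := hullP t strs1 (in_setT x); apply; rewrite ?invt1.
Qed.

Lemma comp_eq x y : y \in comp E x -> comp E y = comp E x.
Proof.
move=> yx; have yC := comp_min (comp_closed x) yx.
apply/eqP; rewrite eqEsubset yC /=; apply: comp_min; first exact: comp_closed.
apply: contraT => xy.
have := comp_min (tclosedI (comp_closed x) (tclosedC (comp_closed y))).
move=> /(_ x); rewrite !inE mem_comp xy => /(_ isT)/subsetP/(_ y yx).
by rewrite !inE mem_comp andbF.
Qed.

Lemma comp_neq_adj x y : comp E x != comp E y -> adj E x y = t.
Proof.
move=> xy; have /tclosedP[_ h] := comp_closed x; apply: h; rewrite ?inE ?mem_comp //.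
by apply: contraNN xy => /comp_eq ->.
Qed.

Lemma autV a : aut E a -> aut E a^-1.
Proof.
move=> /autP h; apply/autP => x y.
by rewrite -[in RHS](permKV a x) -[in RHS](permKV a y) h.
Qed.

Lemma autX a i : aut E a -> aut E (a ^+ i)%g.
Proof.
move=> /autP h; elim: i => [|i /autP IH]; apply/autP => x y.
  by rewrite expg0 !perm1.
by rewrite expgS !permM IH h.
Qed.

Lemma tclosed_aut a S : aut E a -> tclosed t setT E S -> tclosed t setT E (a @: S).
Proof.
move=> /autP h /tclosedP[_ c]; apply/tclosedP; split; first exact: subsetT.
move=> _ y /imsetP[x xS ->] _ yS; rewrite -(permKV a y) h; apply: c; rewrite ?inE //.
by apply: contraNN yS => yS; apply/imsetP; exists (a^-1%g y); rewrite ?permKV.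
Qed.

Lemma comp_aut a x : aut E a -> comp E (a x) = a @: comp E x.
Proof.
move=> h; have le b z : aut E b -> comp E (b z) \subset b @: comp E z.
  move=> hb; apply: comp_min; first exact: tclosed_aut (comp_closed _).
  exact/imset_f/mem_comp.
apply/eqP; rewrite eqEcard le //= card_imset; last exact: perm_inj.
have := subset_leq_card (le _ (a x) (autV h)); rewrite permK card_imset //.
exact: perm_inj.
Qed.

End OneGraph.

(* Graphs whose automorphism group is transitive on the (at least two)
   components for t: union components if t = false, join components otherwise. *)
Definition transitive_comp E v := [/\ cograph [set: T] E, comp E v != setT &
  forall x, exists2 a, aut E a & a x \in comp E v].

(** The vertices that some power of the permutation brings into the component of [v] form an
    invariant closed set, hence are all the vertices. *)
Lemma irr_transitive_comp p v : p \in strs true [set: T] -> irr t setT v p ->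
  comp p.1 v != setT -> transitive_comp p.1 v.
Proof.
move=> /strsP[/(cograph0_neq0 (in_setT v)) c _ a _] /irrP i ne; split=> // x.
pose S := [set x | `[< exists i, (p.2 ^+ i)%g x \in comp p.1 v >]].
suff ST : S = setT.
  have := in_setT x; rewrite -ST inE => /asboolP[j xj].
  by exists (p.2 ^+ j)%g => //; apply: autX.
apply: i; last by rewrite inE; apply/asboolP; exists 0; rewrite expg0 perm1 mem_comp.
apply/andP; split.
  apply/tclosedP; split; first exact: subsetT.
  move=> y z; rewrite !inE => /asboolP[j yj] _ /asboolP zS.
  rewrite -(autP _ _ (autX j a)); have /tclosedP[_] := comp_closed c v; apply; rewrite ?inE //.
  by apply/negP => zj; apply: zS; exists j.
apply/forall_inP => y; rewrite !inE => /asboolP[j yj]; apply/asboolP.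
(* One more step of [p.2] makes the exponent [j] plus the order of [p.2], which acts as [j];
   negative powers are avoided. *)
exists (j + (#[p.2]%g).-1); rewrite -permM -expgS -addnS prednK ?order_gt0 //.
by rewrite expgD expg_order mulg1.
Qed.

Lemma card_comp E v x : transitive_comp E v -> #|comp E x| = #|comp E v|.
Proof.
case=> c _ /(_ x)[a ha xv]; rewrite -(comp_eq c xv) (comp_aut c) // card_imset //.
exact: perm_inj.
Qed.

Lemma card_comp_le E v : transitive_comp E v -> 2 * #|comp E v| <= #|T|.
Proof.
move=> h; have [c ne _] := h.
have [x _ xv] : exists2 x, x \in setT & x \notin comp E v.
  by apply/subsetPn; apply: contraNN ne => s; rewrite eqEsubset subsetT.
rewrite mul2n -addnn -{2}(card_comp x h) -cardsT -cardsUI.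
rewrite (_ : comp E v :&: comp E x = set0) ?cards0 ?addn0; first exact/subset_leq_card/subsetT.
apply/setP => y; rewrite !inE; apply/negP => /andP[yv yx].
by move: xv; rewrite -(comp_eq c yv) (comp_eq c yx) mem_comp.
Qed.

Definition blocks E := [set comp E x | x : T].

Lemma card_blocks E v : transitive_comp E v -> #|T| = #|blocks E| * #|comp E v|.
Proof.
move=> h; have [c _ _] := h.
rewrite -cardsT -[LHS]sum1_card (partition_big (comp E) (mem (blocks E))) /=; last first.
  by move=> x _; apply: imset_f.
rewrite -sum_nat_const; apply: eq_bigr => _ /imsetP[x _ ->].
rewrite -(card_comp x h) -sum1_card; apply: eq_bigl => y; rewrite in_setT /=.
apply/eqP/idP => [<-|]; [exact: mem_comp | exact: comp_eq].
Qed.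

(** All components are copies of the one of [v], their number is forced by the cardinality, and
    adjacency between different components is constant. So an isomorphism of one component extends
    to the whole graph. *)
Lemma transitive_comp_iso E E' v g : transitive_comp E v -> transitive_comp E' v ->
  {in comp E v &, injective g} -> g @: comp E v = comp E' v ->
  {in comp E v &, forall x y, adj E' (g x) (g y) = adj E x y} ->
  exists s : {perm T}, map_graph s E = E'.
Proof.
move=> hE hE' gi gK gadj; have [c ne tr] := hE; have [c' ne' tr'] := hE'.
set K := comp E v in gi gK gadj tr *; set K' := comp E' v in gK tr' *.
have cKK' : #|K| = #|K'| by rewrite -gK card_in_imset.
have K0 : 0 < #|K| by rewrite (cardD1 v) mem_comp.
have cB : #|blocks E| = #|blocks E'|.
  apply/eqP; rewrite -(eqn_pmul2r K0) -(card_blocks hE) {1}cKK'.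
  by rewrite -(card_blocks hE').
(* A chosen automorphism of [F] carrying the block [B] to [L]. It depends on the block and not on a
   vertex, so it is constant on each component. *)
pose rho (F : {set {set T}}) (L B : {set T}) : {perm T} :=
  odflt 1%g [pick a : {perm T} | aut F a && (a @: B == L)].
have rhoP F x : transitive_comp F v ->
    aut F (rho F (comp F v) (comp F x)) /\
    rho F (comp F v) (comp F x) @: comp F x = comp F v.
  case=> cF _ /(_ x)[a ha xv]; rewrite /rho; case: pickP => [b /andP[hb /eqP e]|] //=.
  by move=> /(_ a); rewrite ha -(comp_aut cF) // (comp_eq cF xv) eqxx.
pose be B := nth set0 (enum (blocks E')) (index B (enum (blocks E))).
have be_in x : be (comp E x) \in blocks E'.
  rewrite -mem_enum mem_nth // -cardE -cB cardE index_mem mem_enum.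
  exact: imset_f.
have be_inj x y : be (comp E x) = be (comp E y) -> comp E x = comp E y.
  have sz z : index (comp E z) (enum (blocks E)) < size (enum (blocks E')).
    by rewrite -cardE -cB cardE index_mem mem_enum imset_f.
  move/eqP; rewrite nth_uniq ?enum_uniq // => /eqP e.
  rewrite -(nth_index set0 (_ : comp E x \in enum (blocks E))) ?mem_enum ?imset_f //.
  by rewrite e nth_index // mem_enum imset_f.
pose r x := rho E K (comp E x); pose r' x := rho E' K' (be (comp E x)).
have rP x : aut E (r x) /\ r x @: comp E x = K by apply: rhoP.
have r'P x : aut E' (r' x) /\ r' x @: be (comp E x) = K'.
  by rewrite /r'; have /imsetP[y _ ->] := be_in x; apply: rhoP.
have rK x : r x x \in K by rewrite -(rP x).2 imset_f // mem_comp.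
(* Move [x] into the component of [v], apply [g], and move back to the block of [E'] matched with
   that of [x]. *)
pose G x := (r' x)^-1%g (g (r x x)).
have r'G x : r' x (G x) = g (r x x) by rewrite permKV.
have GB x : G x \in be (comp E x).
  have : g (r x x) \in r' x @: be (comp E x) by rewrite (r'P x).2 -gK imset_f.
  by case/imsetP => y yB e; rewrite /G e permK.
have compG x : comp E' (G x) = be (comp E x).
  have /imsetP[y _ e] := be_in x; rewrite e; apply: comp_eq => //.
  by rewrite -e.
have Gi : injective G.
  move=> x y e; have exy : comp E x = comp E y by apply: be_inj; rewrite -!compG e.
  have er : r x = r y by rewrite /r exy.
  have er' : r' x = r' y by rewrite /r' exy.
  have : g (r x x) = g (r y y) by rewrite -!r'G er' e.
  by move/gi => /(_ (rK x) (rK y)); rewrite er => /perm_inj.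
exists (perm Gi); have w := cograph_wf c; have w' := cograph_wf c'.
have pin : {in [set: T] &, injective (perm Gi)} by move=> x y _ _; apply: perm_inj.
have wr := wf_map_graph pin w.
apply: (@graph_ext _ setT) => //; first by apply: wf_weaken wr; apply: subsetT.
move=> x y _ _; rewrite -(permKV (perm Gi) x) -(permKV (perm Gi) y).
move: ((perm Gi)^-1%g x) ((perm Gi)^-1%g y) => {}x {}y.
rewrite (adj_map_graph pin w) ?inE // !permE.
have [exy|nexy] := eqVneq (comp E x) (comp E y); last first.
  rewrite !comp_neq_adj //; first by rewrite !compG; apply: contraNneq nexy => /be_inj ->.
have er : r x = r y by rewrite /r exy.
have er' : r' x = r' y by rewrite /r' exy.
rewrite -(autP _ _ (rP x).1) -(autP _ _ (r'P x).1 (G x)) r'G.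
by rewrite [in r' x (G y)]er' r'G [in r x y]er gadj.
Qed.

End Components.

(** * From pairs to labeled and unlabeled cographs *)

Section Burnside.
Variable n : nat.
Implicit Types (E : graph_on n) (C : {set graph_on n}) (s a : {perm 'I_n}).

Lemma perm_in_inj s : {in [set: 'I_n] &, injective s}.
Proof. by move=> x y _ _; apply: perm_inj. Qed.

Lemma perm_imT s : s @: [set: 'I_n] = setT.
Proof. by apply: im_perm_on; apply/subsetP. Qed.

Lemma relabelM s a E : relabel (s * a)%g E = relabel a (relabel s E).
Proof.
rewrite /relabel -imset_comp; apply: eq_imset => e /=.
by rewrite -imset_comp; apply: eq_imset => x /=; rewrite permM.
Qed.

Lemma relabel1 E : relabel 1%g E = E.
Proof.
rewrite /relabel (eq_imset (g := id)) ?imset_id // => e /=.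
by rewrite (eq_imset (g := id)) ?imset_id // => x; rewrite perm1.
Qed.

Lemma mem_labeled E : (E \in labeled_cographs n) <-> cograph [set: 'I_n] E.
Proof. by rewrite in_set; split=> /asboolP. Qed.

Lemma cograph_relabel s E : cograph [set: 'I_n] E -> cograph [set: 'I_n] (relabel s E).
Proof. by move=> c; have := cograph_map_graph (perm_in_inj (s := s)) c; rewrite perm_imT. Qed.

Lemma relabel_aut s E : cograph [set: 'I_n] E -> (relabel s E == E) = aut E s.
Proof.
move=> c; have w := cograph_wf c; have i := perm_in_inj (s := s).
have adjr x y : adj (relabel s E) (s x) (s y) = adj E x y.
  by rewrite (adj_map_graph i w) ?inE.
apply/eqP/autP => [e x y|h]; first by rewrite -[in LHS]e.
apply: (@graph_ext _ setT) => //; first exact/cograph_wf/cograph_relabel.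
by move=> x y _ _; rewrite -(permKV s x) -(permKV s y) adjr h.
Qed.

Lemma iso_class_refl E : E \in iso_class E.
Proof. by apply/imsetP; exists 1%g; rewrite ?relabel1. Qed.

Lemma iso_class_eq s E : iso_class (relabel s E) = iso_class E.
Proof.
apply/setP => F; apply/imsetP/imsetP => -[a _ ->].
  by exists (s * a)%g; rewrite ?relabelM.
by exists (s^-1 * a)%g => //; rewrite -relabelM mulgA mulgV mul1g.
Qed.

Lemma iso_class_mem E F : F \in iso_class E -> iso_class F = iso_class E.
Proof. by case/imsetP => s _ ->; apply: iso_class_eq. Qed.

(** The permutations sending [E] to a given [F] of its class form a coset of the automorphism group
    of [F]. *)
Lemma sum_aut_iso_class E : cograph [set: 'I_n] E ->
  \sum_(F in iso_class E) #|[set s | aut F s]| = n`!.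
Proof.
move=> c; transitivity (\sum_(F in iso_class E) \sum_(s | relabel s E == F) 1).
  apply: eq_bigr => _ /imsetP[s0 _ ->]; rewrite sum1dep_card.
  rewrite -(card_imset [set a | aut (relabel s0 E) a] (mulgI s0)).
  apply: eq_card => s; rewrite [RHS]in_set; apply/imsetP/eqP.
    case=> a; rewrite in_set -relabel_aut; last exact: cograph_relabel.
    by move=> /eqP e ->; rewrite relabelM e.
  move=> e; exists (s0^-1 * s)%g; last by rewrite mulgA mulgV mul1g.
  rewrite in_set -relabel_aut; last exact: cograph_relabel.
  by rewrite -relabelM mulgA mulgV mul1g e.
transitivity (\sum_(s : {perm 'I_n}) 1); last first.
  by rewrite sum1_card -[RHS]card_Sn; apply: eq_card => s; rewrite !inE.
rewrite [RHS](partition_big (fun s => relabel s E) (mem (iso_class E))) //= => s _.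
exact: imset_f.
Qed.

Lemma burnside (rep : {set graph_on n} -> graph_on n) (phi : graph_on n -> nat) :
  (forall C, C \in unlabeled_cographs n -> rep C \in C) ->
  (forall s E, cograph [set: 'I_n] E -> phi (relabel s E) = phi E) ->
  \sum_(E in labeled_cographs n) #|[set s | aut E s]| * phi E =
  n`! * \sum_(C in unlabeled_cographs n) phi (rep C).
Proof.
move=> repC inv; rewrite (partition_big (@iso_class n) (mem (unlabeled_cographs n))) /=; last first.
  by move=> E; apply: imset_f.
rewrite big_distrr /=; apply: eq_bigr => C hC; have rC := repC C hC.
case/imsetP: hC rC => E0 /mem_labeled c0 -> rC.
have phiE F : F \in iso_class E0 -> phi F = phi E0 by case/imsetP => s _ ->; apply: inv.
rewrite (phiE _ rC) -(sum_aut_iso_class c0) big_distrl /=.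
apply: eq_big => [E|E /andP[_ /eqP e]]; last by rewrite phiE // -e iso_class_refl.
apply/andP/idP => [[_ /eqP e]|hE]; first by rewrite -e iso_class_refl.
split; last by rewrite (iso_class_mem hE).
by apply/mem_labeled; case/imsetP: hE => s _ ->; apply: cograph_relabel.
Qed.

Lemma degree_relabel s E i : cograph [set: 'I_n] E ->
  degree (relabel s E) (s i) = degree E i.
Proof.
by move=> c; apply: (degree_map_graph (perm_in_inj (s := s)) (cograph_wf c)); rewrite inE.
Qed.

Definition deg_count d E := #|[set i | degree E i == d]|.

Lemma deg_count_relabel d s E : cograph [set: 'I_n] E ->
  deg_count d (relabel s E) = deg_count d E.
Proof.
move=> c; rewrite /deg_count -(card_imset [set i | degree E i == d] (@perm_inj _ s)).
apply: eq_card => i; rewrite inE; apply/idP/imsetP => [h|[j]].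
  by exists (s^-1%g i); rewrite ?permKV // inE -(degree_relabel s _ c) permKV.
by rewrite inE => h ->; rewrite degree_relabel.
Qed.

End Burnside.

Lemma strs_cograph sym n (p : graph_on n.+1 * {perm 'I_n.+1}) : p \in strs sym setT ->
  cograph [set: 'I_n.+1] p.1.
Proof. by case/strsP => /(cograph0_neq0 (in_setT ord0)). Qed.

Lemma perm_on_setT n (s : {perm 'I_n}) : perm_on setT s.
Proof. by apply/subsetP => x; rewrite inE. Qed.

Lemma sum_strs_true n (phi : graph_on n.+1 -> nat) :
  \sum_(p in strs true [set: 'I_n.+1]) phi p.1 =
  \sum_(E in labeled_cographs n.+1) #|[set s | aut E s]| * phi E.
Proof.
transitivity (\sum_(E in labeled_cographs n.+1) \sum_(s | aut E s) phi E).
  rewrite pair_big_dep /=; apply: eq_bigl => -[E s] /=.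
  apply/strsP/andP => /= [[c _ a _]|[/mem_labeled c a]].
    split=> //; apply/mem_labeled; exact: (cograph0_neq0 (in_setT ord0)).
  by split=> //; [left | exact: perm_on_setT].
by apply: eq_bigr => E _; rewrite sum_nat_const cardsE.
Qed.

Lemma sum_strs_false n (phi : graph_on n.+1 -> nat) :
  \sum_(p in strs false [set: 'I_n.+1]) phi p.1 =
  \sum_(E in labeled_cographs n.+1) phi E.
Proof.
rewrite (reindex_onto (fun E => (E, 1%g)) (fun p => p.1)) /=; last first.
  by move=> [E s] /strsP[_ _ _ /= /eqP ->].
apply: eq_bigl => E; rewrite eqxx andbT; apply/strsP/idP => /= [[c _ a _]|/mem_labeled c].
  apply/mem_labeled; exact: (cograph0_neq0 (in_setT ord0)).
split; [by left | exact: perm_on1 | | by []].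
by apply/autP => x y; rewrite !perm1.
Qed.

(** Double counting: by [nstrE] each of the [n.+1] vertices contributes as much as the marked
    one. *)
Lemma sum_deg_count sym n d :
  \sum_(p in strs sym [set: 'I_n.+1]) deg_count d p.1 = n.+1 * cnt sym n d.
Proof.
transitivity (\sum_(p in strs sym [set: 'I_n.+1]) \sum_i (degree p.1 i == d)).
  by apply: eq_bigr => p _; rewrite /deg_count -sum1_card big_mkcond; apply: eq_bigr => i _; rewrite inE; case: eqP.
rewrite exchange_big /= -[n.+1 in RHS]card_ord -sum_nat_const; apply: eq_bigr => i _.
have <- : nstr sym setT i d = cnt sym n d by apply: nstrE; rewrite ?inE // cardsT card_ord.
rewrite /nstr -sum1_card big_mkcond [in RHS]big_mkcond; apply: eq_bigr => p _.
by rewrite [in RHS]in_set; case: (p \in strs _ _); case: eqP.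
Qed.

Lemma labeled_count n d :
  \sum_(E in labeled_cographs n.+1) deg_count d E = n.+1 * cnt false n d.
Proof. by rewrite -sum_strs_false sum_deg_count. Qed.

(** The factor is [n]![and not]n.+1[!], as the choice of the vertex contributes [n.+1] on the other
    side. *)
Lemma unlabeled_count n d (rep : {set graph_on n.+1} -> graph_on n.+1) :
  (forall C, C \in unlabeled_cographs n.+1 -> rep C \in C) ->
  n`! * \sum_(C in unlabeled_cographs n.+1) deg_count d (rep C) = cnt true n d.
Proof.
move=> h; apply/eqP; rewrite -(eqn_pmul2l (ltn0Sn n)) -sum_deg_count sum_strs_true.
rewrite (burnside (phi := deg_count d) h); first by rewrite factS mulnA.
by move=> s E; apply: deg_count_relabel.
Qed.

Lemma exists_rep n : exists rep : {set graph_on n} -> graph_on n,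
  forall C, C \in unlabeled_cographs n -> rep C \in C.
Proof.
exists (fun C : {set graph_on n} => odflt set0 [pick E in C]) => C /imsetP[E _ ->].
by case: pickP => [F //|/(_ E)]; rewrite iso_class_refl.
Qed.

Lemma card_unlabeled n : #|unlabeled_cographs n.+1| * n.+1`! = strcnt true n.+1.
Proof.
have [rep h] := exists_rep n.+1.
have := sum_strs_true (fun _ : graph_on n.+1 => 1).
rewrite (burnside (phi := fun=> 1) h) // !sum1_card card_strs cardsT card_ord => ->.
exact: mulnC.
Qed.

(** * Few graphs have transitively permuted components *)

Section Bound.
Variables (n : nat) (t : bool).
Local Notation v0 := (ord0 : 'I_n.+1).
Implicit Types (E : graph_on n.+1) (C : {set graph_on n.+1}).

Definition tc_graphs : {set graph_on n.+1} := [set E | `[< transitive_comp t E v0 >]].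
Definition tc_classes := [set iso_class E | E in tc_graphs].
(** Picked inside [tc_graphs], so that transitivity of the representative needs no invariance
    argument. *)
Definition tc_rep C : graph_on n.+1 := odflt set0 [pick E in C | E \in tc_graphs].

Lemma tc_repP C : C \in tc_classes -> transitive_comp t (tc_rep C) v0 /\ C = iso_class (tc_rep C).
Proof.
case/imsetP => E hE ->; rewrite /tc_rep; case: pickP => [F /andP[hF]|].
  by rewrite inE => /asboolP h /=; rewrite (iso_class_mem hF).
by move/(_ E); rewrite hE iso_class_refl.
Qed.

(** By [transitive_comp_iso] a class is determined by the isomorphism type of the component of [v0]
    in its representative, here copied to ['I_m.+1]. *)
Lemma tc_classes_size m :
  #|[set C in tc_classes | #|comp t (tc_rep C) v0| == m.+1]| <= #|unlabeled_cographs m.+1|.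
Proof.
pose f C := set_map [set: 'I_m.+1] (comp t (tc_rep C) v0) ord0 v0.
pose R C (D : {set graph_on m.+1}) := D \in unlabeled_cographs m.+1 /\
  exists2 E0, E0 \in D & cograph setT E0 /\
    forall i j, adj (tc_rep C) (f C i) (f C j) = adj E0 i j.
have o0 : (ord0 : 'I_m.+1) \in [set: 'I_m.+1] by rewrite inE.
have fP C : C \in [set C in tc_classes | #|comp t (tc_rep C) v0| == m.+1] ->
    [/\ cograph setT (tc_rep C), v0 \in comp t (tc_rep C) v0 &
     #|comp t (tc_rep C) v0| = #|[set: 'I_m.+1]| ].
  rewrite inE => /andP[/tc_repP[[c _ _] _] /eqP e]; split=> //; first exact: mem_comp.
  by rewrite e cardsT card_ord.
apply: (@leq_card_rel _ _ _ _ R) => [C hC|C C' D hC hC' [hD [E0 ED [c0 a0]]] [_ [E0' ED' [c0' a0']]]].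
  have [c vK cK] := fP C hC; set K := comp _ _ _ in vK cK.
  have k1 := set_mapK vK o0 cK; have k2 := set_mapK o0 vK (esym cK).
  have k3 := set_map_in vK o0 cK; have k4 := set_map_in o0 vK (esym cK).
  have ij := transport_inj k1; have img := transport_img k2 k3 k4.
  have cs : cograph K (induced (tc_rep C) K).
    by apply: (cograph0_neq0 vK); rewrite -[X in cograph0 X _]setIT; apply: cograph0_induced; left.
  have c0 := cograph_map_graph ij cs; rewrite img in c0; set E0 := map_graph _ _ in c0.
  have hD : iso_class E0 \in unlabeled_cographs m.+1 by apply/imset_f/mem_labeled.
  exists (iso_class E0) => //; split=> //; exists E0; first exact: iso_class_refl.
  split=> // i j; have fK x : f C x \in K by apply: k4; rewrite inE.
  rewrite -[i in RHS](k2 i) ?inE // -[j in RHS](k2 j) ?inE //.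
  rewrite (adj_map_graph ij (cograph_wf cs)); [|exact: fK|exact: fK].
  by rewrite adj_induced -!/(f C _) !fK !andbT.
have [c vK cK] := fP C hC; set K := comp _ _ _ in vK cK.
have [c' vK' cK'] := fP C' hC'; set K' := comp _ _ _ in vK' cK'.
have [h e] := tc_repP (proj1 (andP (eq_ind _ is_true hC _ (in_set _ _)))).
have [h' e'] := tc_repP (proj1 (andP (eq_ind _ is_true hC' _ (in_set _ _)))).
have k1 := set_mapK vK o0 cK; have k3 := set_map_in vK o0 cK.
have k2' := set_mapK o0 vK' (esym cK'); have k4' := set_map_in o0 vK' (esym cK').
have [r _ er] : exists2 r, r \in [set: {perm 'I_m.+1}] & E0' = relabel r E0.
  have : E0' \in iso_class E0.
    case/imsetP: hD ED ED' => E1 _ -> /iso_class_mem -> //.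
  by case/imsetP => r _ ->; exists r.
pose g x := f C' (r (set_map K [set: 'I_m.+1] v0 ord0 x)).
have gi : {in K &, injective g}.
  move=> x y xK yK /(transport_inj k2'); rewrite !inE => /(_ isT isT)/perm_inj.
  exact: (transport_inj k1).
have gK : g @: K = K'.
  apply/eqP; rewrite eqEcard card_in_imset // cK cK' leqnn andbT.
  by apply/subsetP => _ /imsetP[x xK ->]; apply: k4'; rewrite inE.
have ga : {in K &, forall x y, adj (tc_rep C') (g x) (g y) = adj (tc_rep C) x y}.
  move=> x y xK yK; rewrite /g a0' er (adj_map_graph (perm_in_inj (s := r)) (cograph_wf c0)) ?inE //.
  by rewrite -a0 /f !k1.
have [s es] := transitive_comp_iso h h' gi gK ga.
by rewrite e e' -es; apply/esym/iso_class_eq.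
Qed.

(** There are at least two components, all of the same size; hence the constraint
    [2 * m <= n.+1]. *)
Lemma card_tc_classes : #|tc_classes| <=
  \sum_(m < n.+2 | (0 < m) && (2 * m <= n.+1)) #|unlabeled_cographs m|.
Proof.
rewrite -sum1_card (partition_big (fun C => inord #|comp t (tc_rep C) v0| : 'I_n.+2)
  (fun m : 'I_n.+2 => (0 < m) && (2 * m <= n.+1))) /=.
  apply: leq_sum => -[[|m] //= hm] _; apply: leq_trans (tc_classes_size m).
  rewrite sum1dep_card; apply: subset_leq_card; apply/subsetP => C; rewrite !inE.
  case/andP => hC /eqP/(congr1 val) /=; rewrite hC /= inordK; first by move=> ->.
  have [h _] := tc_repP hC; have := card_comp_le h; rewrite card_ord ltnS => le.
  exact: leq_trans (leq_pmull _ (isT : 0 < 2)) le.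
move=> C /tc_repP[h _]; have := card_comp_le h; rewrite card_ord => le.
rewrite inordK; last by rewrite ltnS; apply: leq_trans (leq_pmull _ (isT : 0 < 2)) le.
by rewrite le andbT (cardD1 v0) mem_comp //; case: h.
Qed.

Lemma card_tc_strs :
  #|[set p in strs true setT | irr t setT v0 p & comp t p.1 v0 != setT]| <=
  n.+1`! * #|tc_classes|.
Proof.
apply: (@leq_trans (\sum_(E in tc_graphs) #|[set s | aut E s]|)).
  rewrite (eq_bigr (fun E => \sum_(s | aut E s) 1)) => [|E _]; last by rewrite sum1dep_card.
  rewrite pair_big_dep /= sum1dep_card; apply: subset_leq_card; apply/subsetP => p.
  rewrite in_set => /and3P[hp ip np]; rewrite !inE.
  have /strsP[_ _ -> _] := hp; rewrite andbT; apply/asboolP.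
  exact: irr_transitive_comp hp ip np.
rewrite (partition_big (@iso_class n.+1) (mem tc_classes)) /=; last by move=> E; apply: imset_f.
rewrite mulnC -sum_nat_const; apply: leq_sum => C /tc_repP[[c _ _] ->].
rewrite -(sum_aut_iso_class c) [leqRHS](bigID (fun E => E \in tc_graphs)) /=.
apply: leq_trans (leq_addr _ _); rewrite leq_eqVlt; apply/orP; left; apply/eqP.
apply: eq_bigl => E; rewrite andbC; apply/andb_id2r => _.
apply/eqP/idP => [<-|/iso_class_mem //]; exact: iso_class_refl.
Qed.

End Bound.

Definition corecnt sym n d := ncore sym [set: 'I_n.+1] ord0 d.

Lemma cnt_core sym n d : cnt sym n d + corecnt sym n d =
  irrcnt sym false n d + irrcnt sym true n d.
Proof. by apply: nstr_core; rewrite inE. Qed.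

(** For the identity every closed set is invariant, and a cograph with at least two vertices has a
    proper one for some [t]. *)
Lemma corecnt_false n d : 0 < n -> corecnt false n d = 0.
Proof.
move=> n0; apply/eqP; rewrite cards_eq0; apply/eqP/setP => p; rewrite in_set [RHS]inE.
apply/negP => /and4P[hp /irrP i1 /irrP i2 _].
have c := strs_cograph hp; have [|t [S [cS vS SV]]] := cograph_closed c (in_setT ord0).
  by rewrite cardsT card_ord.
have iS : invt t setT p S.
  rewrite /invt cS; apply/forall_inP => x xS.
  by have /strsP[_ _ _ /= /eqP ->] := hp; rewrite perm1.
by case/eqP: SV; case: t iS {cS} => iS; [apply: i2 | apply: i1].
Qed.

(** For some [t] a core pair has several components, which its automorphism permutes transitively.
    The factor 2 is the choice of [t]. *)
Lemma sum_corecnt n : 0 < n -> \sum_(d < n.+1) corecnt true n d <=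
  2 * (n.+1`! * \sum_(m < n.+2 | (0 < m) && (2 * m <= n.+1)) #|unlabeled_cographs m|).
Proof.
move=> n0; pose bad t := [set p in strs true [set: 'I_n.+1] |
  irr t setT ord0 p & comp t p.1 ord0 != setT].
apply: (@leq_trans #|bad false :|: bad true|); last first.
  apply: (leq_trans (leq_card_setU _ _)); rewrite mul2n -addnn.
  by apply: leq_add; apply: (leq_trans (card_tc_strs _ _)); rewrite leq_mul2l card_tc_classes orbT.
rewrite -sum1_card (partition_big (fun p => inord (degree p.1 ord0) : 'I_n.+1) xpredT) //=.
apply: leq_sum => d _; rewrite sum1dep_card; apply: subset_leq_card; apply/subsetP => p.
rewrite in_set => /and4P[hp i1 i2 /eqP e]; rewrite in_set e; apply/andP; split; last first.
  by apply/eqP/val_inj; rewrite /= inordK.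
have c := strs_cograph hp; have [|t [S [cS vS SV]]] := cograph_closed c (in_setT ord0).
  by rewrite cardsT card_ord.
have nc : comp t p.1 ord0 != setT.
  apply: contraNneq SV => e1; rewrite eqEsubset subsetT -e1.
  exact: (comp_min c).
by apply/setUP; case: t nc {cS} => nc; [right | left]; rewrite in_set; apply/and3P.
Qed.

(** * Formal power series *)

Local Open Scope ring_scope.

Record fps (R : Type) := Fps { fcoef : nat -> R }.
Coercion fcoef : fps >-> Funclass.

Lemma fpsP (R : Type) (X Y : fps R) : (forall n, X n = Y n) -> X = Y.
Proof. by case: X Y => [f] [g] /= /funext ->. Qed.

HB.instance Definition _ (R : Type) := gen_eqMixin (fps R).
HB.instance Definition _ (R : Type) := gen_choiceMixin (fps R).

Section FpsRing.
Variable R : comNzRingType.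
Implicit Types X Y Z : fps R.

Definition fps_add X Y := Fps (fun n => X n + Y n).
Definition fps_opp X := Fps (fun n => - X n).
Definition fps_const (c : R) := Fps (fun n => if n is 0%N then c else 0).
(** Locked, so that simplification does not unfold products into sums. *)
Definition fps_mul X Y :=
  locked (Fps (fun n => \sum_(i < n.+1) X i * Y (n - i)%N)).

Lemma fps_mulE X Y n : fps_mul X Y n = \sum_(i < n.+1) X i * Y (n - i)%N.
Proof. by rewrite /fps_mul -lock. Qed.

Fact fps_addA : associative fps_add.
Proof. by move=> X Y Z; apply: fpsP => n /=; rewrite addrA. Qed.
Fact fps_addC : commutative fps_add.
Proof. by move=> X Y; apply: fpsP => n /=; rewrite addrC. Qed.
Fact fps_add0 : left_id (fps_const 0) fps_add.
Proof. by move=> X; apply: fpsP => -[|n] /=; rewrite add0r. Qed.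
Fact fps_addN : left_inverse (fps_const 0) fps_opp fps_add.
Proof. by move=> X; apply: fpsP => -[|n] /=; rewrite addNr. Qed.

HB.instance Definition _ :=
  GRing.isZmodule.Build (fps R) fps_addA fps_addC fps_add0 fps_addN.

(** Coefficients of low index of a product only see truncations, so the ring laws are inherited from
    polynomials. *)
Definition fps_trunc m X : {poly R} := \poly_(i < m) X i.

Lemma coef_truncM m X Y n :
  (n < m)%N -> (fps_trunc m X * fps_trunc m Y)`_n = fps_mul X Y n.
Proof.
move=> nm; rewrite coefM fps_mulE; apply: eq_bigr => i _.
by rewrite !coef_poly (leq_ltn_trans _ nm) ?(leq_ltn_trans _ nm) ?leq_subr //
  -ltnS ltn_ord.
Qed.

Fact fps_mulC : commutative fps_mul.
Proof.
move=> X Y; apply: fpsP => n.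
by rewrite -(coef_truncM _ _ (ltnSn n)) mulrC coef_truncM.
Qed.

Fact fps_mulA : associative fps_mul.
Proof.
move=> X Y Z; apply: fpsP => n; rewrite [in LHS]fps_mulC.
pose p m W := fps_trunc m W.
have aux U V W : fps_mul (fps_mul U V) W n = (p n.+1 U * p n.+1 V * p n.+1 W)`_n.
  rewrite coefM fps_mulE; apply: eq_bigr => i _.
  rewrite coef_truncM // /p /fps_trunc !coef_poly ltnS leq_subr //.
by rewrite !aux; congr (_`_n); rewrite mulrC mulrA.
Qed.

Fact fps_mul1 : left_id (fps_const 1) fps_mul.
Proof.
move=> X; apply: fpsP => n; rewrite fps_mulE.
rewrite big_ord_recl /= mul1r subn0 big1 ?addr0 // => i _.
by rewrite /= mul0r.
Qed.

Fact fps_mulDl : left_distributive fps_mul fps_add.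
Proof.
move=> X Y Z; apply: fpsP => n; rewrite /fps_add /= !fps_mulE -big_split /=.
by apply: eq_bigr => i _; rewrite mulrDl.
Qed.

Fact fps_one_neq0 : fps_const 1 != 0.
Proof.
apply/eqP => /(congr1 (fun X => fcoef X 0%N)) /= /eqP.
by rewrite oner_eq0.
Qed.

HB.instance Definition _ :=
  GRing.Zmodule_isComNzRing.Build (fps R) fps_mulA fps_mulC fps_mul1 fps_mulDl
    fps_one_neq0.

Lemma fps_coefD X Y n : (X + Y) n = X n + Y n. Proof. by []. Qed.
Lemma fps_coefN X n : (- X) n = - X n. Proof. by []. Qed.
Lemma fps_coefB X Y n : (X - Y) n = X n - Y n. Proof. by []. Qed.
Lemma fps_coef0 n : (0 : fps R) n = 0. Proof. by case: n. Qed.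
Lemma fps_coef1 n : (1 : fps R) n = (n == 0%N)%:R. Proof. by case: n. Qed.
Lemma fps_coefM X Y n : (X * Y) n = \sum_(i < n.+1) X i * Y (n - i)%N.
Proof. exact: fps_mulE. Qed.

Lemma fps_coef_sum (I : Type) (r : seq I) (P : pred I) (F : I -> fps R) n :
  (\sum_(i <- r | P i) F i) n = \sum_(i <- r | P i) F i n.
Proof. by elim/big_rec2: _ => [|i x y _ <-] //; rewrite fps_coef0. Qed.

Lemma fps_coefMn X k n : (X *+ k) n = X n *+ k.
Proof. by elim: k => [|k IH]; rewrite ?fps_coef0 // !mulrS fps_coefD IH. Qed.

Lemma fps_constM (c d : R) : fps_const (c * d) = fps_const c * fps_const d.
Proof.
apply: fpsP => n; rewrite fps_coefM big_ord_recl /= subn0 big1 ?addr0 => [|i _].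
  by case: n => //= n; rewrite mulr0.
by rewrite mul0r.
Qed.

Lemma fps_constD (c d : R) : fps_const (c + d) = fps_const c + fps_const d.
Proof. by apply: fpsP => -[|n] //=; rewrite addr0. Qed.

Lemma fps_coefCM c X n : (fps_const c * X) n = c * X n.
Proof.
rewrite fps_coefM big_ord_recl /= subn0 big1 ?addr0 // => i _.
by rewrite mul0r.
Qed.

Lemma fps_coefM0 X Y : (X * Y) 0%N = X 0%N * Y 0%N.
Proof. by rewrite fps_coefM big_ord1. Qed.

Definition fpsX : fps R := Fps (fun n => (n == 1%N)%:R).

Lemma fps_coefXM X n : (fpsX * X) n = if n is n'.+1 then X n' else 0.
Proof.
case: n => [|n]; first by rewrite fps_coefM0 mul0r.
rewrite fps_coefM !big_ord_recl big1 => [|i _]; last by rewrite mul0r.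
by rewrite /= mul0r mul1r add0r addr0 subSS subn0.
Qed.

Lemma fps_coefXn_small X j n : X 0%N = 0 -> (n < j)%N -> (X ^+ j) n = 0.
Proof.
move=> X0; elim: j n => [//|j IH] n nj.
rewrite exprS fps_coefM big_ord_recl X0 mul0r add0r big1 // => i _.
have i_n := ltn_ord i; rewrite IH ?mulr0 // lift0; lia.
Qed.

Lemma eq_coefM X X' Y n :
  (forall i, (i <= n)%N -> X i = X' i) -> (X * Y) n = (X' * Y) n.
Proof.
move=> e; rewrite !fps_coefM; apply: eq_bigr => i _.
by rewrite e // -ltnS.
Qed.

(** Geometric series in [Z = 1 - X]: as [Z ^+ j] starts at index [j], each coefficient is a finite
    sum. *)
Lemma fps_inv_ex X : X 0%N = 1 -> exists2 Y, X * Y = 1 & Y 0%N = 1.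
Proof.
move=> X0; pose Z := 1 - X.
have Z0 : Z 0%N = 0 by rewrite fps_coefB X0 subrr.
pose Y := Fps (fun n => (\sum_(j < n.+1) Z ^+ j) n).
exists Y; last by rewrite /Y /= big_ord1 expr0.
apply: fpsP => n; rewrite mulrC (@eq_coefM _ (\sum_(j < n.+1) Z ^+ j)) => [|i le_in].
  have -> : (\sum_(j < n.+1) Z ^+ j) * X = 1 - Z ^+ n.+1.
    by rewrite -opprB subrX1 -mulNr mulrC opprB /Z subKr.
  rewrite fps_coefB fps_coefXn_small ?subr0 //.
rewrite /Y /= !fps_coef_sum.
rewrite -(subnKC le_in) -addSn big_split_ord /= [X in _ + X]big1 ?addr0 // => j _.
by rewrite fps_coefXn_small // leq_addr.
Qed.

Definition fps_deriv X := Fps (fun n => X n.+1 *+ n.+1).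

Lemma fps_derivD X Y : fps_deriv (X + Y) = fps_deriv X + fps_deriv Y.
Proof. by apply: fpsP => n /=; rewrite mulrnDl. Qed.

Lemma fps_derivM X Y :
  fps_deriv (X * Y) = fps_deriv X * Y + X * fps_deriv Y.
Proof.
apply: fpsP => n; pose p W := fps_trunc n.+2 W.
have pd W i : (i <= n)%N -> (p W)^`()`_i = fps_deriv W i.
  by move=> le_in; rewrite coef_deriv coef_poly !ltnS le_in.
have e : fps_deriv (X * Y) n = (p X * p Y)^`()`_n.
  by rewrite coef_deriv coef_truncM.
rewrite e // derivM coefD !coefM fps_coefD !fps_coefM.
have pc W i : (i <= n)%N -> (p W)`_i = W i.
  by move=> le_in; rewrite coef_poly ltnS (leq_trans le_in).
congr (_ + _); apply: eq_bigr => -[i /= i_n] _; rewrite pd ?pc //; lia.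
Qed.

End FpsRing.

(** * Series in two variables: substitution and diagonal *)

Section FpsEval.
Variable R : comNzRingType.
Implicit Types (A X Y : fps R) (F G : fps (fps R)).

Lemma coef_horner_fps (p : {poly fps R}) A n : A 0%N = 0 ->
  p.[A] n = \sum_(d < n.+1) (p`_d * A ^+ d) n.
Proof.
move=> A0; rewrite (@horner_coef_wide _ (n.+1 + size p)) ?leq_addl //.
rewrite big_split_ord fps_coefD !fps_coef_sum /= [X in _ + X]big1 ?addr0 // => i _.
rewrite mulrC (@eq_coefM _ _ 0) ?mul0r ?fps_coef0 // => j le_jn.
by rewrite fps_coefXn_small ?fps_coef0 //= ltnS (leq_trans le_jn) ?leq_addr.
Qed.

(** In [fps (fps R)] the outer index is the power of [x], the inner one that of [y]; this
    substitutes [A(y)] for [x]. If [A] has no constant term, the terms with [d > n] do not reach the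
    coefficient [n]. *)
Definition fps_eval A F := Fps (fun n => \sum_(d < n.+1) (F d * A ^+ d) n).

Lemma fps_evalE A F n m : A 0%N = 0 -> (n < m)%N ->
  fps_eval A F n = (fps_trunc m F).[A] n.
Proof.
move=> A0 nm; rewrite coef_horner_fps //; apply: eq_bigr => -[i /= i_n] _.
by rewrite coef_poly (leq_trans i_n).
Qed.

Lemma fps_evalD A F G : fps_eval A (F + G) = fps_eval A F + fps_eval A G.
Proof.
apply: fpsP => n /=; rewrite -big_split /=; apply: eq_bigr => i _.
by rewrite mulrDl.
Qed.

Lemma fps_evalM A F G : A 0%N = 0 ->
  fps_eval A (F * G) = fps_eval A F * fps_eval A G.
Proof.
move=> A0; apply: fpsP => n; pose p W := fps_trunc n.+1 W.
rewrite (@eq_coefM _ (fps_eval A F) (p _ F).[A]); last first.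
  by move=> i le_in; rewrite (@fps_evalE _ _ _ n.+1).
rewrite [in RHS]mulrC (@eq_coefM _ (fps_eval A G) (p _ G).[A]); last first.
  by move=> i le_in; rewrite (@fps_evalE _ _ _ n.+1).
rewrite [in RHS]mulrC -hornerM coef_horner_fps //; apply: eq_bigr => -[i /= i_n] _.
by rewrite coef_truncM.
Qed.

Definition fps_inx X : fps (fps R) := Fps (fun d => fps_const (X d)).
Definition fps_iny X : fps (fps R) := fps_const X.

Lemma fps_inxM X Y : fps_inx (X * Y) = fps_inx X * fps_inx Y.
Proof.
apply: fpsP => d; rewrite fps_coefM /= fps_coefM; apply: fpsP => n.
rewrite fps_coef_sum; case: n => [|n] /=.
  by apply: eq_bigr => i _; rewrite fps_coefM0.
by rewrite big1 // => i _; rewrite fps_coefCM mulr0.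
Qed.

Lemma fps_inxD X Y : fps_inx (X + Y) = fps_inx X + fps_inx Y.
Proof. by apply: fpsP => d /=; rewrite fps_constD. Qed.

Lemma fps_inx1 : fps_inx 1 = 1.
Proof. by apply: fpsP => -[|d] /=; apply: fpsP => -[|n]. Qed.

Lemma fps_inyM X Y : fps_iny (X * Y) = fps_iny X * fps_iny Y.
Proof. exact: fps_constM. Qed.

Lemma fps_inyD X Y : fps_iny (X + Y) = fps_iny X + fps_iny Y.
Proof. exact: fps_constD. Qed.

Lemma fps_eval_iny A X : fps_eval A (fps_iny X) = X.
Proof.
apply: fpsP => n /=; rewrite big_ord_recl /= mulr1 big1 ?addr0 // => i _.
by rewrite mul0r fps_coef0.
Qed.

Lemma fps_evalN A F : fps_eval A (- F) = - fps_eval A F.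
Proof.
apply: fpsP => n /=; rewrite -sumrN; apply: eq_bigr => i _.
by rewrite mulNr.
Qed.

Lemma fps_eval1 A : fps_eval A 1 = 1.
Proof. exact: (fps_eval_iny A 1). Qed.

Definition fps_diag := fps_eval (fpsX R).

Lemma fps_coefXnM X d n :
  (fpsX R ^+ d * X) n = if (d <= n)%N then X (n - d)%N else 0.
Proof.
elim: d X n => [|d IH] X n; first by rewrite mul1r subn0.
by rewrite exprSr -mulrA IH fps_coefXM; case: (leqP d n) => dn; case E: (n - d)%N => [|k];
  case: (leqP d.+1 n) => dn' //; try lia; congr (X _); lia.
Qed.

Lemma fps_diagE F n : fps_diag F n = \sum_(d < n.+1) F d (n - d)%N.
Proof.
apply: eq_bigr => -[i /= i_n] _.
by rewrite mulrC fps_coefXnM -ltnS i_n.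
Qed.

Lemma fps_diagM F G : fps_diag (F * G) = fps_diag F * fps_diag G.
Proof. exact: fps_evalM. Qed.

Lemma fps_diag_inx X : fps_diag (fps_inx X) = X.
Proof.
apply: fpsP => n; rewrite fps_diagE big_ord_recr /= subnn big1 ?add0r // => -[i /= i_n] _.
by case: (n - i)%N (subn_gt0 i n) => //=; rewrite i_n.
Qed.

Definition fps_Dx F := fps_deriv F.
Definition fps_Dy F : fps (fps R) := Fps (fun d => fps_deriv (F d)).

Lemma fps_DyD F G : fps_Dy (F + G) = fps_Dy F + fps_Dy G.
Proof. by apply: fpsP => d /=; rewrite fps_derivD. Qed.

Lemma fps_deriv_sum (I : Type) (r : seq I) (P : pred I) (f : I -> fps R) :
  fps_deriv (\sum_(i <- r | P i) f i) = \sum_(i <- r | P i) fps_deriv (f i).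
Proof.
elim/big_rec2: _ => [|i x y _ <-]; last by rewrite fps_derivD.
by apply: fpsP => -[|n] /=; rewrite mul0rn.
Qed.

Lemma fps_DyM F G : fps_Dy (F * G) = fps_Dy F * G + F * fps_Dy G.
Proof.
apply: fpsP => d; rewrite fps_coefD [LHS]/= !fps_coefM fps_deriv_sum -big_split /=.
by apply: eq_bigr => i _; rewrite fps_derivM.
Qed.

Lemma fps_Dx_inx X : fps_Dx (fps_inx X) = fps_inx (fps_deriv X).
Proof.
apply: fpsP => d /=; apply: fpsP => n; rewrite fps_coefMn /=.
by case: n => //= n; rewrite mul0rn.
Qed.

Lemma fps_Dx_iny X : fps_Dx (fps_iny X) = 0.
Proof. by apply: fpsP => d; rewrite fps_coef0 /= mul0rn. Qed.

Lemma fps_deriv_const (c : R) : fps_deriv (fps_const c) = 0.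
Proof. by apply: fpsP => n; rewrite fps_coef0 /= mul0rn. Qed.

Lemma fps_Dy_inx X : fps_Dy (fps_inx X) = 0.
Proof. by apply: fpsP => d; rewrite fps_coef0 /= fps_deriv_const. Qed.

Lemma fps_Dy_iny X : fps_Dy (fps_iny X) = fps_iny (fps_deriv X).
Proof. by apply: fpsP => -[|d] //=; exact: fps_deriv_const. Qed.

Lemma fps_DxDy F : fps_Dx (fps_Dy F) = fps_Dy (fps_Dx F).
Proof.
by apply: fpsP => d /=; apply: fpsP => n; rewrite /= !fps_coefMn mulrnAC.
Qed.

Lemma fps_deriv_diag F :
  fps_deriv (fps_diag F) = fps_diag (fps_Dx F) + fps_diag (fps_Dy F).
Proof.
apply: fpsP => n; rewrite fps_coefD -[LHS]/(fps_diag F n.+1 *+ n.+1) !fps_diagE.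
rewrite -sumrMnl.
have -> : \sum_(i < n.+2) F i (n.+1 - i)%N *+ n.+1 =
   \sum_(i < n.+2) F i (n.+1 - i)%N *+ i + \sum_(i < n.+2) F i (n.+1 - i)%N *+ (n.+1 - i).
  by rewrite -big_split; apply: eq_bigr => -[i /= i_n] _; rewrite -mulrnDr subnKC.
congr (_ + _).
  rewrite big_ord_recl /= mulr0n add0r; apply: eq_bigr => i _ /=.
  by rewrite fps_coefMn.
rewrite big_ord_recr /= subnn mulr0n addr0; apply: eq_bigr => -[i /= i_n] _.
by rewrite subSn.
Qed.

End FpsEval.

Lemma iter_leibniz (S : comNzRingType) (D : S -> S) (X Y : S) (k : nat) :
  (forall U V, D (U + V) = D U + D V) ->
  (forall U V, D (U * V) = D U * V + U * D V) ->
  iter k D (X * Y) = \sum_(i < k.+1) iter i D X * iter (k - i) D Y *+ 'C(k, i).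
Proof.
move=> DD DM.
have D0 : D 0 = 0 by apply: (addrI (D 0)); rewrite -DD !addr0.
have Dn U n : D (U *+ n) = D U *+ n.
  by elim: n => [|n IH]; rewrite ?mulr0n // !mulrS DD IH.
have Ds n (f : 'I_n -> S) : D (\sum_(i < n) f i) = \sum_(i < n) D (f i).
  by elim/big_rec2: _ => [|i x y _ <-] //.
elim: k => [|k IH]; first by rewrite big_ord1 /= bin0.
rewrite iterS IH Ds.
under eq_bigr => i _ do rewrite Dn DM mulrnDl -iterS.
rewrite big_split /= [in RHS]big_ord_recl /= bin0.
under [in RHS]eq_bigr => i _ do rewrite binS mulrnDr.
rewrite big_split /= addrA [LHS]addrC; congr (_ + _).
  rewrite big_ord_recl /= bin0 subn0; congr (_ + _).
  rewrite [in RHS]big_ord_recr /= bin_small // mulr0n addr0.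
  by apply: eq_bigr => -[i /= i_n] _; rewrite /bump /= !add1n subSS -(subnSK i_n).
Qed.

(** * Asymptotic symmetry of the factorial moments *)

Section CoefOrder.
Variable R : realFieldType.
Implicit Types X Y Z : fps R.

Definition fps_le X Y := forall n, X n <= Y n.
Definition fps_abs X := Fps (fun n => `|X n|).

Lemma fps_ge0 X n : fps_le 0 X -> 0 <= X n.
Proof. by move/(_ n); rewrite fps_coef0. Qed.

Lemma fps_leM X X' Y Y' : fps_le 0 X -> fps_le X X' -> fps_le 0 Y ->
  fps_le Y Y' -> fps_le (X * Y) (X' * Y').
Proof.
move=> X0 XX' Y0 YY' n; rewrite !fps_coefM; apply: ler_sum => i _.
by apply: ler_pM => //; apply: fps_ge0.
Qed.

Lemma fps_le0M X Y : fps_le 0 X -> fps_le 0 Y -> fps_le 0 (X * Y).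
Proof.
move=> X0 Y0 n; rewrite fps_coef0 fps_coefM sumr_ge0 // => i _.
by rewrite mulr_ge0 //; [have := X0 i | have := Y0 (n - i)%N]; rewrite fps_coef0.
Qed.

Lemma fps_le0X X k : fps_le 0 X -> fps_le 0 (X ^+ k).
Proof.
move=> X0; elim: k => [|k IH]; last by rewrite exprS; apply: fps_le0M.
by move=> n; rewrite fps_coef1 fps_coef0 ler0n.
Qed.

Lemma fps_le_trans X Y Z : fps_le X Y -> fps_le Y Z -> fps_le X Z.
Proof. by move=> h h' n; apply: le_trans (h n) (h' n). Qed.

Lemma fps_leD X X' Y Y' : fps_le X X' -> fps_le Y Y' -> fps_le (X + Y) (X' + Y').
Proof. by move=> h h' n; rewrite !fps_coefD lerD. Qed.

Lemma fps_abs_ge0 X : fps_le 0 (fps_abs X).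
Proof. by move=> n; rewrite fps_coef0 /=. Qed.

Lemma fps_absM X Y : fps_le (fps_abs (X * Y)) (fps_abs X * fps_abs Y).
Proof.
move=> n; rewrite [leLHS]/= !fps_coefM (le_trans (ler_norm_sum _ _ _)) //.
by apply: ler_sum => i _; rewrite normrM.
Qed.

Lemma fps_absD X Y : fps_le (fps_abs (X + Y)) (fps_abs X + fps_abs Y).
Proof. by move=> n; rewrite /= ler_normD. Qed.

Lemma fps_abs_id X : fps_le 0 X -> fps_abs X = X.
Proof. by move=> X0; apply: fpsP => n /=; rewrite ger0_norm // -(fps_coef0 R n). Qed.

Lemma fps_leMr X Y Z : fps_le 0 Z -> fps_le X Y -> fps_le (X * Z) (Y * Z).
Proof.
move=> Z0 XY n; rewrite !fps_coefM; apply: ler_sum => i _.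
by rewrite ler_wpM2r // -(fps_coef0 R (n - i)).
Qed.

Lemma fps_le_deriv X Y : fps_le X Y -> fps_le (fps_deriv X) (fps_deriv Y).
Proof. by move=> XY n; rewrite /= lerMn2r XY orbT. Qed.

Lemma fps_deriv_ge0 X : fps_le 0 X -> fps_le 0 (fps_deriv X).
Proof.
by move=> X0 n; rewrite fps_coef0 /= mulrn_wge0 // -(fps_coef0 R n.+1).
Qed.

End CoefOrder.

(** * Coefficientwise comparison with powers of [B] *)

Section Kernel.
Variable R : archiRealFieldType.
Variables A B g al h : fps R.
Hypothesis A_ge0 : fps_le 0 A.
Hypothesis A0 : A 0%N = 0.
Hypothesis A1 : 1 <= A 1%N.
Hypothesis BE : (1 - A) * B = 1.
Hypothesis alE : al = 2 * B - 1.
Hypothesis hE : h * (1 + A) = 1 - A.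

Implicit Types X Y : fps R.
Notation D := (@fps_deriv R).
Notation half := (fps_const (2^-1 : R)).

Lemma half2 : half * 2 = 1.
Proof.
have -> : (2 : fps R) = fps_const 2.
  by rewrite -[2 : fps R]/(1 + 1) -[2 : R]/(1 + 1) fps_constD.
by rewrite -fps_constM mulVf // pnatr_eq0.
Qed.

Lemma BS : B = 1 + A * B.
Proof. by rewrite -[in LHS](subrK (A * B) B) -[X in X - _]mul1r -mulrBl BE. Qed.

Lemma B_ge0_ge n : 0 <= B n.
Proof.
elim/ltn_ind: n => n IH; rewrite BS fps_coefD fps_coef1.
apply: addr_ge0; first by rewrite ler0n.
rewrite fps_coefM big_ord_recl A0 mul0r add0r sumr_ge0 // => -[i /= i_n] _.
rewrite mulr_ge0 //; first by rewrite -(fps_coef0 R (bump 0 i)).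
by apply: IH; rewrite /bump /=; lia.
Qed.

Lemma B_ge0 : fps_le 0 B.
Proof. by move=> n; rewrite fps_coef0 B_ge0_ge. Qed.

Lemma BX_ge0 m : fps_le 0 (B ^+ m).
Proof. exact/fps_le0X/B_ge0. Qed.

Lemma B_ge1 : fps_le 1 B.
Proof.
move=> n; rewrite [in leRHS]BS fps_coefD lerDl.
exact/fps_ge0/(fps_le0M A_ge0 B_ge0).
Qed.

Lemma BX_le m m' : (m <= m')%N -> fps_le (B ^+ m) (B ^+ m').
Proof.
move=> /subnK <-; elim: (m' - m)%N => [|k IH] //.
rewrite addSn exprS -[B ^+ m]mul1r; apply: fps_leM => //.
- by move=> n; rewrite fps_coef0 fps_coef1 ler0n.
- exact: B_ge1.
- exact: BX_ge0.
Qed.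

(* "X = O(B^m)", tested against powers of B so that it is stable under products
   and the exponents r + m stay positive (B^0 = 1 dominates nothing). *)
Definition dom m (X : fps R) := forall r, (0 < r + m)%N ->
  exists2 C, 0 <= C & fps_le (fps_abs X * B ^+ r) (fps_const C * B ^+ (r + m)).

Lemma dom_le m X Y : fps_le (fps_abs X) (fps_abs Y) -> dom m Y -> dom m X.
Proof.
move=> XY dY r r0; have [C C0 h'] := dY r r0; exists C => //.
by apply: fps_le_trans h'; apply: fps_leMr => //; apply: BX_ge0.
Qed.

Lemma dom_add m X Y : dom m X -> dom m Y -> dom m (X + Y).
Proof.
move=> dX dY r r0; have [C C0 hX] := dX r r0; have [C' C'0 hY] := dY r r0.
exists (C + C'); first exact: addr_ge0.
apply: (fps_le_trans (fps_leMr (BX_ge0 r) (fps_absD X Y))).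
by rewrite mulrDl fps_constD mulrDl; apply: fps_leD.
Qed.

Lemma dom_weaken m m' X : (m <= m')%N -> dom m X -> dom m' X.
Proof.
move=> mm' dX r r0; have [rm|rm] := posnP (r + m); last first.
  have [C C0 hX] := dX r rm; exists C => //.
  apply: (fps_le_trans hX) => n; rewrite !fps_coefCM ler_wpM2l //.
  by apply: BX_le; rewrite leq_add2l.
have [-> m0] : r = 0%N /\ m = 0%N by lia.
have [|C C0 hX] := dX 1%N; first by lia.
exists C => //; rewrite mulr1.
apply: (@fps_le_trans _ _ (fps_abs X * B ^+ 1)).
  rewrite -[X in fps_le X _]mulr1; apply: fps_leM => //.
  - exact: fps_abs_ge0.
  - by move=> n; rewrite fps_coef0 fps_coef1 ler0n.
  - by rewrite expr1; apply: B_ge1.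
apply: (fps_le_trans hX) => n; rewrite !fps_coefCM ler_wpM2l //.
by apply: BX_le; lia.
Qed.

Lemma fps_leCM (C : R) (X Y : fps R) : 0 <= C -> fps_le X Y ->
  fps_le (fps_const C * X) (fps_const C * Y).
Proof. by move=> C0 XY n; rewrite !fps_coefCM ler_wpM2l. Qed.

Lemma dom_mul m m' X Y : dom m X -> dom m' Y -> dom (m + m') (X * Y).
Proof.
have aux p p' (U V : fps R) r : dom p U -> dom p' V -> (0 < r + p')%N -> (0 < r + p' + p)%N ->
    exists2 C : R, 0 <= C &
      fps_le (fps_abs (U * V) * B ^+ r) (fps_const C * B ^+ (r + p' + p)).
  move=> dU dV r1 r2; have [C C0 hV] := dV r r1; have [C' C'0 hU] := dU _ r2.
  exists (C * C'); first exact: mulr_ge0.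
  apply: (fps_le_trans (fps_leMr (BX_ge0 r) (fps_absM U V))).
  rewrite -mulrA; apply: (@fps_le_trans _ _ (fps_abs U * (fps_const C * B ^+ (r + p')))).
    apply: fps_leM => //; first exact: fps_abs_ge0.
    by apply: fps_le0M; [apply: fps_abs_ge0 | apply: BX_ge0].
  by rewrite fps_constM mulrCA -mulrA; apply: fps_leCM.
(* The factors are absorbed one after the other, and the intermediate exponent must be positive;
   when it is not, the other order works. *)
move=> dX dY r r0; have [rm|rm] := posnP (r + m').
  rewrite (mulrC X); have [||C C0 hC] := aux _ _ Y X r dY dX; [lia|lia|].
  by exists C => //; rewrite addnA.
have [||C C0 hC] := aux _ _ X Y r dX dY; [lia|lia|].
by exists C => //; rewrite [(m + _)%N]addnC addnA.
Qed.

Lemma dom_const (c : R) : dom 0 (fps_const c).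
Proof.
move=> r _; exists `|c| => //; rewrite addn0.
suff -> : fps_abs (fps_const c) = fps_const `|c| by [].
by apply: fpsP => -[|n] //=; rewrite normr0.
Qed.

Lemma dom_B : dom 1 B.
Proof.
move=> r _; exists 1 => //; rewrite -[fps_const 1]/(1 : fps R) mul1r addn1 exprS.
by rewrite fps_abs_id //; apply: B_ge0.
Qed.

Lemma dom_abs_le_B X : fps_le (fps_abs X) B -> dom 1 X.
Proof. by move=> h1; apply: dom_le dom_B; rewrite (fps_abs_id B_ge0). Qed.

Lemma fps_const1 : fps_const 1 = 1 :> fps R. Proof. by []. Qed.

Lemma fps_constMn (c : R) n : fps_const (c *+ n) = fps_const c *+ n.
Proof.
elim: n => [|n IH]; first by rewrite !mulr0n; apply: fpsP => -[].
by rewrite !mulrS fps_constD IH.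
Qed.

Lemma fps_natE n : n%:R = fps_const n%:R :> fps R.
Proof. by rewrite fps_constMn. Qed.

Lemma dom_al : dom 1 al.
Proof.
rewrite alE; apply: dom_add.
  rewrite -(add0n 1%N); apply: dom_mul dom_B.
  by rewrite fps_natE; apply: dom_const.
apply: (@dom_weaken 0) => //; rewrite -fps_const1.
have -> : - fps_const 1 = fps_const (-1) :> fps R.
  by apply: fpsP => -[|n]; rewrite fps_coefN //= oppr0.
exact: dom_const.
Qed.

Lemma dom_exp m X k : dom m X -> dom (m * k) (X ^+ k).
Proof.
move=> dX; elim: k => [|k IH]; first by rewrite muln0; apply: dom_const.
by rewrite exprS mulnS; apply: dom_mul.
Qed.

Lemma alM1A : al * (1 - A) = 1 + A.
Proof.
have -> : al * (1 - A) = 2 * ((1 - A) * B) - (1 - A) by rewrite alE; ring.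
by rewrite BE; ring.
Qed.

Lemma h_al : h * al = 1.
Proof.
have e : h * (1 + A) * B = 1 by rewrite hE BE.
have -> : al = (1 + A) * B by rewrite -alM1A -mulrA BE mulr1.
by rewrite mulrA.
Qed.

(** [h = 2 / (1 + A) - 1], and [1 / (1 + A)] satisfies the recurrence of [B] with a sign, so that
    [B] bounds the absolute values of its coefficients. *)
Lemma dom_h : dom 1 h.
Proof.
have [|Y YE Y0] := @fps_inv_ex _ (1 + A).
  by rewrite fps_coefD A0 addr0.
have YS : Y = 1 - A * Y by rewrite -YE; ring.
have -> : h = 2 * Y - 1.
  have : h * ((1 + A) * Y) = (1 - A) * Y by rewrite mulrA hE.
  rewrite YE mulr1 => ->; have := YE; rewrite !mulrDl !mul1r => e.
  by rewrite -[in RHS]e; ring.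
apply: dom_add; last first.
  rewrite -fps_const1; apply: (@dom_weaken 0) => //.
  have -> : - fps_const 1 = fps_const (-1) :> fps R.
    by apply: fpsP => -[|n]; rewrite fps_coefN //= oppr0.
  exact: dom_const.
rewrite -(add0n 1%N); apply: dom_mul; first by rewrite fps_natE; apply: dom_const.
apply: dom_abs_le_B; elim/ltn_ind => n IH.
rewrite /= YS [in leRHS]BS fps_coefB fps_coefD (le_trans (ler_normB _ _)) //.
apply: lerD; first by rewrite fps_coef1 normr_nat.
rewrite !fps_coefM (le_trans (ler_norm_sum _ _ _)) //; apply: ler_sum => -[[|i] /= i_n] _.
  by rewrite A0 !mul0r normr0.
rewrite normrM (ger0_norm (fps_ge0 _ A_ge0)) ler_wpM2l ?(fps_ge0 _ A_ge0) //.
by apply: (IH (n - i.+1)%N); lia.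
Qed.

(** The scalars of the calculus: neither they nor their derivatives contribute to orders. *)
Definition tame X := forall i, dom 0 (iter i D X).

Lemma tame_const c : tame (fps_const c).
Proof.
case=> [|i]; first exact: dom_const.
rewrite iterSr fps_deriv_const; have -> : iter i D 0 = fps_const 0.
  by elim: i => [|i IH]; rewrite ?iterS ?IH ?fps_deriv_const //; apply: fpsP => -[].
exact: dom_const.
Qed.

Lemma tame1 : tame 1. Proof. exact: tame_const. Qed.

Lemma tame_deriv X : tame X -> tame (D X).
Proof. by move=> tX i; rewrite -iterSr; apply: tX. Qed.

Lemma dom_sum m n (f : 'I_n -> fps R) : (forall i, dom m (f i)) ->
  dom m (\sum_(i < n) f i).
Proof.
move=> hf; elim/big_ind: _ => // [|X Y]; last exact: dom_add.
apply: (@dom_weaken 0) => //; have -> : 0 = fps_const 0 :> fps R by apply: fpsP => -[].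
exact: dom_const.
Qed.

Lemma dom_muln m X n : dom m X -> dom m (X *+ n).
Proof.
by move=> dX; rewrite -mulr_natl fps_natE -[m]add0n; apply/dom_mul/dX/dom_const.
Qed.

Lemma tame_mul X Y : tame X -> tame Y -> tame (X * Y).
Proof.
move=> tX tY i; rewrite iter_leibniz; [|exact: fps_derivD|exact: fps_derivM].
apply: dom_sum => j; apply/dom_muln; rewrite -[0%N]/(0 + 0)%N.
exact: dom_mul.
Qed.

Lemma tame_nat n : tame n%:R.
Proof. by rewrite fps_natE; apply: tame_const. Qed.

Lemma tame_opp X : tame X -> tame (- X).
Proof.
move=> tX; have -> : - X = fps_const (-1) * X.
  by apply: fpsP => n; rewrite fps_coefCM fps_coefN mulN1r.
exact/tame_mul/tX/tame_const.
Qed.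

(** Polynomials in [al] of degree at most [m] with tame coefficients. Unlike [dom m], this form is
    stable under derivation (at the cost of 2) and lets [h] cancel against [al]. *)
Inductive Pol : nat -> fps R -> Prop :=
| Pol_mono m i c : (i <= m)%N -> tame c -> Pol m (c * al ^+ i)
| Pol_add m X Y : Pol m X -> Pol m Y -> Pol m (X + Y).

Lemma Pol_weaken m m' X : (m <= m')%N -> Pol m X -> Pol m' X.
Proof.
move=> mm' p; elim: p m' mm' => [{}m i c im tc|{}m {}X Y _ IX _ IY] m' mm'.
  by apply: Pol_mono => //; apply: leq_trans mm'.
by apply: Pol_add; [apply: IX | apply: IY].
Qed.

Lemma Pol_tame c : tame c -> Pol 0 c.
Proof. by move=> tc; rewrite -[c]mulr1 -(expr0 al); apply: Pol_mono. Qed.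

Lemma Pol_al : Pol 1 al.
Proof. by rewrite -[al]mul1r -(expr1 al); apply: Pol_mono => //; apply: tame1. Qed.

Lemma Pol_mul m m' X Y : Pol m X -> Pol m' Y -> Pol (m + m') (X * Y).
Proof.
move=> pX; elim: pX m' Y => [{}m i c im tc|{}m {}X X' _ IX _ IX'] m' Y pY; last first.
  by rewrite mulrDl; apply: Pol_add; [apply: IX | apply: IX'].
elim: pY => [{}m' j c' jm' tc'|{}m' {}Y Y' _ IY _ IY']; last first.
  by rewrite mulrDr; apply: Pol_add.
have -> : c * al ^+ i * (c' * al ^+ j) = c * c' * al ^+ (i + j) by rewrite exprD; ring.
by apply: Pol_mono; [apply: leq_add | apply: tame_mul].
Qed.

Lemma Pol_opp m X : Pol m X -> Pol m (- X).
Proof.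
elim=> [{}m i c im tc|{}m {}X Y _ IX _ IY].
  by rewrite -mulNr; apply: Pol_mono => //; apply: tame_opp.
by rewrite opprD; apply: Pol_add.
Qed.

Lemma Pol_muln m X n : Pol m X -> Pol m (X *+ n).
Proof.
by move=> pX; rewrite -mulr_natl -[m]add0n; apply/Pol_mul/pX/Pol_tame/tame_nat.
Qed.

Lemma Pol0 m : Pol m 0.
Proof.
apply: (@Pol_weaken 0) => //; apply: Pol_tame.
by have := tame_nat 0; rewrite mulr0n.
Qed.

Lemma Pol_sum m n (f : 'I_n -> fps R) : (forall i, Pol m (f i)) ->
  Pol m (\sum_(i < n) f i).
Proof.
move=> hf; elim/big_ind: _ => // [|X Y]; last exact: Pol_add.
exact: Pol0.
Qed.

Lemma Pol_dom m X : Pol m X -> dom m X.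
Proof.
elim=> [{}m i c im tc|{}m {}X Y _ IX _ IY]; last exact: dom_add.
apply: (dom_weaken im); rewrite -[i]add0n -[X in dom (0 + X)]mul1n.
by apply: dom_mul; [exact: (tc 0%N) | apply/dom_exp/dom_al].
Qed.

(** [h^2] cancels two factors [al]. On monomials with fewer of them, the remaining powers of [h] are
    only bounded by [dom_h] and cost up to 2, whence [4 <= m]. *)
Lemma h2_Pol_dom m X : (4 <= m)%N -> Pol m X -> dom (m - 2) (h ^+ 2 * X).
Proof.
move=> m4 p; elim: p m4 => [{}m i c im tc|{}m {}X Y _ IX _ IY] m4; last first.
  by rewrite mulrDr; apply: dom_add; [apply: IX | apply: IY].
case: i im => [|[|i]] im.
- apply: (@dom_weaken (1 * 2 + (0 + 0))); first lia.
  apply: dom_mul; first exact/dom_exp/dom_h.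
  by apply: dom_mul; [exact: (tc 0%N) | apply: dom_const].
- have -> : h ^+ 2 * (c * al ^+ 1) = c * h by rewrite -[in RHS](mulr1 c) -h_al; ring.
  apply: (@dom_weaken (0 + 1)); first lia.
  by apply: dom_mul; [exact: (tc 0%N) | apply: dom_h].
have -> : h ^+ 2 * (c * al ^+ i.+2) = (h * al) * (h * al) * (c * al ^+ i).
  by rewrite !exprS; ring.
rewrite h_al !mul1r; apply: (@dom_weaken i); first lia.
by apply/Pol_dom/Pol_mono.
Qed.


(** * Series with rapidly decreasing coefficients are tame *)

Hypothesis AD : D A = g * al.
Hypothesis g_ge : fps_le 1 g.

Lemma al_ge : fps_le B al.
Proof.
move=> n; rewrite alE mulr_natl -[B *+ 2]/(B + B) fps_coefB fps_coefD.
by rewrite -addrA lerDl subr_ge0; apply: B_ge1.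
Qed.

Lemma one_ge0 : fps_le 0 (1 : fps R).
Proof. by move=> n; rewrite fps_coef1 fps_coef0 ler0n. Qed.

Lemma BXS m : B ^+ m.+1 = B ^+ m + A * B ^+ m.+1.
Proof. by rewrite exprS {1}BS; ring. Qed.

(** [B^m] dominates [A * B^m], and [A 1 >= 1] makes the latter dominate the shift of [B^m]. *)
Lemma BX_shift m n : (0 < m)%N -> (B ^+ m) n <= (B ^+ m) n.+1.
Proof.
case: m => // m _; rewrite -[leLHS](fps_coefXM (B ^+ m.+1) n.+1) [in leRHS]BXS.
rewrite fps_coefD; apply: (@le_trans _ _ ((A * B ^+ m.+1) n.+1)); last first.
  by rewrite lerDr; apply/fps_ge0/BX_ge0.
apply: fps_leMr; first exact: BX_ge0.
by case=> [|[|j]] //=; exact: fps_ge0 A_ge0.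
Qed.

Lemma iter_D_coef i X n : iter i D X n = X (n + i)%N *+ (n + i) ^_ i.
Proof.
elim: i n => [|i IH] n; first by rewrite addn0.
by rewrite iterS -[LHS]/(iter i D X n.+1 *+ n.+1) IH -mulrnA -addSnnS ffactnSr addnK.
Qed.

(** Since [A * B^r <= B^r] for [r > 0], each term [A j * (B^r) (n - j)] of a convolution is at most
    [(B^r) n]; a further factor [1 / j^2] makes these terms summable. *)
Lemma tame_rapid X : fps_le 0 X ->
  (forall p i, exists2 C, 0 <= C &
     forall j, (0 < j)%N -> j.+1%:R ^+ p * X (j + i)%N <= C * A j) -> tame X.
Proof.
move=> X0 rapid i r; rewrite addn0 => r0.
(* The power [i] pays for the [i] derivatives, the power 2 for the summation. *)
have [C C0 hC] := rapid i.+2 i; set Y := iter i D X.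
have Y0 : fps_le 0 Y.
  by rewrite /Y; elim: (i) => //= k; apply: fps_deriv_ge0.
have hY j : (0 < j)%N -> j.+1%:R ^+ 2 * Y j <= C * i.+1%:R ^+ i * A j.
  move=> j0; rewrite /Y iter_D_coef -[X (j + i)%N *+ _]mulr_natr.
  have h1 : ((j + i) ^_ i)%:R <= (j.+1%:R ^+ i * i.+1%:R ^+ i : R).
    rewrite -exprMn -natrM -natrX ler_nat.
    apply: (@leq_trans ((j + i) ^ i)); last first.
      by case: (posnP i) => [->|i0]; rewrite ?expn0 // leq_exp2r //; nia.
    rewrite ffact_prod -[X in (_ <= _ ^ X)%N]card_ord -prod_nat_const.
    by apply: leq_prod => k _; rewrite leq_subr.
  have Xji : 0 <= X (j + i)%N by apply: fps_ge0.
  apply: (@le_trans _ _ (j.+1%:R ^+ 2 * (X (j + i)%N * (j.+1%:R ^+ i * i.+1%:R ^+ i)))).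
    by rewrite ler_wpM2l ?exprn_ge0 // ler_wpM2l.
  have -> : j.+1%:R ^+ 2 * (X (j + i)%N * (j.+1%:R ^+ i * i.+1%:R ^+ i)) =
      j.+1%:R ^+ i.+2 * X (j + i)%N * i.+1%:R ^+ i.
    by rewrite (exprD _ 2 i); ring.
  by rewrite [leRHS]mulrAC ler_wpM2r ?exprn_ge0 // hC.
set c := C * i.+1%:R ^+ i in hY.
have c0 : 0 <= c by rewrite mulr_ge0 // exprn_ge0.
exists (Y 0%N + c); first by rewrite addr_ge0 //; apply: fps_ge0.
move=> n; rewrite fps_abs_id // fps_coefCM (fps_coefM Y) big_ord_recl /= subn0.
rewrite mulrDl lerD2l.
have ABle j : (j <= n)%N -> A j * (B ^+ r) (n - j)%N <= (B ^+ r) n.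
  move=> jn; case: r r0 => // r _; rewrite [in leRHS]BXS [in leRHS]fps_coefD.
  apply: (@le_trans _ _ ((A * B ^+ r.+1) n)); last by rewrite lerDr; apply/fps_ge0/BX_ge0.
  rewrite (fps_coefM A) (bigD1 (Ordinal (jn : (j < n.+1)%N))) //= lerDl.
  apply: sumr_ge0 => k _; rewrite mulr_ge0 //; first exact: fps_ge0.
  exact/fps_ge0/BX_ge0.
have Br0 k : 0 <= (B ^+ r) k by apply/fps_ge0/BX_ge0.
(* Telescoping, as [1 / (k + 2)^2] is at most [1 / (k + 1) - 1 / (k + 2)]. *)
have sum1 m : \sum_(k < m) (k.+2%:R ^+ 2)^-1 <= 1 - m.+1%:R^-1 :> R.
  elim: m => [|m IH]; first by rewrite big_ord0 invr1 subrr.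
  rewrite big_ord_recr /= -lerBrDr; apply: (le_trans IH).
  have m0 : 0 < m.+1%:R :> R by rewrite ltr0Sn.
  rewrite -(natr1 m.+1); move: (m.+1%:R : R) m0 => x m0.
  have x1 : 0 < x + 1 by rewrite addr_gt0.
  have -> : 1 - (x + 1)^-1 - ((x + 1) ^+ 2)^-1 = 1 - x^-1 + (x * (x + 1) ^+ 2)^-1.
    by field; rewrite (gt_eqF m0) (gt_eqF x1).
  by rewrite lerDl invr_ge0 mulr_ge0 ?exprn_ge0 // ltW.
apply: (@le_trans _ _ (\sum_(k < n) c * (k.+2%:R ^+ 2)^-1 * (B ^+ r) n)); last first.
  rewrite -mulr_suml ler_wpM2r // -mulr_sumr ler_piMr //.
  by apply: le_trans (sum1 n) _; rewrite gerBl invr_ge0.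
apply: ler_sum => k _; rewrite /bump /= add1n.
have k2 : 0 < k.+2%:R ^+ 2 :> R by rewrite exprn_gt0.
have hk : Y k.+1 <= c * (k.+2%:R ^+ 2)^-1 * A k.+1.
  by rewrite mulrAC ler_pdivlMr // mulrC hY.
apply: (@le_trans _ _ (c * (k.+2%:R ^+ 2)^-1 * A k.+1 * (B ^+ r) (n - k.+1)%N)).
  by rewrite ler_wpM2r.
rewrite -mulrA ler_wpM2l ?mulr_ge0 ?invr_ge0 ?exprn_ge0 //.
by apply: ABle; apply: ltn_ord.
Qed.

Lemma A_ge_B j : B j <= j.+1%:R * A j.+1.
Proof.
have -> : j.+1%:R * A j.+1 = D A j by rewrite /= mulr_natl.
rewrite AD -[B]mul1r.
by apply: fps_leM; [apply: one_ge0 | apply: g_ge | apply: B_ge0 | apply: al_ge].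
Qed.

Lemma A_B_le m j : (0 < m <= j)%N -> A m * B (j - m)%N <= B j.
Proof.
case/andP=> m0 mj; rewrite [in leRHS]BS [in leRHS]fps_coefD.
apply: (@le_trans _ _ ((A * B) j)); last by rewrite lerDr fps_coef1 ler0n.
rewrite (fps_coefM A) (bigD1 (Ordinal (mj : (m < j.+1)%N))) //= lerDl.
by apply: sumr_ge0 => k _; rewrite mulr_ge0 //; [apply: fps_ge0 | apply: B_ge0_ge].
Qed.

Lemma B_mono j k : (j <= k)%N -> B j <= B k.
Proof.
move/subnK <-; elim: (k - j)%N => [//|i IH]; rewrite addSn (le_trans IH) //.
by have := @BX_shift 1 (i + j) isT; rewrite expr1.
Qed.

Lemma B_pos j : 1 <= B j.
Proof. by apply: le_trans (B_mono (leq0n j)); have := B_ge1 0. Qed.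

Lemma A2 : 2^-1 <= A 2.
Proof.
have := A_ge_B 1; have := B_pos 1 => h1 h2.
by lra.
Qed.

(** In [B = 1 + A * B] keep the terms of [A 1 >= 1] and [A 2 >= 1/2]: two steps gain the factor
    [3 / 2]. *)
Lemma B_expo j : (3 / 2) ^+ j <= B j.*2.
Proof.
elim: j => [|j IH]; first by rewrite expr0 B_pos.
have h1 : 3 / 2 * B j.*2 <= B j.*2.+2.
  rewrite [in leRHS]BS fps_coefD fps_coef1 add0r fps_coefM !big_ord_recl /=.
  rewrite A0 mul0r add0r /bump /= !add1n !subSS !subn0.
  rewrite addrA -[leLHS]addr0; apply: lerD; last first.
    by apply: sumr_ge0 => i _; rewrite mulr_ge0 //; [apply: fps_ge0 | apply: B_ge0_ge].
  have e1 : B j.*2 <= A 1 * B j.*2.+1.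
    rewrite -[leLHS]mul1r; apply: ler_pM => //; first exact: B_ge0_ge.
    exact: B_mono.
  have e2 : 2^-1 * B j.*2 <= A 2 * B j.*2 by rewrite ler_wpM2r ?B_ge0_ge // A2.
  by lra.
rewrite exprS doubleS; apply: le_trans h1; rewrite ler_wpM2l //.
by rewrite divr_ge0.
Qed.

(** Keep one term of the binomial expansion of [(1 + 1/2)^(q + p)]. *)
Lemma pow_le_expo p : exists2 C : R, 0 <= C &
  forall q, q.+1%:R ^+ p <= C * (3 / 2) ^+ q.
Proof.
exists (p`!%:R * 2 ^+ p * (3 / 2) ^+ p); first by rewrite !mulr_ge0 ?exprn_ge0 ?divr_ge0.
move=> q; have -> : 3 / 2 = 2^-1 + 1 :> R by lra.
rewrite -(mulrA (_ * _)) -exprD [(p + q)%N]addnC.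
have h1 : 'C(q + p, p)%:R * 2^-1 ^+ p <= (2^-1 + 1) ^+ (q + p) :> R.
  rewrite addrC exprDn (bigD1 (inord p)) //= inordK ?ltnS ?leq_addl //.
  rewrite expr1n mul1r mulr_natl lerDl; apply: sumr_ge0 => i _.
  by rewrite mulrn_wge0 // mulr_ge0 ?exprn_ge0 // invr_ge0.
apply: (@le_trans _ _ (p`!%:R * 2 ^+ p * ('C(q + p, p)%:R * 2^-1 ^+ p))); last first.
  by rewrite ler_wpM2l // mulr_ge0 ?exprn_ge0.
have -> : p`!%:R * 2 ^+ p * ('C(q + p, p)%:R * 2^-1 ^+ p) = ('C(q + p, p) * p`!)%:R :> R.
  by rewrite natrM mulrCA -!mulrA -exprMn mulfV ?pnatr_eq0 // expr1n mulr1.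
rewrite bin_ffact -natrX ler_nat ffact_prod.
rewrite -[X in (_ ^ X <= _)%N]card_ord -prod_nat_const.
by apply: leq_prod => k _; have := ltn_ord k; lia.
Qed.

Lemma leq_add_mulSS i j : ((j.+1 + i).+2 <= i.+2 * j.+2)%N.
Proof.
have t0 : (i.+1 <= i.+1 * j.+2)%N by rewrite leq_pmulr.
by rewrite mulSn; lia.
Qed.

(** The first halving comes from [2 * m <= n.+1], the second from the steps of length 2 in [B_expo];
    [i + 8] absorbs the shift and the roundings. *)
Lemma leq_quarter i j :
  (j.+2 <= (i + 8) * ((j.+1 - i - 3)./2)./2.+1)%N.
Proof.
have h1 := odd_double_half (j.+1 - i - 3); set q := (j.+1 - i - 3)./2 in h1 *.
have h2 := odd_double_half q; set q' := q./2 in h2 *.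
rewrite mulnS mulnDl; move: (i * q')%N => z.
by move: h1 h2; do 2 case: odd; lia.
Qed.

(** For [m] at most about half of [j], [A m * B (j - m) <= B j] and the exponential growth of [B]
    make [A m] exponentially smaller than [j.+1%:R * A j.+1], which beats all polynomial factors. *)
Lemma tame_growth c : 0 <= c -> (forall n, (0 < n)%N -> g n <=
    c * n.+1%:R * \sum_(m < n.+2 | (0 < m)%N && (2 * m <= n.+1)%N) A m) -> tame g.
Proof.
move=> c0 hg; apply: tame_rapid => [|p i]; first exact: fps_le_trans one_ge0 g_ge.
have [C C0 hC] := pow_le_expo (p + 3).
have gge0 n : 0 <= g n by apply: fps_ge0; apply: fps_le_trans one_ge0 g_ge.
(* [C1] covers the finitely many indices too small for the estimate, where [1 <= j * A j] is enough;
   [C2] covers the others. *)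
pose C1 := \sum_(j < i + 5) j.+1%:R ^+ p * g (j + i)%N * j%:R.
have C10 : 0 <= C1 by apply: sumr_ge0 => j _; rewrite !mulr_ge0 ?exprn_ge0.
pose C2 := c * i.+2%:R ^+ 2 * (i + 8)%:R ^+ (p + 3) * C.
have C20 : 0 <= C2 by rewrite !mulr_ge0 ?exprn_ge0.
exists (C1 + C2); first exact: addr_ge0.
case=> // j _; rewrite mulrDl.
have jA : 1 <= j.+1%:R * A j.+1 by apply: le_trans (A_ge_B j); apply: B_pos.
have A0' : 0 <= A j.+1 by apply: fps_ge0.
have [ji|ji] := ltnP j.+1 (i + 5).
  rewrite -[leLHS]addr0; apply: lerD; last exact: mulr_ge0.
  rewrite /C1 (bigD1 (Ordinal ji)) //= mulrDl -[leLHS]addr0.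
  apply: lerD; last first.
    by rewrite mulr_ge0 // sumr_ge0 // => k _; rewrite !mulr_ge0 ?exprn_ge0.
  by rewrite -[leRHS]mulrA ler_peMr // mulr_ge0 ?exprn_ge0.
rewrite -[leLHS]add0r; apply: lerD; first exact: mulr_ge0.
pose q := ((j.+1 - i - 3)./2)%N; pose q' := q./2.
have hA m : (0 < m)%N -> (2 * m <= (j.+1 + i).+1)%N ->
    A m * (3 / 2) ^+ q' <= j.+1%:R * A j.+1.
  move=> m0 mj; apply: le_trans (A_ge_B j).
  have mj' : (m <= j)%N by lia.
  apply: (@le_trans _ _ (A m * B (j - m)%N)); last by apply: A_B_le; rewrite m0.
  rewrite ler_wpM2l //; first exact: fps_ge0.
  apply: (le_trans (B_expo q')); apply: B_mono.
  have h1 : (q'.*2 <= q)%N by rewrite /q' -[leqRHS]odd_double_half leq_addl.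
  have h2 : (q.*2 <= j.+1 - i - 3)%N.
    by rewrite /q -[leqRHS]odd_double_half leq_addl.
  lia.
set E := (3 / 2) ^+ q' in hA.
have E0 : 0 < E by rewrite exprn_gt0 // divr_gt0.
rewrite -(ler_pM2r E0).
have hsum : (\sum_(m < (j.+1 + i).+2 | (0 < m)%N && (2 * m <= (j.+1 + i).+1)%N) A m) * E
     <= (j.+1 + i).+2%:R * (j.+1%:R * A j.+1).
  rewrite mulr_suml; apply: (@le_trans _ _ (\sum_(m < (j.+1 + i).+2) j.+1%:R * A j.+1)).
    rewrite [leRHS](bigID (fun m : 'I__ => (0 < m)%N && (2 * m <= (j.+1 + i).+1)%N)) /=.
    rewrite -[leLHS]addr0; apply: lerD; last by rewrite sumr_ge0 // => k _; rewrite mulr_ge0.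
    by apply: ler_sum => m /andP[m0 mj]; apply: hA.
  by rewrite sumr_const card_ord [leRHS]mulr_natl.
have hg' := hg (j.+1 + i)%N isT.
apply: (@le_trans _ _ (j.+2%:R ^+ p * (c * (j.+1 + i).+1%:R *
    ((j.+1 + i).+2%:R * (j.+1%:R * A j.+1))))).
  rewrite -[leLHS]mulrA ler_wpM2l ?exprn_ge0 //.
  apply: (le_trans (ler_wpM2r (ltW E0) hg')).
  by rewrite -(mulrA (c * _)) ler_wpM2l // mulr_ge0.
have hn : (j.+2%:R ^+ p * ((j.+1 + i).+1%:R * (j.+1 + i).+2%:R * j.+1%:R) : R) <=
   i.+2%:R ^+ 2 * j.+2%:R ^+ (p + 3).
  rewrite (exprD _ p 3) [leRHS]mulrCA ler_wpM2l ?exprn_ge0 // -!natrX -!natrM ler_nat.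
  have t2 := leq_add_mulSS i j; have t1 := ltnW t2.
  have := leq_mul (leq_mul t1 t2) (leqnSn j.+1); move/leq_trans; apply.
  by apply: eq_leq; ring.
have hj : (j.+2%:R ^+ (p + 3) : R) <= (i + 8)%:R ^+ (p + 3) * (C * E).
  apply: (@le_trans _ _ (((i + 8) * q'.+1)%:R ^+ (p + 3))); last first.
    by rewrite natrM exprMn ler_wpM2l ?exprn_ge0 // hC.
  rewrite lerXn2r ?nnegrE ?ler0n // ler_nat.
  exact: leq_quarter.
have -> : j.+2%:R ^+ p * (c * (j.+1 + i).+1%:R * ((j.+1 + i).+2%:R * (j.+1%:R * A j.+1))) =
  j.+2%:R ^+ p * ((j.+1 + i).+1%:R * (j.+1 + i).+2%:R * j.+1%:R) * (c * A j.+1) by ring.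
have cA : 0 <= c * A j.+1 by rewrite mulr_ge0.
apply: (le_trans (ler_wpM2r cA hn)).
apply: (@le_trans _ _ (i.+2%:R ^+ 2 * ((i + 8)%:R ^+ (p + 3) * (C * E)) * (c * A j.+1))).
  by rewrite ler_wpM2r // ler_wpM2l ?exprn_ge0.
by rewrite le_eqVlt; apply/orP; left; apply/eqP; rewrite /C2; ring.
Qed.

(** * Derivatives of [al], [h] and [h^2] *)

Hypothesis gT : tame g.

(** The logarithmic derivative of [al]. It equals [2 * g * B ^+ 2], but is written in [al] to be
    visibly in [Pol 2]. *)
Definition dl := half * g * (al + 1) ^+ 2.

Lemma D1 : D 1 = 0. Proof. exact: fps_deriv_const. Qed.

Lemma DN X : D (- X) = - D X.
Proof. by apply: fpsP => n; rewrite fps_coefN /= mulNrn. Qed.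

Lemma half_al : half * (al + 1) = B.
Proof.
have -> : al + 1 = 2 * B by rewrite alE; ring.
by rewrite mulrA half2 mul1r.
Qed.

Lemma dlE : dl = 2 * g * B ^+ 2.
Proof.
rewrite -half_al /dl; transitivity (g * (al + 1) ^+ 2 * half * (half * 2)).
  by rewrite half2; ring.
by ring.
Qed.

Lemma D_B : D B = g * al * B ^+ 2.
Proof.
have : D ((1 - A) * B) = 0 by rewrite BE D1.
rewrite fps_derivM fps_derivD D1 DN add0r AD => /eqP; rewrite addrC addr_eq0 => /eqP e.
have : B * ((1 - A) * D B) = B * - (- (g * al) * B) by rewrite e.
by rewrite mulrA [B * _]mulrC BE mul1r => ->; ring.
Qed.

Lemma D_al : D al = dl * al.
Proof.
rewrite alE fps_derivD DN D1 subr0 mulr_natl -[B *+ 2]/(B + B) fps_derivD D_B dlE alE.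
by ring.
Qed.

Lemma D_h : D h = - (dl * h).
Proof.
have : D (h * al) = 0 by rewrite h_al D1.
rewrite fps_derivM D_al => /eqP; rewrite addr_eq0 => /eqP e.
have : D h * (h * al) = - (dl * h) * (h * al).
  by rewrite mulrCA mulrA -mulrA e; ring.
by rewrite h_al !mulr1.
Qed.

Lemma Pol_dl : Pol 2 dl.
Proof.
rewrite /dl -[2%N]/(0 + (1 + 1))%N expr2; apply: Pol_mul.
  exact/Pol_tame/tame_mul/gT/tame_const.
by apply: Pol_mul; apply: Pol_add; first [exact: Pol_al | exact/(Pol_weaken (leq0n _))/Pol_tame/tame1].
Qed.

Lemma D_exp i X : D (X ^+ i.+1) = X ^+ i * D X *+ i.+1.
Proof.
elim: i => [|i IH]; first by rewrite expr1 expr0 mul1r.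
by rewrite exprS fps_derivM IH mulrnAr mulrA -exprS [RHS]mulrS [D X * _]mulrC.
Qed.

Lemma Pol_deriv m X : Pol m X -> Pol (m + 2) (D X).
Proof.
elim=> [{}m i c im tc|{}m {}X Y _ IX _ IY]; last by rewrite fps_derivD; apply: Pol_add.
rewrite fps_derivM; apply: Pol_add.
  by apply: Pol_mono; [rewrite (leq_trans im) ?leq_addr | apply: tame_deriv].
case: i im => [|i] im; first by rewrite expr0 D1 mulr0; apply: Pol0.
have -> : c * D (al ^+ i.+1) = c * al ^+ i.+1 * dl *+ i.+1.
  by rewrite D_exp D_al mulrnAr exprSr; congr (_ *+ _); ring.
by apply: Pol_muln; apply: Pol_mul Pol_dl; apply: Pol_mono.
Qed.

Let P := h ^+ 2.

Lemma D_h2 V : D (h ^+ 2 * V) = h ^+ 2 * (D V - 2 * dl * V).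
Proof. by rewrite fps_derivM D_exp expr1 D_h; ring. Qed.

Definition V1 := g * (2 * al + 1).

(** [2 * h^2 * dl = g * (1 + h)^2] because [h * al = 1]; its leading term is the tame series [g]. *)
Lemma D_P : D P = - g - h ^+ 2 * V1.
Proof.
rewrite /P -[h ^+ 2]mulr1 D_h2 D1 sub0r /V1.
have -> : h ^+ 2 * - (2 * dl * 1) = - (half * 2) * g * (h * al + h) ^+ 2 by rewrite /dl; ring.
rewrite half2 h_al.
have -> : h ^+ 2 * 1 * (g * (2 * al + 1)) = g * (2 * h * (h * al) + h ^+ 2) by ring.
by rewrite h_al; ring.
Qed.

Lemma Pol_V1 : Pol 1 V1.
Proof.
rewrite /V1 -[1%N]/(0 + 1)%N; apply: Pol_mul; first exact: Pol_tame.
apply: Pol_add; last exact/(Pol_weaken (leq0n _))/Pol_tame/tame1.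
by rewrite -[1%N]/(0 + 1)%N; apply: Pol_mul Pol_al; apply/Pol_tame/tame_nat.
Qed.

(** Counting [h^2] as -2, the weight is [2 * i + 1], one less than the expected [2 * (i + 2) - 2],
    because the leading term [- g] of [D P] stays tame when differentiated. This unit makes
    negligible the Leibniz terms with two or more derivatives on [h^2]. *)
Lemma iter_D_P i : exists2 V, Pol (2 * i + 3) V & iter i.+2 D P = h ^+ 2 * V.
Proof.
elim: i => [|i [V pV e]].
  exists (- (D g * al ^+ 2) - (D V1 - 2 * dl * V1)).
    apply: Pol_add; apply: Pol_opp; first by apply: Pol_mono => //; apply: tame_deriv.
    apply: Pol_add; first exact: Pol_deriv Pol_V1.
    apply: Pol_opp; rewrite -[(_ + 3)%N]/(0 + 2 + 1)%N; apply: Pol_mul Pol_V1.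
    by apply: Pol_mul Pol_dl; apply/Pol_tame/tame_nat.
  rewrite /= D_P fps_derivD !DN D_h2.
  have e : h ^+ 2 * (D g * al ^+ 2) = D g.
    by transitivity (D g * (h * al) ^+ 2); [ring | rewrite h_al; ring].
  by rewrite -[in LHS]e; ring.
exists (D V - 2 * dl * V); last by rewrite iterS e D_h2.
have -> : (2 * i.+1 + 3 = 2 * i + 3 + 2)%N by lia.
apply: Pol_add; first exact: Pol_deriv.
apply: Pol_opp; rewrite addnC; apply: Pol_mul pV; rewrite -[2%N]/(0 + 2)%N.
by apply: Pol_mul Pol_dl; apply/Pol_tame/tame_nat.
Qed.

(** * Mixed derivatives of the kernel on the diagonal *)

Notation Dx := (@fps_Dx R).
Notation Dy := (@fps_Dy R).
Notation inx := (@fps_inx R).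
Notation iny := (@fps_iny R).
Notation diag := (@fps_diag R).

Implicit Types U V : fps (fps R).
Variable F : fps (fps R).
Hypothesis FE : (inx h + iny h) * F = 2.

(* The bivariate analogue of Pol; h(x) F and h(y) F have weight 0 since F has
   weight 1 and h is of order B^-1. *)
Inductive PB : nat -> fps (fps R) -> Prop :=
| PB_inx c : tame c -> PB 0 (inx c)
| PB_iny c : tame c -> PB 0 (iny c)
| PB_alx : PB 1 (inx al)
| PB_aly : PB 1 (iny al)
| PB_F : PB 1 F
| PB_hx : PB 0 (inx h * F)
| PB_hy : PB 0 (iny h * F)
| PB_add m U V : PB m U -> PB m V -> PB m (U + V)
| PB_mul m m' U V : PB m U -> PB m' V -> PB (m + m') (U * V)
| PB_weaken m m' U : (m <= m')%N -> PB m U -> PB m' U.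

Lemma diagD U V : diag (U + V) = diag U + diag V.
Proof. exact: fps_evalD. Qed.

Lemma diag_iny X : diag (iny X) = X.
Proof. exact: fps_eval_iny. Qed.

Lemma diag_F : diag F = al.
Proof.
have e : diag ((inx h + iny h) * F) = 2.
  by rewrite FE -[2 : fps (fps R)]/(1 + 1) diagD /diag fps_eval1.
rewrite fps_diagM diagD fps_diag_inx diag_iny in e.
have : half * 2 * (h * al) * diag F = half * 2 * al.
  by transitivity (half * ((h + h) * diag F) * al); [ring | rewrite e].
by rewrite half2 h_al !mul1r.
Qed.

Lemma PB_diag m U : PB m U -> Pol m (diag U).
Proof.
elim=> {m U} [c tc|c tc|||||| m X Y _ IX _ IY|m m' X Y _ IX _ IY|m m' X mm' _ IX].
- by rewrite fps_diag_inx; apply: Pol_tame.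
- by rewrite diag_iny; apply: Pol_tame.
- by rewrite fps_diag_inx; apply: Pol_al.
- by rewrite diag_iny; apply: Pol_al.
- by rewrite diag_F; apply: Pol_al.
- by rewrite fps_diagM fps_diag_inx diag_F h_al; apply/Pol_tame/tame1.
- by rewrite fps_diagM diag_iny diag_F h_al; apply/Pol_tame/tame1.
- by rewrite diagD; apply: Pol_add.
- by rewrite fps_diagM; apply: Pol_mul.
- exact: Pol_weaken IX.
Qed.

Lemma inx_natr n : inx n%:R = n%:R.
Proof.
by elim: n => [|n IH]; [apply: fpsP => d; rewrite !fps_coef0 /=; case: d => [|d] /=; apply: fpsP => -[]
  | rewrite !mulrS fps_inxD fps_inx1 IH].
Qed.

Lemma inx0 : inx 0 = 0. Proof. exact: (inx_natr 0). Qed.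

Lemma inxh2 : inx half * 2 = 1.
Proof. by rewrite -(inx_natr 2) -fps_inxM half2 fps_inx1. Qed.

Lemma iny_natr n : iny n%:R = n%:R.
Proof.
by elim: n => [|n IH]; [apply: fpsP => -[] | rewrite !mulrS fps_inyD IH].
Qed.

Lemma inyh2 : iny half * 2 = 1.
Proof. by rewrite -(iny_natr 2) -fps_inyM half2. Qed.

Lemma Dx2 : Dx 2 = 0.
Proof. by rewrite -(inx_natr 2) fps_Dx_inx; have := fps_deriv_const (2 : R); rewrite -fps_natE => ->; rewrite inx0. Qed.

Lemma Dy2 : Dy 2 = 0.
Proof. by rewrite -(inx_natr 2) fps_Dy_inx. Qed.

Lemma inxN X : inx (- X) = - inx X.
Proof.
by apply: (addrI (inx X)); rewrite -fps_inxD !subrr inx0.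
Qed.

Lemma inyN X : iny (- X) = - iny X.
Proof.
apply: (addrI (iny X)); rewrite -fps_inyD !subrr; exact: fpsP => -[].
Qed.

Lemma Dx_F : Dx F = inx (half * dl) * (inx h * F) * F.
Proof.
have e : Dx ((inx h + iny h) * F) = 0 by rewrite FE Dx2.
rewrite /fps_Dx fps_derivM fps_derivD -!/(fps_Dx _) fps_Dx_inx fps_Dx_iny addr0 in e.
have : inx half * F * (inx (D h) * F + (inx h + iny h) * Dx F) = 0.
  by rewrite e mulr0.
have -> : inx half * F * (inx (D h) * F + (inx h + iny h) * Dx F) =
   inx half * F * inx (D h) * F + inx half * ((inx h + iny h) * F) * Dx F by ring.
rewrite FE inxh2 mul1r D_h inxN fps_inxM => /eqP; rewrite addrC addr_eq0 => /eqP ->.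
by rewrite fps_inxM; ring.
Qed.

Lemma Dy_F : Dy F = iny (half * dl) * (iny h * F) * F.
Proof.
have e : Dy ((inx h + iny h) * F) = 0 by rewrite FE Dy2.
rewrite fps_DyM fps_DyD fps_Dy_inx fps_Dy_iny add0r in e.
have : iny half * F * (iny (D h) * F + (inx h + iny h) * Dy F) = 0.
  by rewrite e mulr0.
have -> : iny half * F * (iny (D h) * F + (inx h + iny h) * Dy F) =
   iny half * F * iny (D h) * F + iny half * ((inx h + iny h) * F) * Dy F by ring.
rewrite FE inyh2 mul1r D_h inyN fps_inyM => /eqP; rewrite addrC addr_eq0 => /eqP ->.
by rewrite fps_inyM; ring.
Qed.

Lemma PB_dlx : PB 2 (inx dl).
Proof.
rewrite /dl expr2 !fps_inxM !fps_inxD fps_inx1 -[2%N]/(0 + (1 + 1))%N.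
have p1 : PB 1 (inx al + 1).
  apply: PB_add; first exact: PB_alx.
  apply: (@PB_weaken 0) => //; rewrite -fps_inx1; exact/PB_inx/tame1.
by apply: PB_mul; [rewrite -fps_inxM; apply/PB_inx/tame_mul/gT/tame_const | apply: PB_mul].
Qed.

Lemma PB_dly : PB 2 (iny dl).
Proof.
rewrite /dl expr2 !fps_inyM !fps_inyD -[2%N]/(0 + (1 + 1))%N.
have p1 : PB 1 (iny al + iny 1).
  apply: PB_add; first exact: PB_aly.
  by apply: (@PB_weaken 0) => //; apply/PB_iny/tame1.
by apply: PB_mul; [rewrite -fps_inyM; apply/PB_iny/tame_mul/gT/tame_const | apply: PB_mul].
Qed.

Lemma PB_hdlx : PB 2 (inx (half * dl)).
Proof.
rewrite fps_inxM -[2%N]/(0 + 2)%N; apply: PB_mul PB_dlx.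
exact/PB_inx/tame_const.
Qed.

Lemma PB_hdly : PB 2 (iny (half * dl)).
Proof.
rewrite fps_inyM -[2%N]/(0 + 2)%N; apply: PB_mul PB_dly.
exact/PB_iny/tame_const.
Qed.

Lemma PB0 m : PB m 0.
Proof.
apply: (@PB_weaken 0) => //; rewrite -inx0; exact/PB_inx/(tame_nat 0).
Qed.

Lemma PB_opp m U : PB m U -> PB m (- U).
Proof.
move=> pU; have -> : - U = inx (-1) * U by rewrite inxN fps_inx1 mulN1r.
by rewrite -[m]add0n; apply: PB_mul pU; apply/PB_inx/tame_opp/tame1.
Qed.

Lemma Dx_D U V : Dx (U + V) = Dx U + Dx V.
Proof. exact: fps_derivD. Qed.
Lemma Dx_M U V : Dx (U * V) = Dx U * V + U * Dx V.
Proof. exact: fps_derivM. Qed.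

Lemma PB_Dx m U : PB m U -> PB (m + 2) (Dx U).
Proof.
elim=> {m U} [c tc|c tc|||||| m X Y _ IX _ IY|m m' X Y pX IX pY IY|m m' X mm' _ IX].
- by rewrite fps_Dx_inx; apply: (@PB_weaken 0) => //; apply/PB_inx/tame_deriv.
- by rewrite fps_Dx_iny; apply: PB0.
- by rewrite fps_Dx_inx D_al fps_inxM addnC; apply: PB_mul PB_alx; apply: PB_dlx.
- by rewrite fps_Dx_iny; apply: PB0.
- rewrite Dx_F -[(1 + 2)%N]/(2 + 0 + 1)%N; apply: PB_mul PB_F.
  by apply: PB_mul PB_hx; apply: PB_hdlx.
- have -> : Dx (inx h * F) = - (inx dl * (inx h * F)) +
      inx (half * dl) * (inx h * F) * (inx h * F).
    by rewrite Dx_M fps_Dx_inx D_h inxN fps_inxM Dx_F; ring.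
  rewrite -[(0 + 2)%N]/(2 + 0 + 0)%N; apply: PB_add.
    by apply: PB_opp; apply: PB_mul PB_hx; apply: PB_dlx.
  by apply: PB_mul PB_hx; apply: PB_mul PB_hx; apply: PB_hdlx.
- have -> : Dx (iny h * F) = inx (half * dl) * (inx h * F) * (iny h * F).
    by rewrite Dx_M fps_Dx_iny Dx_F; ring.
  rewrite -[(0 + 2)%N]/(2 + 0 + 0)%N.
  by apply: PB_mul PB_hy; apply: PB_mul PB_hx; apply: PB_hdlx.
- by rewrite Dx_D; apply: PB_add.
- rewrite Dx_M; apply: PB_add; first by rewrite addnAC; apply: PB_mul.
  by rewrite -addnA; apply: PB_mul.
- by apply: PB_weaken IX; rewrite leq_add2r.
Qed.

Lemma PB_Dy m U : PB m U -> PB (m + 2) (Dy U).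
Proof.
elim=> {m U} [c tc|c tc|||||| m X Y _ IX _ IY|m m' X Y pX IX pY IY|m m' X mm' _ IX].
- by rewrite fps_Dy_inx; apply: PB0.
- by rewrite fps_Dy_iny; apply: (@PB_weaken 0) => //; apply/PB_iny/tame_deriv.
- by rewrite fps_Dy_inx; apply: PB0.
- by rewrite fps_Dy_iny D_al fps_inyM addnC; apply: PB_mul PB_aly; apply: PB_dly.
- rewrite Dy_F -[(1 + 2)%N]/(2 + 0 + 1)%N; apply: PB_mul PB_F.
  by apply: PB_mul PB_hy; apply: PB_hdly.
- have -> : Dy (inx h * F) = iny (half * dl) * (iny h * F) * (inx h * F).
    by rewrite fps_DyM fps_Dy_inx Dy_F; ring.
  rewrite -[(0 + 2)%N]/(2 + 0 + 0)%N.
  by apply: PB_mul PB_hx; apply: PB_mul PB_hy; apply: PB_hdly.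
- have -> : Dy (iny h * F) = - (iny dl * (iny h * F)) +
      iny (half * dl) * (iny h * F) * (iny h * F).
    by rewrite fps_DyM fps_Dy_iny D_h inyN fps_inyM Dy_F; ring.
  rewrite -[(0 + 2)%N]/(2 + 0 + 0)%N; apply: PB_add.
    by apply: PB_opp; apply: PB_mul PB_hy; apply: PB_dly.
  by apply: PB_mul PB_hy; apply: PB_mul PB_hy; apply: PB_hdly.
- by rewrite fps_DyD; apply: PB_add.
- rewrite fps_DyM; apply: PB_add; first by rewrite addnAC; apply: PB_mul.
  by rewrite -addnA; apply: PB_mul.
- by apply: PB_weaken IX; rewrite leq_add2r.
Qed.

Definition dxy k l U := diag (iter k Dx (iter l Dy U)).

Lemma Pol_dxyF k l : Pol (2 * (k + l) + 1) (dxy k l F).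
Proof.
apply: PB_diag; have pl : PB (2 * l + 1) (iter l Dy F).
  elim: l => [|l IH]; first exact: PB_F.
  by rewrite iterS; apply: (PB_weaken _ (PB_Dy IH)); lia.
elim: k => [|k IH]; first by rewrite add0n.
by rewrite iterS; apply: (PB_weaken _ (PB_Dx IH)); lia.
Qed.

Lemma PxyE : inx P * F = iny P * F + 2 * inx h + - (2 * iny h).
Proof.
have -> : inx P = inx h * inx h by rewrite /P expr2 fps_inxM.
have -> : iny P = iny h * iny h by rewrite /P expr2 fps_inyM.
transitivity (iny h * iny h * F + (inx h - iny h) * ((inx h + iny h) * F)); first by ring.
by rewrite FE; ring.
Qed.


Lemma iter_DyDx k l U : iter k Dx (iter l Dy U) = iter l Dy (iter k Dx U).
Proof.
elim: k => //= k ->; elim: l (iter k Dx U) => //= l IH W.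
by rewrite fps_DxDy IH.
Qed.

Lemma diag_sum n (f : 'I_n -> fps (fps R)) :
  diag (\sum_(i < n) f i) = \sum_(i < n) diag (f i).
Proof.
elim/big_rec2: _ => [|i x y _ <-]; last by rewrite diagD.
by rewrite -inx0 fps_diag_inx.
Qed.

Lemma diag_muln U n : diag (U *+ n) = diag U *+ n.
Proof.
by elim: n => [|n IH]; rewrite ?mulr0n -?[in LHS]inx0 ?fps_diag_inx // !mulrS diagD IH.
Qed.

Lemma iter_Dx_inx k c : iter k Dx (inx c) = inx (iter k D c).
Proof. by elim: k => //= k ->; rewrite fps_Dx_inx. Qed.

Lemma iter_Dy_iny k c : iter k Dy (iny c) = iny (iter k D c).
Proof. by elim: k => //= k ->; rewrite fps_Dy_iny. Qed.

Lemma dxy_inx k l c U : dxy k l (inx c * U) =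
  \sum_(i < k.+1) iter i D c * dxy (k - i) l U *+ 'C(k, i).
Proof.
have e : iter l Dy (inx c * U) = inx c * iter l Dy U.
  by elim: l => //= l ->; rewrite fps_DyM fps_Dy_inx mul0r add0r.
rewrite /dxy e iter_leibniz; [|exact: Dx_D|exact: Dx_M].
rewrite diag_sum; apply: eq_bigr => i _.
by rewrite diag_muln fps_diagM iter_Dx_inx fps_diag_inx.
Qed.

Lemma dxy_iny k l c U : dxy k l (iny c * U) =
  \sum_(j < l.+1) iter j D c * dxy k (l - j) U *+ 'C(l, j).
Proof.
have e : iter k Dx (iny c * U) = iny c * iter k Dx U.
  by elim: k => //= k ->; rewrite Dx_M fps_Dx_iny mul0r add0r.
rewrite /dxy iter_DyDx e iter_leibniz; [|exact: fps_DyD|exact: fps_DyM].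
rewrite diag_sum; apply: eq_bigr => i _.
by rewrite diag_muln fps_diagM iter_Dy_iny diag_iny iter_DyDx.
Qed.

Lemma dxyD k l U V : dxy k l (U + V) = dxy k l U + dxy k l V.
Proof.
rewrite /dxy; have -> : iter l Dy (U + V) = iter l Dy U + iter l Dy V.
  by elim: l => //= l ->; rewrite fps_DyD.
rewrite -diagD; congr diag; by elim: k => //= k ->; rewrite Dx_D.
Qed.

Lemma iter_D0 k : iter k D 0 = 0.
Proof.
by elim: k => //= k ->; apply: fpsP => n; rewrite -[LHS]/((0 : fps R) n.+1 *+ n.+1) !fps_coef0 mul0rn.
Qed.

Lemma dxy_inx0 k l c : dxy k l.+1 (inx c) = 0.
Proof.
have := dxy_inx k l.+1 c 1; rewrite mulr1 => ->.
rewrite big1 // => i _; rewrite /dxy iterSr -fps_inx1 fps_Dy_inx -inx0.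
have -> : iter l Dy (inx 0) = inx 0.
  by elim: l => //= l ->; rewrite fps_Dy_inx inx0.
by rewrite iter_Dx_inx fps_diag_inx iter_D0 mulr0 mul0rn.
Qed.

Lemma dxy_iny0 k l c : dxy k.+1 l (iny c) = 0.
Proof.
rewrite /dxy iter_Dy_iny iterSr fps_Dx_iny -inx0 iter_Dx_inx fps_diag_inx.
exact: iter_D0.
Qed.

(* A factor h^2 lowers the order by 2, which Pol does not record. *)
Definition hPol m X := exists2 V, Pol m V & X = h ^+ 2 * V.

Lemma hPol_add m X Y : hPol m X -> hPol m Y -> hPol m (X + Y).
Proof.
by move=> [V pV ->] [W pW ->]; exists (V + W); [apply: Pol_add | rewrite mulrDr].
Qed.

Lemma hPol_opp m X : hPol m X -> hPol m (- X).
Proof. by move=> [V pV ->]; exists (- V); [apply: Pol_opp | rewrite mulrN]. Qed.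

Lemma hPol_muln m X n : hPol m X -> hPol m (X *+ n).
Proof. by move=> [V pV ->]; exists (V *+ n); [apply: Pol_muln | rewrite mulrnAr]. Qed.

Lemma hPol_sum m n (f : 'I_n -> fps R) : (forall i, hPol m (f i)) ->
  hPol m (\sum_(i < n) f i).
Proof.
move=> hf; elim/big_ind: _ => // [|X Y]; last exact: hPol_add.
by exists 0; [apply: Pol0 | rewrite mulr0].
Qed.

(** Each of the two main terms has weight [2 * (k + l) + 3]: the point is that they cancel to
    leading order. They come from exactly one derivative falling on [h^2], in [x] on one side of
    [PxyE] and in [y] on the other. *)
Lemma dom_dxyF k l :
  dom (2 * (k + l) + 2) (g * (dxy k l.+1 F *+ k.+1 - dxy k.+1 l F *+ l.+1)).
Proof.
suff [W pW ->] : hPol (2 * (k + l) + 4)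
    (g * (dxy k l.+1 F *+ k.+1 - dxy k.+1 l F *+ l.+1)).
  have -> : (2 * (k + l) + 2 = 2 * (k + l) + 4 - 2)%N by lia.
  by apply: h2_Pol_dom pW; lia.
have := congr1 (dxy k.+1 l.+1) PxyE.
rewrite !dxyD -mulrN -(inx_natr 2) -fps_inxM dxy_inx0 addr0.
have -> : inx 2 * - iny h = iny (- (2 * h)).
  by rewrite inyN fps_inyM iny_natr inx_natr mulrN.
rewrite dxy_iny0 addr0 dxy_inx dxy_iny.
(* The terms where [h^2] is not differentiated agree on both sides once [x = y], and [addrI] removes
   them. *)
rewrite !big_ord_recl /= !subn0 !subSS !subn0 !bin0 !bin1 => /addrI.
rewrite !D_P; set S1 := \sum_(i < _) _; set S2 := \sum_(i < _) _ => e.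
have h1 : hPol (2 * (k + l) + 4) S1.
  apply: hPol_sum => i; have [V pV eV] := iter_D_P i.
  apply: hPol_muln; rewrite /= -[D (D _)]/(iter i.+2 D P) eV.
  exists (V * dxy (k - i.+1) l.+1 F); last by rewrite mulrA.
  apply: (Pol_weaken _ (Pol_mul pV (Pol_dxyF _ _))).
  by have := ltn_ord i; lia.
have h2 : hPol (2 * (k + l) + 4) S2.
  apply: hPol_sum => i; have [V pV eV] := iter_D_P i.
  apply: hPol_muln; rewrite /= -[D (D _)]/(iter i.+2 D P) eV.
  exists (V * dxy k.+1 (l - i.+1) F); last by rewrite mulrA.
  apply: (Pol_weaken _ (Pol_mul pV (Pol_dxyF _ _))).
  by have := ltn_ord i; lia.
have h3 : hPol (2 * (k + l) + 4) (h ^+ 2 * V1 * dxy k l.+1 F).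
  exists (V1 * dxy k l.+1 F); last by rewrite mulrA.
  by apply: (Pol_weaken _ (Pol_mul Pol_V1 (Pol_dxyF _ _))); lia.
have h4 : hPol (2 * (k + l) + 4) (h ^+ 2 * V1 * dxy k.+1 l F).
  exists (V1 * dxy k.+1 l F); last by rewrite mulrA.
  by apply: (Pol_weaken _ (Pol_mul Pol_V1 (Pol_dxyF _ _))); lia.
have -> : g * (dxy k l.+1 F *+ k.+1 - dxy k.+1 l F *+ l.+1) =
   S1 - S2 - (h ^+ 2 * V1 * dxy k l.+1 F) *+ k.+1 +
   (h ^+ 2 * V1 * dxy k.+1 l F) *+ l.+1.
  apply/eqP; rewrite -subr_eq0; apply/eqP.
  move/eqP: e; rewrite -subr_eq0 => /eqP e.
  rewrite -[RHS]oppr0 -e; ring.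
apply: hPol_add; last exact: hPol_muln.
by apply: hPol_add; [apply: hPol_add => //; apply: hPol_opp | apply/hPol_opp/hPol_muln].
Qed.

Variable Core : fps (fps R).
Hypothesis Core_ge0 : forall d e, 0 <= Core d e.
Hypothesis gE : g = diag Core.

Lemma diag_ge0 U : (forall d e, 0 <= U d e) -> fps_le 0 (diag U).
Proof. by move=> h0 n; rewrite fps_coef0 fps_diagE sumr_ge0. Qed.

(** With nonnegative coefficients a partial derivative is, on the diagonal, at most the derivative
    of the diagonal, by [fps_deriv_diag]. So tameness of [g] controls the mixed derivatives of
    [Core]. *)
Lemma dom_dxy_Core k l i :
  fps_le (fps_abs (iter i D (dxy k l Core))) (iter (i + (k + l)) D g).
Proof.
have Dle (U : fps (fps R)) : (forall d e, 0 <= U d e) ->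
    (forall d e, 0 <= Dx U d e) /\ (forall d e, 0 <= Dy U d e).
  by move=> U0; split=> d e /=; rewrite ?fps_coefMn mulrn_wge0.
have step (U : fps (fps R)) : (forall d e, 0 <= U d e) ->
    fps_le (diag (Dx U)) (D (diag U)) /\ fps_le (diag (Dy U)) (D (diag U)).
  move=> U0; have [x0 y0] := Dle _ U0.
  rewrite fps_deriv_diag; split=> n; rewrite fps_coefD ?lerDl ?lerDr;
    exact/fps_ge0/diag_ge0.
have iterle j X Y : fps_le X Y -> fps_le (iter j D X) (iter j D Y).
  by move=> XY; elim: j => //= j IH; apply: fps_le_deriv.
have C0 : forall d e, 0 <= iter k Dx (iter l Dy Core) d e.
  elim: k => [|k IH] /=; last by case: (Dle _ IH).
  by elim: l => [|l IH] //=; case: (Dle _ IH).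
rewrite fps_abs_id; last first.
  elim: i => [|i IH]; first exact: diag_ge0.
  exact: fps_deriv_ge0.
rewrite iterD; apply: iterle.
elim: k C0 => [|k IH] C0; rewrite /dxy.
  elim: l C0 => [|l IH] C0; first by rewrite gE.
  have C0' : forall d e, 0 <= iter l Dy Core d e.
    by elim: l {IH C0} => [|l IH] //=; case: (Dle _ IH).
  by rewrite !iterS; apply: (fps_le_trans (step _ C0').2); apply/fps_le_deriv/IH.
have C0' : forall d e, 0 <= iter k Dx (iter l Dy Core) d e.
  elim: k {IH C0} => [|k IH] /=; last by case: (Dle _ IH).
  by elim: l => [|l IH] //=; case: (Dle _ IH).
by rewrite addSn !iterS; apply: (fps_le_trans (step _ C0').1); apply/fps_le_deriv/IH.
Qed.

Lemma tame_dxy_Core k l : tame (dxy k l Core).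
Proof.
move=> i; apply: dom_le (gT (i + (k + l))) => n.
apply: le_trans (dom_dxy_Core k l i n) _; exact: ler_norm.
Qed.


Lemma dxyM k l U V : dxy k l (U * V) = \sum_(i < k.+1) \sum_(j < l.+1)
  dxy i j U * dxy (k - i) (l - j) V *+ 'C(l, j) *+ 'C(k, i).
Proof.
rewrite /dxy iter_DyDx iter_leibniz; [|exact: Dx_D|exact: Dx_M].
have iterDs n (f : 'I_n -> fps (fps R)) :
    iter l Dy (\sum_(i < n) f i) = \sum_(i < n) iter l Dy (f i).
  elim: l => [//|l IH]; rewrite iterS IH.
  elim/big_rec2: _ => [|i x y _ <-]; last by rewrite fps_DyD.
  by rewrite -inx0 fps_Dy_inx inx0.
have iterDn m W n : iter m Dy (W *+ n) = iter m Dy W *+ n.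
  elim: m => //= m ->; elim: n => [|n IH]; last by rewrite !mulrS fps_DyD IH.
  by rewrite !mulr0n -inx0 fps_Dy_inx inx0.
rewrite iterDs diag_sum; apply: eq_bigr => i _; rewrite iterDn diag_muln sumrMnl.
congr (_ *+ _); rewrite iter_leibniz; [|exact: fps_DyD|exact: fps_DyM].
rewrite diag_sum; apply: eq_bigr => j _.
by rewrite diag_muln fps_diagM !iter_DyDx.
Qed.

(** A derivative spent on [Core] saves weight 2, so only the term with [Core] undifferentiated
    counts. *)
Lemma dxy_CoreF k l : exists2 X, Pol (2 * (k + l)) X &
  dxy k l (Core * F) = g * dxy k l F + X.
Proof.
have pt i j : (0 < i + j)%N -> (i <= k)%N -> (j <= l)%N ->
    Pol (2 * (k + l)) (dxy i j Core * dxy (k - i) (l - j) F).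
  move=> ij ik jl; apply: (Pol_weaken _
    (Pol_mul (Pol_tame (tame_dxy_Core i j)) (Pol_dxyF _ _))); lia.
rewrite dxyM big_ord_recl big_ord_recl !bin0 !mulr1n !subn0 /=.
have -> : dxy 0 0 Core = g by rewrite gE.
rewrite -addrA; eexists; last by [].
apply: Pol_add.
  apply: Pol_sum => j; do ?apply: Pol_muln.
  have := pt 0%N (lift ord0 j); rewrite subn0; apply; rewrite // lift0.
  exact: ltn_ord.
apply: Pol_sum => i; apply: Pol_sum => j; do 2 apply: Pol_muln.
by apply: pt; rewrite ?lift0 // -ltnS.
Qed.

Lemma dom_dxyN k l : dom (2 * (k + l) + 2)
  (dxy k l.+1 (Core * F) *+ k.+1 - dxy k.+1 l (Core * F) *+ l.+1).
Proof.
have [X pX ->] := dxy_CoreF k l.+1; have [Y pY ->] := dxy_CoreF k.+1 l.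
have -> : (g * dxy k l.+1 F + X) *+ k.+1 - (g * dxy k.+1 l F + Y) *+ l.+1 =
   g * (dxy k l.+1 F *+ k.+1 - dxy k.+1 l F *+ l.+1) + (X *+ k.+1 - Y *+ l.+1).
  by rewrite !mulrnDl mulrBr -!mulrnAr opprD addrACA.
apply: dom_add; first exact: dom_dxyF.
apply: Pol_dom; apply: Pol_add; [|apply: Pol_opp]; apply: Pol_muln.
  by apply: Pol_weaken pX; lia.
by apply: Pol_weaken pY; lia.
Qed.

Lemma D_BX_ge m : (0 < m)%N -> fps_le (B ^+ (m + 2)) (D (B ^+ m)).
Proof.
case: m => // m _; rewrite D_exp D_B.
apply: (@fps_le_trans _ _ (B ^+ m * (g * al * B ^+ 2))); last first.
  move=> n; rewrite fps_coefMn -mulr_natr ler_peMr ?ler1n //.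
  apply/fps_ge0/fps_le0M; first exact: BX_ge0.
  apply: fps_le0M (BX_ge0 _); apply: fps_le0M.
    by apply: fps_le_trans g_ge; apply: one_ge0.
  by apply: fps_le_trans al_ge; apply: B_ge0.
have -> : B ^+ (m.+1 + 2) = B ^+ m * (1 * B * B ^+ 2) by rewrite mul1r -exprS -exprD addSnnS.
apply: fps_leM => //; first exact: BX_ge0.
  by rewrite mul1r; apply: fps_le0M (BX_ge0 _); apply: B_ge0.
apply: fps_leMr; first exact: BX_ge0.
by apply: fps_leM; [apply: one_ge0 | apply: g_ge | apply: B_ge0 | apply: al_ge].
Qed.

(** [g * al] is the diagonal of [Core * F], so this is a lower bound for the normalisation of the
    moments: the order [2 * K + 1] is attained. *)
Lemma iter_D_gal K : fps_le (B ^+ (2 * K + 1)) (iter K D (g * al)).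
Proof.
elim: K => [|K IH].
  rewrite expr1 -[X in fps_le X _]mul1r.
  by apply: fps_leM; [apply: one_ge0 | apply: g_ge | apply: B_ge0 | apply: al_ge].
have -> : (2 * K.+1 + 1 = 2 * K + 1 + 2)%N by lia.
apply: (fps_le_trans (D_BX_ge _)); first by rewrite addn1.
exact: fps_le_deriv.
Qed.

(** A derivative multiplies coefficients by the index but raises the order by [B^2] only, so two
    powers of [B] are worth a factor [n]. *)
Lemma BX_gap2 m : (0 < m)%N ->
  exists2 C, 0 <= C & forall n, (B ^+ m) n * n.+1%:R <= C * (B ^+ m.+2) n.
Proof.
case: m => // m _; have : dom 1 (g * al).
  by rewrite -[1%N]/(0 + 1)%N; apply: dom_mul dom_al; exact: (gT 0).
case/(_ m.+2) => [|C C0 hC]; first by lia.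
exists (C * m.+1%:R); first by rewrite mulr_ge0.
move=> n; apply: (@le_trans _ _ (D (B ^+ m.+1) n)).
  by rewrite -[leRHS]/((B ^+ m.+1) n.+1 *+ n.+1) -[leRHS]mulr_natr ler_wpM2r // BX_shift.
rewrite D_exp D_B fps_coefMn -[leLHS]mulr_natr [leRHS]mulrAC ler_wpM2r //.
have -> : B ^+ m * (g * al * B ^+ 2) = g * al * B ^+ m.+2 by rewrite !exprS; ring.
have := hC n; rewrite fps_coefCM addn1 fps_abs_id //.
apply: fps_le0M; first by apply: fps_le_trans g_ge; apply: one_ge0.
by apply: fps_le_trans al_ge; apply: B_ge0.
Qed.

Lemma fps_eval_ge0 (Q : fps R) : fps_le 0 Q -> fps_le 0 (fps_eval A (inx Q)).
Proof.
move=> Q0 n; rewrite fps_coef0 sumr_ge0 // => d _.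
by rewrite fps_coefCM mulr_ge0 //; apply: fps_ge0 => //; apply: fps_le0X.
Qed.

Lemma fps_eval_inxX : fps_eval A (inx (fpsX R)) = A.
Proof.
apply: fpsP => -[|n] /=; first by rewrite big_ord1 fps_coefCM mul0r A0.
rewrite !big_ord_recl big1 => [|i _]; last by rewrite fps_coefCM mul0r.
by rewrite !fps_coefCM /= mul0r add0r addr0 mul1r expr1.
Qed.

(* With B = sum_j A^j, the polynomial B^3 - 2 L B^2 + 2 L^2 B has coefficient
   ((t - 2 L)^2 + t) / 2 at A^(t-1). *)
Lemma BX_quad (L : R) n : (B ^+ 2) n * (2 * L) <= (B ^+ 3) n + B n * (2 * L ^+ 2).
Proof.
(* [B] is [G] evaluated at [A], and substituting the nonnegative [A] preserves nonnegativity; so it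
   suffices to compare powers of [G]. *)
pose G : fps R := Fps (fun=> 1).
have G1 : (1 - fpsX R) * G = 1.
  apply: fpsP => k; rewrite mulrBl mul1r fps_coefB fps_coefXM fps_coef1.
  by case: k => [|k] /=; rewrite ?subr0 ?subrr.
have GB : fps_eval A (inx G) = B.
  have : fps_eval A (inx ((1 - fpsX R) * G)) = 1 by rewrite G1 fps_inx1 fps_eval1.
  rewrite fps_inxM; move: (fps_evalM (inx (1 - fpsX R)) (inx G) A0) => -> .
  rewrite fps_inxD inxN fps_inx1 fps_evalD fps_evalN fps_eval1 fps_eval_inxX => e; rewrite -[LHS]mul1r -BE [_ * B]mulrC -mulrA e mulr1 //.
have G2 k : (G ^+ 2) k = k.+1%:R.
  rewrite expr2 fps_coefM /= (eq_bigr (fun=> 1)); last by move=> i _; rewrite mulr1.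
  by rewrite sumr_const card_ord.
have G3 k : (G ^+ 3) k * 2 = k.+1%:R * k.+2%:R.
  rewrite exprSr fps_coefM /= (eq_bigr (fun i : 'I_k.+1 => i.+1%:R)); last first.
    by move=> i _; rewrite mulr1 G2.
  elim: k => [|k IH]; first by rewrite big_ord1 mul1r.
  rewrite big_ord_recr /= mulrDl IH -(natr1 k.+2 : _ = _ :> R) -(natr1 k.+1 : _ = _ :> R); ring.
pose Q := G ^+ 3 + fps_const (2 * L ^+ 2) * G - fps_const (2 * L) * G ^+ 2.
have Q0 : fps_le 0 Q.
  move=> k; rewrite fps_coef0 fps_coefB fps_coefD !fps_coefCM G2 /= mulr1.
  have := G3 k; rewrite -(natr1 k.+1 : _ = _ :> R); set t := k.+1%:R; set c := fcoef (G ^+ 3) k => e.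
  have t0 : 0 <= t by rewrite ler0n.
  have : 0 <= (t - 2 * L) ^+ 2 + t by rewrite addr_ge0 // sqr_ge0.
  by nra.
have := fps_eval_ge0 Q0 n.
have inxX j : inx (G ^+ j) = inx G ^+ j.
  by elim: j => [|j IH]; rewrite ?fps_inx1 // !exprS fps_inxM IH.
have evX j : fps_eval A (inx G ^+ j) = B ^+ j.
  elim: j => [|j IH]; first exact: fps_eval1.
  rewrite !exprS -IH -GB; exact: fps_evalM.
have evc (c : R) X : fps_eval A (inx (fps_const c * X)) = fps_const c * fps_eval A (inx X).
  rewrite fps_inxM (fps_evalM (inx (fps_const c))) //; congr (_ * _).
  rewrite -[RHS](fps_eval_iny A); congr fps_eval.
  by apply: fpsP => -[|k] //=; apply: fpsP => -[].
rewrite /Q !fps_inxD inxN !fps_evalD fps_evalN !evc !inxX !evX GB.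
rewrite fps_coefB fps_coefD !fps_coefCM fps_coef0 subr_ge0.
by rewrite ![(B ^+ 2) n * _]mulrC [B n * _]mulrC.
Qed.

Lemma BX_quadm (L : R) m n :
  (B ^+ m.+2) n * (2 * L) <= (B ^+ m.+3) n + (B ^+ m.+1) n * (2 * L ^+ 2).
Proof.
have h2 : fps_le (fps_const (2 * L) * B ^+ 2 * B ^+ m)
    ((B ^+ 3 + fps_const (2 * L ^+ 2) * B) * B ^+ m).
  apply: fps_leMr; first exact: BX_ge0.
  by move=> k; rewrite fps_coefD !fps_coefCM mulrC [X in _ <= _ + X]mulrC BX_quad.
have e1 : fps_const (2 * L) * B ^+ 2 * B ^+ m = fps_const (2 * L) * B ^+ m.+2.
  by rewrite -mulrA -exprD.
have e2 : (B ^+ 3 + fps_const (2 * L ^+ 2) * B) * B ^+ m =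
    B ^+ m.+3 + fps_const (2 * L ^+ 2) * B ^+ m.+1.
  by rewrite [LHS]mulrDl -exprD -mulrA -exprS.
have := h2 n; rewrite e1 e2.
move: (B ^+ m.+1) (B ^+ m.+2) (B ^+ m.+3) => b1 b2 b3; rewrite fps_coefD !fps_coefCM.
by rewrite mulrC [X in _ <= _ + X]mulrC.
Qed.

(** [BX_gap2] only separates powers two apart. [BX_quadm] with [L = 1 / eps] interpolates: for large
    [n] its term in [B^(m+1)] is absorbed by [B^(m+3)]. *)
Lemma BX_small m (eps : R) : 0 < eps ->
  exists n0, forall n, (n0 <= n)%N -> (B ^+ m.+2) n <= eps * (B ^+ m.+3) n.
Proof.
move=> e0; have [//|C C0 hC] := @BX_gap2 m.+1.
pose L := eps^-1; have L0 : 0 < L by rewrite invr_gt0.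
exists (Num.bound (2 * L ^+ 2 * C)) => n hn.
have := BX_quadm L m n; have := hC n.
set b1 := (B ^+ m.+1) n; set b2 := (B ^+ m.+2) n; set b3 := (B ^+ m.+3) n => h1 h2'.
have b30 : 0 <= b3 by apply/fps_ge0/BX_ge0.
have n1 : 2 * L ^+ 2 * C <= n.+1%:R.
  apply: (le_trans (ltW (archi_boundP _))); first by rewrite !mulr_ge0 // ltW.
  by rewrite ler_nat; apply: leq_trans hn _.
have : b1 * (2 * L ^+ 2) <= b3.
  rewrite -(@ler_pM2r _ n.+1%:R) ?ltr0Sn // mulrAC.
  apply: (@le_trans _ _ (C * b3 * (2 * L ^+ 2))).
    by rewrite ler_wpM2r // mulr_ge0 // exprn_ge0 // ltW.
  have -> : C * b3 * (2 * L ^+ 2) = b3 * (2 * L ^+ 2 * C) by ring.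
  by rewrite ler_wpM2l.
move=> h3; have h4 : b2 * (2 * L) <= b3 + b3 by apply: le_trans h2' _; rewrite lerD2l.
rewrite -(@ler_pM2r _ (2 * L)) ?mulr_gt0 //; apply: (le_trans h4).
have -> : eps * b3 * (2 * L) = (eps * L) * (b3 + b3) by ring.
by rewrite /L mulfV ?gt_eqF // mul1r.
Qed.

Lemma iter_Dx_coef k U d e : iter k Dx U d e = U (d + k)%N e *+ (d + k) ^_ k.
Proof.
elim: k d => [|k IH] d; first by rewrite addn0.
rewrite iterS -[LHS]/((iter k Dx U d.+1 *+ d.+1) e) fps_coefMn IH -mulrnA.
by rewrite -addSnnS ffactnSr addnK.
Qed.

Lemma iter_Dy_coef l U d e : iter l Dy U d e = U d (e + l)%N *+ (e + l) ^_ l.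
Proof.
elim: l e => [|l IH] e; first by rewrite addn0.
by rewrite iterS -[LHS]/(iter l Dy U d e.+1 *+ e.+1) IH -mulrnA -addSnnS ffactnSr addnK.
Qed.

(** For a counting series, after division by the total [bin_moment 0 0 s U], the expectation of
    [C(D, k) * C(s - D, l)] for the degree [D] among [s] other vertices. *)
Definition bin_moment k l s U : R :=
  \sum_(d < s.+1) U d (s - d)%N *+ ('C(d, k) * 'C(s - d, l)).

Lemma dxy_bin_moment k l U n :
  dxy k l U n = bin_moment k l (n + k + l) U *+ (k`! * l`!).
Proof.
rewrite /dxy fps_diagE /bin_moment.
pose f d := U d (n + k + l - d)%N *+ ('C(d, k) * 'C(n + k + l - d, l)).
have z1 : \sum_(0 <= d < k) f d = 0.
  by rewrite big_nat big1 // => d /andP[_ dk]; rewrite /f bin_small.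
have z2 : \sum_(n.+1 + k <= d < (n + k + l).+1) f d = 0.
  rewrite big_nat big1 // => d /andP[dk dn].
  by rewrite /f [X in (_ * X)%N]bin_small ?muln0 //; lia.
rewrite -(big_mkord xpredT f) (@big_cat_nat _ _ _ k) //=; last by lia.
rewrite z1 add0r (@big_cat_nat _ _ _ (n.+1 + k)) //=; [|lia|lia].
rewrite z2 addr0.
rewrite -[X in \sum_(X <= _ < _) _]add0n big_addn addnK big_mkord -sumrMnl.
apply: eq_bigr => d _; rewrite iter_Dx_coef iter_Dy_coef /f -!mulrnA.
have dn : (d <= n)%N by rewrite -ltnS.
have -> : (n + k + l - (d + k) = n - d + l)%N by lia.
by congr (_ *+ _); rewrite -!bin_ffact; ring.
Qed.

Lemma bin_moment_total s U : bin_moment 0 0 s U = diag U s.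
Proof.
by rewrite fps_diagE; apply: eq_bigr => d _; rewrite !bin0 mulr1n.
Qed.

Lemma diag_CoreF : diag (Core * F) = g * al.
Proof. by rewrite fps_diagM -gE diag_F. Qed.

(** By [dom_dxyN] the difference is of order [2 * (k + l) + 2], by [iter_D_gal] the right side is at
    least of the next order, and [BX_small] separates the two. *)
Lemma bin_moment_close k l (eps : R) : 0 < eps -> exists s0, forall s, (s0 <= s)%N ->
  `|bin_moment k l.+1 s (Core * F) - bin_moment k.+1 l s (Core * F)| <=
    eps * ('C(s, k + l.+1)%:R * bin_moment 0 0 s (Core * F)).
Proof.
move=> e0; have := @dom_dxyN k l; case/(_ 0%N) => [|C C0 hC]; first by rewrite addn2.
(* The [+ 1] keeps the denominator positive when [C = 0]. *)
set K := (k + l.+1)%N; set eps' := eps / (C * K`!%:R + 1).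
have CK0 : 0 < C * K`!%:R + 1 by rewrite ltr_wpDl ?ltr01 // mulr_ge0.
have [|n0 hn0] := @BX_small (2 * (k + l)) eps'; first by rewrite divr_gt0.
exists (n0 + K)%N => s hs; set n := (s - K)%N.
have sn : s = (n + K)%N by rewrite /n subnK //; apply: leq_trans hs; rewrite leq_addl.
have : `|(dxy k l.+1 (Core * F) *+ k.+1 - dxy k.+1 l (Core * F) *+ l.+1) n| <=
    C * (B ^+ (2 * (k + l)).+2) n.
  by have := hC n; rewrite mulr1 fps_coefCM add0n addn2.
rewrite fps_coefB !fps_coefMn !dxy_bin_moment.
have -> : (n + k + l.+1 = s)%N by rewrite sn /K; lia.
have -> : (n + k.+1 + l = s)%N by rewrite sn /K; lia.
set X := bin_moment k l.+1 s _; set Y := bin_moment k.+1 l s _.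
(* The weights [k.+1] and [l.+1] complete both factorial products to the same one. *)
have -> : X *+ (k`! * l.+1`!) *+ k.+1 - Y *+ (k.+1`! * l`!) *+ l.+1 =
    (X - Y) *+ (k.+1`! * l.+1`!).
  by rewrite mulrnBl -!mulrnA !factS; congr (_ *+ _ - _ *+ _); ring.
rewrite normrMn => h1.
have h2 : `|X - Y| <= C * (B ^+ (2 * (k + l)).+2) n.
  by apply: le_trans h1; rewrite -[leRHS]mulr_natr ler_peMr // ler1n muln_gt0 !fact_gt0.
apply: (le_trans h2).
have hn : (n0 <= n)%N by rewrite /n; lia.
have h3 : (B ^+ (2 * (k + l)).+3) n <= K`!%:R * ('C(s, K)%:R * bin_moment 0 0 s (Core * F)).
  have -> : (2 * (k + l)).+3 = (2 * K + 1)%N by rewrite /K; lia.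
  apply: (le_trans (iter_D_gal K n)).
  rewrite -diag_CoreF iter_D_coef -sn -bin_moment_total -bin_ffact mulrnA.
  by rewrite !mulr_natl.
apply: (@le_trans _ _ (C * (eps' * (K`!%:R * ('C(s, K)%:R * bin_moment 0 0 s (Core * F)))))).
  rewrite ler_wpM2l //; apply: (le_trans (hn0 n hn)).
  by rewrite ler_wpM2l // ltW // divr_gt0.
set Z := 'C(s, K)%:R * _.
have Z0 : 0 <= Z.
  rewrite mulr_ge0 // bin_moment_total diag_CoreF; apply/fps_ge0/fps_le0M.
    exact: fps_le_trans one_ge0 g_ge.
  exact: fps_le_trans B_ge0 al_ge.
have -> : C * (eps' * (K`!%:R * Z)) = (C * K`!%:R / (C * K`!%:R + 1)) * (eps * Z).
  by rewrite /eps'; ring.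
apply: ler_piMl; first by rewrite mulr_ge0 // ltW.
by rewrite ler_pdivrMr // mul1r lerDl ler01.
Qed.

End Kernel.

(** The labeled and the unlabeled model enter the analysis only through [A], [N] and [Core]
    satisfying these hypotheses. *)
Theorem bin_moment_limit (R : archiRealFieldType) (A : fps R)
    (N Core : fps (fps R)) (c : R) :
  fps_le 0 A -> A 0%N = 0 -> 1 <= A 1%N ->
  N * (1 - fps_inx A * fps_iny A) = (1 + fps_inx A) * (1 + fps_iny A) * Core ->
  fps_deriv A = fps_diag N ->
  (forall d e, 0 <= Core d e) -> 1 <= Core 0%N 0%N -> 0 <= c ->
  (forall n, (0 < n)%N -> fps_diag Core n <=
    c * n.+1%:R * \sum_(m < n.+2 | (0 < m)%N && (2 * m <= n.+1)%N) A m) ->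
  forall k l (eps : R), 0 < eps -> exists s0, forall s, (s0 <= s)%N ->
  `|bin_moment k l.+1 s N - bin_moment k.+1 l s N| <=
    eps * ('C(s, k + l.+1)%:R * bin_moment 0 0 s N).
Proof.
move=> A_ge0 A0 A1 NE AN C_ge0 C1 c0 hg.
have [|B BE _] := @fps_inv_ex _ (1 - A); first by rewrite fps_coefB A0 subr0.
have [|Y YE _] := @fps_inv_ex _ (1 + A); first by rewrite fps_coefD A0 addr0.
pose al := 2 * B - 1; pose h := (1 - A) * Y.
have hE : h * (1 + A) = 1 - A by rewrite /h -mulrA [Y * _]mulrC YE mulr1.
set a := fps_inx A in NE *; set b := fps_iny A in NE *.
have [|w wE _] := @fps_inv_ex _ (1 - a * b).
  by rewrite fps_coefB fps_coefM0 /= A0 -[fps_const 0]/(0 : fps R) mul0r subr0.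
pose F := (1 + a) * (1 + b) * w.
have hx : fps_inx h * (1 + a) = 1 - a.
  by rewrite -[1 in LHS]fps_inx1 -fps_inxD -fps_inxM hE fps_inxD inxN fps_inx1.
have hy : fps_iny h * (1 + b) = 1 - b.
  by rewrite -[1 in LHS](iny_natr R 1) -fps_inyD -fps_inyM hE fps_inyD inyN (iny_natr R 1).
have FE : (fps_inx h + fps_iny h) * F = 2.
  transitivity (2 * ((1 - a * b) * w)); last by rewrite wE mulr1.
  have -> : 2 * ((1 - a * b) * w) = ((1 - a) * (1 + b) + (1 - b) * (1 + a)) * w by ring.
  by rewrite -hx -hy /F; ring.
have NF : N = Core * F.
  rewrite -[LHS]mulr1 -wE mulrA NE /F; ring.
pose g := fps_diag Core.
have AD : fps_deriv A = g * al.
  by rewrite AN NF (diag_CoreF BE (erefl al) hE FE (erefl g)).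
have g_ge : fps_le 1 g.
  case=> [|n].
    by rewrite fps_coef1 /g fps_diagE big_ord1 subn0.
  by rewrite fps_coef1; apply/fps_ge0/diag_ge0.
have gT := tame_growth A_ge0 A0 A1 BE (erefl al) AD g_ge c0 hg.
rewrite NF => k l eps e0.
exact: (bin_moment_close A_ge0 A0 A1 BE (erefl al) hE AD g_ge gT FE C_ge0 (erefl g)).
Qed.

(** * The generating series of the two models *)

Section Series.
Variables (R : archiRealFieldType) (sym : bool).

(** Exponential in both variables: [f] already includes the choice of the [d] neighbours among
    [d + e] vertices, which turns [d! e!] into [(d + e)!]. *)
Definition egf2 (f : nat -> nat -> nat) : fps (fps R) :=
  Fps (fun d => Fps (fun e => (f (d + e)%N d)%:R / (d + e)`!%:R)).

Definition cnt_egf := egf2 (cnt sym).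
Definition core_egf := egf2 (corecnt sym).
(** Without constant term; the empty graph is the explicit 1 in [1 + str_egf]. *)
Definition str_egf : fps R :=
  Fps (fun m => if m is 0 then 0 else (strcnt sym m)%:R / m`!%:R).

Lemma fact_neq0 n : (n`!%:R : R) != 0.
Proof. by rewrite pnatr_eq0 -lt0n fact_gt0. Qed.

Lemma str_egf1 j : (1 + str_egf) j = (strcnt sym j)%:R / j`!%:R.
Proof.
by rewrite fps_coefD fps_coef1; case: j => [|j]; rewrite /= ?addr0 ?add0r // divr1.
Qed.

Lemma bin_fact_div n j : (j <= n)%N ->
  ('C(n, j)%:R / n`!%:R : R) = j`!%:R^-1 * (n - j)`!%:R^-1.
Proof.
move=> jn; rewrite -(bin_fact jn) !natrM; field.
by rewrite !fact_neq0 pnatr_eq0 -lt0n bin_gt0.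
Qed.

Lemma cnt_div (t : bool) n d : (cnt sym n d)%:R / n`!%:R = \sum_(j < n.+1 | (t * j <= d)%N)
  (strcnt sym j)%:R / j`!%:R * ((irrcnt sym t (n - j)%N (d - t * j)%N)%:R / (n - j)`!%:R) :> R.
Proof.
rewrite (cnt_rec sym t n d) natr_sum mulr_suml [RHS]big_mkcond; apply: eq_bigr => j _.
case: ifP => _; last by rewrite muln0 mul0r.
have jn : (j <= n)%N by rewrite -ltnS.
rewrite natrM mulrAC bin_fact_div // natrM; ring.
Qed.

(** In a disjoint union the part cut off consists of non-neighbours of the marked vertex, so its
    series is in [y]; in a join it is in [x]. *)
Lemma cnt_irr_false :
  cnt_egf = (1 + fps_iny str_egf) * egf2 (irrcnt sym false).
Proof.
have -> : 1 + fps_iny str_egf = fps_iny (1 + str_egf) by rewrite fps_inyD.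
apply: fpsP => d; rewrite fps_coefCM; apply: fpsP => e; rewrite fps_coefM.
under [RHS]eq_bigr do rewrite str_egf1.
rewrite [LHS](cnt_div false) -addnS (addnC d e.+1) big_split_ord /= [X in _ + X]big1 ?addr0; last first.
  by move=> [j /= jd] _; rewrite irrcnt_gt ?mul0r ?mulr0 //; lia.
apply: eq_bigr => -[j /= je] _; rewrite subn0.
by have -> : (d + e - j = d + (e - j))%N by lia.
Qed.

Lemma cnt_irr_true :
  cnt_egf = (1 + fps_inx str_egf) * egf2 (irrcnt sym true).
Proof.
have -> : 1 + fps_inx str_egf = fps_inx (1 + str_egf) by rewrite fps_inxD fps_inx1.
have inxE i : fps_inx (1 + str_egf) i = fps_const ((strcnt sym i)%:R / i`!%:R).
  by rewrite -str_egf1.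
apply: fpsP => d; rewrite fps_coefM; apply: fpsP => e; rewrite fps_coef_sum.
under [RHS]eq_bigr do rewrite inxE fps_coefCM.
rewrite [LHS](cnt_div true) big_mkcond -addSn big_split_ord /= [X in _ + X]big1 ?addr0; last first.
  by move=> j _; rewrite mul1n leqNgt addSn ltnS leq_addr.
apply: eq_bigr => -[j /= jd] _; rewrite mul1n -ltnS jd.
by have -> : (d + e - j = d - j + e)%N by lia.
Qed.

Lemma core_egfE : core_egf =
  egf2 (irrcnt sym false) + egf2 (irrcnt sym true) - cnt_egf.
Proof.
apply: fpsP => d; rewrite fps_coefB fps_coefD; apply: fpsP => e.
rewrite fps_coefB fps_coefD /= -mulrDl -natrD -cnt_core natrD.
by rewrite mulrDl addrAC subrr add0r.
Qed.

(** Eliminate the two irreducible series [F] and [G] from [N = (1 + b) * F], [N = (1 + a) * G] and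
    [Core = F + G - N]. *)
Lemma cnt_egf_core : cnt_egf * (1 - fps_inx str_egf * fps_iny str_egf) =
  (1 + fps_inx str_egf) * (1 + fps_iny str_egf) * core_egf.
Proof.
rewrite core_egfE; move: cnt_irr_false cnt_irr_true.
set N := cnt_egf; set a := fps_inx _; set b := fps_iny _; set F := egf2 _; set G := egf2 _.
move=> e1 e2; transitivity ((1 + a) * ((1 + b) * F) + (1 + b) * ((1 + a) * G) - (1 + a) * (1 + b) * N).
  by rewrite -e1 -e2; ring.
by ring.
Qed.

Lemma deriv_str_egfE n : fps_deriv str_egf n = (strcnt sym n.+1)%:R / n`!%:R.
Proof.
rewrite -[LHS]/((strcnt sym n.+1)%:R / n.+1`!%:R *+ n.+1).
by rewrite factS natrM invfM mulrCA -mulr_natr mulrAC mulVf ?mul1r // pnatr_eq0.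
Qed.

Lemma deriv_str_egf : fps_deriv str_egf = fps_diag cnt_egf.
Proof.
apply: fpsP => n; rewrite fps_diagE deriv_str_egfE.
rewrite /= natr_sum mulr_suml; apply: eq_bigr => -[d /= dn] _.
by rewrite subnKC.
Qed.

Lemma ord1_cograph : cograph [set: 'I_1] set0.
Proof.
have -> : [set: 'I_1] = [set ord0] by apply/setP => i; rewrite !inE ord1 eqxx.
exact: cograph_vertex.
Qed.

Lemma ord1_strs : (set0, 1%g) \in strs sym [set: 'I_1].
Proof.
apply/strsP; split; [by left; exact: ord1_cograph | exact: perm_on1 | |].
  by apply/autP => x y; rewrite !perm1.
by rewrite eqxx orbT.
Qed.

Lemma ord1_degree : degree set0 (ord0 : 'I_1) = 0%N.
Proof. by apply/eqP; rewrite cards_eq0; apply/eqP/setP => x; rewrite !inE. Qed.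

Lemma corecnt0_gt0 : (0 < corecnt sym 0 0)%N.
Proof.
apply/card_gt0P; exists (set0, 1%g); rewrite in_set ord1_strs /= ord1_degree eqxx andbT.
by rewrite !irr_small // cardsT card_ord.
Qed.

End Series.

(** In the unlabeled case [str_egf] counts unlabeled cographs by [card_unlabeled], and the bound is
    [sum_corecnt]; in the labeled case the left side vanishes. *)
Lemma core_egf_growth (R : archiRealFieldType) sym n : (0 < n)%N ->
  fps_diag (core_egf R sym) n <=
  2 * n.+1%:R * \sum_(m < n.+2 | (0 < m)%N && (2 * m <= n.+1)%N) str_egf R sym m.
Proof.
move=> n0; have A0 m : 0 <= str_egf R sym m by case: m => [|m] //=; rewrite divr_ge0.
have -> : fps_diag (core_egf R sym) n = (\sum_(d < n.+1) corecnt sym n d)%:R / n`!%:R.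
  rewrite fps_diagE natr_sum mulr_suml; apply: eq_bigr => -[d /= dn] _.
  by rewrite subnKC.
case: sym A0 => A0; last first.
  rewrite big1 => [|d _]; last by rewrite corecnt_false.
  by rewrite mul0r !mulr_ge0 // sumr_ge0.
have AE m : (0 < m)%N -> str_egf R true m = #|unlabeled_cographs m|%:R.
  case: m => // m _; rewrite [LHS]/= -/(strcnt true m.+1) -card_unlabeled natrM.
  by rewrite mulfK // fact_neq0.
rewrite ler_pdivrMr; last by rewrite ltr0n fact_gt0.
rewrite (eq_bigr (fun m : 'I_n.+2 => #|unlabeled_cographs m|%:R)) => [|m /andP[m0 _]]; last exact: AE.
rewrite -natr_sum; have := sum_corecnt n0; rewrite -(ler_nat R) => /le_trans; apply.
rewrite factS !natrM le_eqVlt; apply/orP; left; apply/eqP; ring.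
Qed.

(** * From factorial moments to the uniform law *)

(** The mean of the hypergeometric law, cleared of denominators; the second factorial moment follows
    in the same way. *)
Lemma Vandermonde_first (d e K : nat) :
  (\sum_(k < K.+2) k * ('C(d, k) * 'C(e, K.+1 - k)) =
   d * 'C((d + e).-1, K))%N.
Proof.
rewrite big_ord_recl mul0n add0n.
case: d => [|d].
  by rewrite mul0n big1 // => i _; rewrite bin0n /= mul0n muln0.
rewrite addSn /= -binomial.Vandermonde big_distrr /=.
by apply: eq_bigr => i _; rewrite subSS mulnA -mul_bin_diag mulnA.
Qed.

Lemma Vandermonde_second (d e K : nat) :
  (\sum_(k < K.+3) k * k.-1 * ('C(d, k) * 'C(e, K.+2 - k)) =
   d * d.-1 * 'C((d + e).-2, K))%N.
Proof.
rewrite big_ord_recl !mul0n add0n.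
case: d => [|d].
  by rewrite mul0n big1 // => i _; rewrite bin0n /= mul0n muln0.
rewrite addSn /= -(mulnA d.+1) -Vandermonde_first big_distrr /=.
apply: eq_bigr => i _; rewrite subSS /bump /= add1n /=.
have E := mul_bin_diag d.+1 i; rewrite /= in E.
by rewrite [RHS]mulnCA (mulnA d.+1) E -!mulnA mulnCA.
Qed.

(** The variance of the sample proportion, expanded by the first two factorial moments. Sampling
    without replacement does no worse than with replacement, where the variance is
    [y * (1 - y) / K.+2]. *)
Lemma Vandermonde_variance (R : realFieldType) (s d K : nat) :
  (d <= s.+2)%N -> (K.+2 <= s.+2)%N ->
  \sum_(k < K.+3) (k%:R / K.+2%:R - d%:R / s.+2%:R) ^+ 2 *
     ('C(d, k) * 'C(s.+2 - d, K.+2 - k))%:R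
  <= K.+2%:R^-1 * 'C(s.+2, K.+2)%:R :> R.
Proof.
move=> ds Ks.
pose c k : R := ('C(d, k) * 'C(s.+2 - d, K.+2 - k))%:R.
have S0 : \sum_(k < K.+3) c k = 'C(s.+2, K.+2)%:R.
  by rewrite /c -natr_sum binomial.Vandermonde subnKC.
have S1 : \sum_(k < K.+3) k%:R * c k = d%:R * 'C(s.+1, K.+1)%:R.
  rewrite -natrM -[s.+1]/(s.+2.-1) -(subnKC ds) -Vandermonde_first natr_sum.
  by apply: eq_bigr => i _; rewrite -natrM.
have S2 : \sum_(k < K.+3) (k%:R * k.-1%:R) * c k = (d%:R * d.-1%:R) * 'C(s, K)%:R.
  rewrite -!natrM -[s]/(s.+2.-2) -[in RHS](subnKC ds) -Vandermonde_second natr_sum.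
  by apply: eq_bigr => i _; rewrite -!natrM.
have E1 : s.+2%:R * 'C(s.+1, K.+1)%:R = K.+2%:R * 'C(s.+2, K.+2)%:R :> R.
  by rewrite -!natrM; congr _%:R; exact: (mul_bin_diag s.+2 K.+1).
have E2 : s.+1%:R * 'C(s, K)%:R = K.+1%:R * 'C(s.+1, K.+1)%:R :> R.
  by rewrite -!natrM; congr _%:R; exact: (mul_bin_diag s.+1 K).
have sq k : k%:R ^+ 2 = k%:R * k.-1%:R + k%:R :> R.
  by case: k => [|k] /=; rewrite ?expr0n ?mul0r ?addr0 // -[k.+1]addn1 natrD; ring.
set k2 : R := K.+2%:R; set s2 : R := s.+2%:R.
have k20 : 0 < k2 by rewrite ltr0n.
have s20 : 0 < s2 by rewrite ltr0n.
set y : R := d%:R / s2.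
have -> : \sum_(k < K.+3) (k%:R / k2 - y) ^+ 2 * c k =
    k2^-1 ^+ 2 * ((d%:R * d.-1%:R) * 'C(s, K)%:R + d%:R * 'C(s.+1, K.+1)%:R)
    - 2 * y * k2^-1 * (d%:R * 'C(s.+1, K.+1)%:R) + y ^+ 2 * 'C(s.+2, K.+2)%:R.
  rewrite -S0 -S1 -S2 -big_split /= !mulr_sumr -sumrB -big_split /=.
  apply: eq_bigr => k _; rewrite -mulrDl -(sq k).
  by rewrite -/(c k); move: (c k) (k%:R : R) k2^-1 y => a b i z; ring.
have k1E : K.+1%:R = k2 - 1 by rewrite /k2 -[K.+2]addn1 natrD addrK.
have s1E : s.+1%:R = s2 - 1 by rewrite /s2 -[s.+2]addn1 natrD addrK.
have s10 : 0 < s2 - 1 by rewrite -s1E ltr0n.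
have k10 : 0 < k2 - 1 by rewrite -k1E ltr0n.
rewrite s1E k1E -/k2 -/s2 in E1 E2.
have y0 : 0 <= y by rewrite /y divr_ge0 // ltW.
have y1 : y <= 1 by rewrite /y ler_pdivrMr // mul1r ler_nat.
have dE : d%:R = y * s2 by rewrite /y divfK // gt_eqF.
(* The only inequality between the two sampling schemes: drawing a second marked ball is less likely
   without replacement. *)
have d1 : d%:R * d.-1%:R <= (y * s2) * (y * (s2 - 1)).
  case: (posnP d) => [d0|d_gt0].
    by rewrite d0 mul0r; apply: mulr_ge0; apply: mulr_ge0 => //; exact: ltW.
  have -> : d.-1%:R = y * s2 - 1 :> R.
    by rewrite -dE -[in RHS](prednK d_gt0) -[d.-1.+1]addn1 natrD addrK.
  rewrite dE; apply: ler_wpM2l; first by rewrite mulr_ge0 // ltW.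
  lra.
set B0 : R := 'C(s.+2, K.+2)%:R in E1 *.
set B1 : R := 'C(s.+1, K.+1)%:R in E1 E2 *.
set B2 : R := 'C(s, K)%:R in E2 *.
have B00 : 0 <= B0 by rewrite ler0n.
have B20 : 0 <= B2 by rewrite ler0n.
have T1 : d%:R * B1 = y * (k2 * B0) by rewrite dE -mulrA E1.
have T2 : d%:R * d.-1%:R * B2 <= y ^+ 2 * (k2 * (k2 - 1) * B0).
  apply: le_trans (ler_wpM2r B20 d1) _.
  have -> : y * s2 * (y * (s2 - 1)) * B2 = y ^+ 2 * (s2 * ((s2 - 1) * B2)).
    by move: (s2) (y) (B2) => a b c'; ring.
  rewrite E2 [s2 * _]mulrCA E1.
  by rewrite [(k2 - 1) * _]mulrCA mulrA.
rewrite T1.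
have k2u : k2 != 0 by rewrite gt_eqF.
have -> : k2^-1 * B0 = k2^-1 ^+ 2 * (k2 * B0).
  by rewrite expr2 -mulrA mulKf.
apply: (@le_trans _ _ (k2^-1 ^+ 2 * (y ^+ 2 * (k2 * (k2 - 1) * B0) + y * (k2 * B0))
    - 2 * y * k2^-1 * (y * (k2 * B0)) + y ^+ 2 * B0)).
  by rewrite lerD2r lerD2r ler_wpM2l ?sqr_ge0 // lerD2r.
have -> : k2^-1 ^+ 2 * (y ^+ 2 * (k2 * (k2 - 1) * B0) + y * (k2 * B0))
    - 2 * y * k2^-1 * (y * (k2 * B0)) + y ^+ 2 * B0 =
    k2^-1 ^+ 2 * (k2 * B0 * (y * (1 - y))).
  by clear -k2u; move: k2 k2u (y) (B0) => a a0 b c0; field.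
apply: ler_wpM2l; first exact: sqr_ge0.
apply: ler_piMr; first by rewrite mulr_ge0 // ltW.
by clear -y0 y1; nra.
Qed.

Lemma sqr_dist_le (R : realFieldType) (c a b : R) :
  (b - a) ^+ 2 <= 2 * (a - c) ^+ 2 + 2 * (c - b) ^+ 2.
Proof. have := sqr_ge0 ((a - c) - (c - b)); nra. Qed.

Section Urn.
Variables (R : realFieldType) (s K : nat) (q : nat -> R).
Hypothesis Ks : (K.+2 <= s.+2)%N.
Hypothesis q_ge0 : forall d, 0 <= q d.

Let n := s.+2.
Let k2 := K.+2.
Let Tot := \sum_(d < n.+1) q d.
Let c (d k : nat) : R := ('C(d, k) * 'C(n - d, k2 - k))%:R.
Let mom (k : nat) := \sum_(d < n.+1) q d * c d k.
Let BT := 'C(n, k2)%:R * Tot.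

Hypothesis Tot_gt0 : 0 < Tot.

Let BT_gt0 : 0 < BT.
Proof. by rewrite mulr_gt0 // ltr0n bin_gt0. Qed.

Let sum_c d : (d <= n)%N -> \sum_(k < k2.+1) c d k = 'C(n, k2)%:R.
Proof. by move=> dn; rewrite -natr_sum binomial.Vandermonde subnKC. Qed.

Let sum_mom : \sum_(k < k2.+1) mom k = BT.
Proof.
rewrite exchange_big /= /BT mulr_sumr; apply: eq_bigr => d _.
by rewrite -mulr_sumr (sum_c (ltn_ord d)) mulrC.
Qed.

(* mom k / BT is the law of the number of marked balls in a sample of size k2. *)
Lemma equal_moments_close (eta : R) :
  (forall k, (k < k2)%N -> `|mom k - mom k.+1| <= eta * BT) ->
  forall k, (k <= k2)%N -> `|mom k / BT - k2.+1%:R^-1| <= k2%:R * eta.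
Proof.
move=> H.
have eta0 : 0 <= eta.
  by rewrite -(pmulr_lge0 _ BT_gt0); exact: le_trans (normr_ge0 _) (H 0%N _).
have far i j : (i + j <= k2)%N -> `|mom i - mom (i + j)%N| <= j%:R * (eta * BT).
  elim: j => [|j IH] ij; first by rewrite addn0 subrr normr0 mul0r.
  apply: le_trans (ler_distD (mom (i + j)%N) _ _) _.
  rewrite -[j.+1]addn1 natrD mulrDl mul1r addnA addn1; apply: lerD.
    by apply: IH; apply: leq_trans ij; rewrite leq_add2l.
  by apply: H; rewrite -addnS.
have far2 i j : (i <= k2)%N -> (j <= k2)%N -> `|mom i - mom j| <= k2%:R * (eta * BT).
  have e0 : 0 <= eta * BT by rewrite mulr_ge0 // ltW.
  wlog ij : i j / (i <= j)%N.
    by move=> W ik jk; case: (leqP i j) => ij; last rewrite distrC; apply: W => //; exact: ltnW.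
  move=> ik jk; rewrite -(subnKC ij); apply: le_trans (far _ _ _) _; rewrite ?subnKC //.
  by apply: ler_wpM2r => //; rewrite ler_nat; exact: leq_trans (leq_subr _ _) jk.
move=> k kk.
have K10 : 0 < k2.+1%:R :> R by rewrite ltr0n.
have -> : mom k / BT - k2.+1%:R^-1 =
    (\sum_(j < k2.+1) (mom k - mom j)) / (k2.+1%:R * BT).
  rewrite sumrB sum_mom sumr_const card_ord -[mom k *+ _]mulr_natl.
  have := gt_eqF K10; have := gt_eqF BT_gt0.
  move: (mom k) (BT) (k2.+1%:R : R) => a b x /negbT b0 /negbT x0; field.
  by rewrite x0 b0.
rewrite normrM [`|_^-1|]gtr0_norm; last by rewrite invr_gt0 mulr_gt0.
rewrite ler_pdivrMr; last by rewrite mulr_gt0.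
apply: le_trans (ler_norm_sum _ _ _) _.
apply: (@le_trans _ _ (\sum_(j < k2.+1) k2%:R * (eta * BT))).
  by apply: ler_sum => j _; apply: far2 => //; rewrite -ltnS.
rewrite sumr_const card_ord -[_ *+ k2.+1]mulr_natl.
by rewrite le_eqVlt; apply/orP; left; apply/eqP; ring.
Qed.

(** Bernstein's argument, comparing [f] at the proportion in the urn with [f] at the proportion in
    the sample: uniform continuity within [delta], Chebyshev beyond. The last error term replaces
    the law of the sample by the uniform one. *)
Lemma urn_bernstein (eta eps delta M : R) (f : R -> R) :
  (forall k, (k < k2)%N -> `|mom k - mom k.+1| <= eta * BT) ->
  0 <= eps -> 0 < delta -> (forall x, `|f x| <= M) ->
  (forall x y, 0 <= x <= 1 -> 0 <= y <= 1 -> `|x - y| <= delta ->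
     `|f x - f y| <= eps) ->
  `|\sum_(d < n.+1) q d / Tot * f (d%:R / n.+1%:R) -
    k2.+1%:R^-1 * \sum_(k < k2.+1) f (k%:R / k2%:R)| <=
  eps + 2 * M / delta ^+ 2 * (2 * k2%:R^-1 + 2 * n.+1%:R^-1)
      + k2.+1%:R * (k2%:R * eta * M).
Proof.
move=> Hmom eps0 delta0 fM fuc.
have M0 : 0 <= M := le_trans (normr_ge0 _) (fM 0).
have C0 : 0 < 'C(n, k2)%:R :> R by rewrite ltr0n bin_gt0.
have c0 d k : 0 <= c d k by rewrite ler0n.
have w0 d k : 0 <= q d * c d k / BT by rewrite divr_ge0 ?mulr_ge0 // ltW.
have k2p : 0 < k2%:R :> R by rewrite ltr0n.
have n1p : 0 < n.+1%:R :> R by rewrite ltr0n.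
have np : 0 < n%:R :> R by rewrite ltr0n.
pose y d : R := d%:R / n.+1%:R.
pose z k : R := k%:R / k2%:R.
pose L := 2 * M / delta ^+ 2.
have L0 : 0 <= L by rewrite divr_ge0 ?sqr_ge0 // mulr_ge0.
have y01 d : (d <= n)%N -> 0 <= y d <= 1.
  move=> dn; rewrite /y divr_ge0 ?ler0n //= ler_pdivrMr // mul1r ler_nat.
  exact: leqW.
have z01 k : (k <= k2)%N -> 0 <= z k <= 1.
  by move=> kn; rewrite /z divr_ge0 ?ler0n //= ler_pdivrMr // mul1r ler_nat.
have -> : \sum_(d < n.+1) q d / Tot * f (y d) =
    \sum_(d < n.+1) \sum_(k < k2.+1) q d * c d k / BT * f (y d).
  apply: eq_bigr => d _; rewrite -mulr_suml; congr (_ * _).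
  rewrite -mulr_suml -mulr_sumr (sum_c (ltn_ord d)) /BT invfM mulrA mulfK //.
  by rewrite gt_eqF.
have bound d k : (d <= n)%N -> (k <= k2)%N ->
    `|f (y d) - f (z k)| <= eps + L * (y d - z k) ^+ 2.
  move=> dn kk; case: (leP `|y d - z k| delta) => dl.
    by apply: le_trans (fuc _ _ (y01 _ dn) (z01 _ kk) dl) _; rewrite lerDl mulr_ge0 // sqr_ge0.
  apply: (@le_trans _ _ (2 * M)).
    apply: le_trans (ler_normB _ _) _; rewrite mulr2n mulrDl mul1r; exact: lerD.
  apply: ler_wpDl => //; rewrite /L -mulrA ler_peMr ?mulr_ge0 //.
  rewrite mulrC ler_pdivlMr ?exprn_gt0 // mul1r -[leRHS]real_normK ?num_real //.
  by rewrite lerXn2r ?nnegrE // ?ltW.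
pose m k := mom k / BT.
have S1 : \sum_(d < n.+1) \sum_(k < k2.+1) q d * c d k / BT = 1.
  rewrite exchange_big /=.
  under eq_bigr do rewrite -mulr_suml.
  by rewrite -mulr_suml sum_mom divff // gt_eqF.
have E1 : `|\sum_(d < n.+1) \sum_(k < k2.+1) q d * c d k / BT * f (y d) -
           \sum_(k < k2.+1) m k * f (z k)| <=
    eps + L * (2 * k2%:R^-1 + 2 * n.+1%:R^-1).
  have -> : \sum_(k < k2.+1) m k * f (z k) =
      \sum_(d < n.+1) \sum_(k < k2.+1) q d * c d k / BT * f (z k).
    by rewrite exchange_big /=; apply: eq_bigr => k _; rewrite -!mulr_suml.
  rewrite -sumrB; apply: le_trans (ler_norm_sum _ _ _) _.
  apply: (@le_trans _ _ (\sum_(d < n.+1) \sum_(k < k2.+1) q d * c d k / BT *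
      (eps + L * (y d - z k) ^+ 2))).
    apply: ler_sum => d _; rewrite -sumrB; apply: le_trans (ler_norm_sum _ _ _) _.
    apply: ler_sum => k _; rewrite -mulrBr normrM (ger0_norm (w0 d k)).
    by apply: (ler_wpM2l (w0 d k)); apply: bound; rewrite -ltnS.
  apply: (@le_trans _ _ (\sum_(d < n.+1) (q d / Tot) *
     (eps + L * (2 * k2%:R^-1 + 2 * n.+1%:R^-1)))); last first.
    by rewrite -mulr_suml -mulr_suml divff ?mul1r // gt_eqF.
  apply: ler_sum => d _.
  have dn := ltn_ord d; rewrite ltnS in dn.
  have -> : \sum_(k < k2.+1) q d * c d k / BT * (eps + L * (y d - z k) ^+ 2) =
      q d / Tot * (\sum_(k < k2.+1) c d k * (eps + L * (y d - z k) ^+ 2) / 'C(n, k2)%:R).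
    rewrite mulr_sumr; apply: eq_bigr => k _; rewrite /BT invfM.
    move: (_ + _ * _ ^+ 2) (c d k) (q d) (Tot^-1) ('C(n, k2)%:R^-1) => a1 a2 a3 a4 a5; ring.
  apply: ler_wpM2l; first by rewrite divr_ge0 // ltW.
  rewrite -mulr_suml ler_pdivrMr //.
  have -> : \sum_(k < k2.+1) c d k * (eps + L * (y d - z k) ^+ 2) =
     eps * 'C(n, k2)%:R + L * \sum_(k < k2.+1) c d k * (y d - z k) ^+ 2.
    rewrite -(sum_c dn) !mulr_sumr -big_split /=; apply: eq_bigr => k _.
    by move: ((y d - z k) ^+ 2) (c d k) => a b; ring.
  rewrite mulrDl lerD2l -[L * _ * _]mulrA; apply: ler_wpM2l => //.
  (* The variance bound is centred at [d / n], whereas a degree is divided by the number [n.+1] of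
     vertices. *)
  pose x : R := d%:R / n%:R.
  have xy : (x - y d) ^+ 2 <= n.+1%:R^-1.
    have x1 : x <= 1 by rewrite /x ler_pdivrMr // mul1r ler_nat.
    have x0 : 0 <= x by rewrite /x divr_ge0 // ltW.
    have -> : x - y d = x * n.+1%:R^-1.
      have nE : n.+1%:R = n%:R + 1 :> R by rewrite -[n.+1]addn1 natrD.
      have h2 : n%:R + 1 != 0 :> R by rewrite -nE gt_eqF.
      have h1 : n%:R != 0 :> R by rewrite gt_eqF.
      rewrite /x /y nE; move: (n%:R : R) (d%:R : R) h1 h2 => a b h1 h2.
      by field; rewrite h1 h2.
    have t0 : 0 <= n.+1%:R^-1 :> R by rewrite invr_ge0 ltW.
    have t1 : n.+1%:R^-1 <= 1 :> R by rewrite invf_le1 // ler1n.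
    rewrite expr2; apply: le_trans (ler_piMr _ _) (ler_piMl t0 x1).
      exact: mulr_ge0.
    by rewrite mulr_ile1.
  have V := @Vandermonde_variance R s d K dn Ks.
  have -> : (2 * k2%:R^-1 + 2 * n.+1%:R^-1) * 'C(n, k2)%:R =
      2 * (k2%:R^-1 * 'C(n, k2)%:R) + \sum_(k < k2.+1) c d k * (2 * n.+1%:R^-1).
    by rewrite -mulr_suml (sum_c dn) mulrDl mulrA (mulrC 'C(_, _)%:R).
  apply: (@le_trans _ _ (2 * (\sum_(k < k2.+1) (z k - x) ^+ 2 * c d k) +
      \sum_(k < k2.+1) c d k * (2 * n.+1%:R^-1))); last first.
    by rewrite lerD2r ler_wpM2l.
  rewrite mulr_sumr -big_split /=; apply: ler_sum => k _.
  have key : (y d - z k) ^+ 2 <= 2 * (z k - x) ^+ 2 + 2 * n.+1%:R^-1.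
    apply: le_trans (sqr_dist_le x _ _) _.
    by rewrite lerD2l ler_wpM2l.
  apply: le_trans (ler_wpM2l (c0 d k) key) _.
  by rewrite le_eqVlt; apply/orP; left; apply/eqP; ring.
apply: le_trans (ler_distD (\sum_(k < k2.+1) m k * f (z k)) _ _) _.
apply: lerD => //.
rewrite mulr_sumr -sumrB; apply: le_trans (ler_norm_sum _ _ _) _.
apply: (@le_trans _ _ (\sum_(k < k2.+1) (k2%:R * eta * M))); last first.
  by rewrite sumr_const card_ord -[leLHS]mulr_natl.
apply: ler_sum => k _; rewrite -mulrBl normrM; apply: ler_pM => //.
by apply: equal_moments_close => //; rewrite -ltnS.
Qed.
End Urn.

(** [K] is fixed before [s], because the moments are only controlled for a fixed sample size. *)
Lemma urn_limit (R : archiRealFieldType) (q : nat -> nat -> R) (f : R -> R) (M : R) :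
  (forall s d, 0 <= q s d) -> (forall s, 0 < \sum_(d < s.+1) q s d) ->
  (forall k l eta, 0 < eta -> exists s0, forall s, (s0 <= s)%N ->
     `|\sum_(d < s.+1) q s d *+ ('C(d, k) * 'C(s - d, l.+1)) -
       \sum_(d < s.+1) q s d *+ ('C(d, k.+1) * 'C(s - d, l))| <=
     eta * ('C(s, k + l.+1)%:R * \sum_(d < s.+1) q s d)) ->
  (forall x, `|f x| <= M) ->
  (forall eps, 0 < eps -> exists2 delta, 0 < delta &
     forall x y, 0 <= x <= 1 -> 0 <= y <= 1 -> `|x - y| <= delta ->
     `|f x - f y| <= eps) ->
  forall eps, 0 < eps -> exists K0, forall K, (K0 <= K)%N -> exists s0,
    forall s, (s0 <= s)%N ->
    `|\sum_(d < s.+1) q s d / (\sum_(i < s.+1) q s i) * f (d%:R / s.+1%:R) -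
      K.+3%:R^-1 * \sum_(k < K.+3) f (k%:R / K.+2%:R)| <= eps.
Proof.
move=> q0 T0 Hm fM fuc eps eps0.
have M0 : 0 <= M := le_trans (normr_ge0 _) (fM 0).
have e4 : 0 < eps / 4 by lra.
have [delta delta0 Hd] := fuc _ e4.
set L := 2 * M / delta ^+ 2.
have L0 : 0 <= L by rewrite divr_ge0 ?sqr_ge0 // mulr_ge0.
have [K0 HK0] : exists K0 : nat, forall n, (K0 <= n)%N -> L * (2 * n.+1%:R^-1) <= eps / 4.
  exists (Num.bound ((eps / 4)^-1 * (L * 2))) => n nK.
  rewrite mulrA ler_pdivrMr ?ltr0n // -ler_pdivrMl //.
  apply: le_trans (ltW (archi_boundP _)) _.
    by apply: mulr_ge0; [rewrite invr_ge0 ltW | apply: mulr_ge0].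
  by rewrite ler_nat leqW.
exists K0 => K KK.
(* Makes the last error term of [urn_bernstein] at most [eps / 4]; [M + 1] avoids a zero
   denominator. *)
pose eta := (eps / 4) / (K.+3%:R * (K.+2%:R * (M + 1))).
have den0 : 0 < K.+3%:R * (K.+2%:R * (M + 1)) :> R.
  by rewrite !mulr_gt0 ?ltr0n // ltr_wpDl.
have eta0 : 0 < eta by rewrite divr_gt0.
have [s1 Hs1] : exists s1, forall s, (s1 <= s)%N -> forall k, (k < K.+2)%N ->
   `|\sum_(d < s.+1) q s d * ('C(d, k) * 'C(s - d, K.+2 - k))%:R -
       \sum_(d < s.+1) q s d * ('C(d, k.+1) * 'C(s - d, K.+2 - k.+1))%:R| <=
     eta * ('C(s, K.+2)%:R * \sum_(d < s.+1) q s d).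
  (* Only finitely many [k] occur, so the thresholds have a maximum. *)
  suff : forall m, (m <= K.+2)%N -> exists s1, forall s, (s1 <= s)%N -> forall k, (k < m)%N ->
   `|\sum_(d < s.+1) q s d * ('C(d, k) * 'C(s - d, K.+2 - k))%:R -
       \sum_(d < s.+1) q s d * ('C(d, k.+1) * 'C(s - d, K.+2 - k.+1))%:R| <=
     eta * ('C(s, K.+2)%:R * \sum_(d < s.+1) q s d) by move/(_ K.+2 (leqnn _)).
  elim=> [|m IH] mK; first by exists 0%N.
  have [s1 H1] := IH (ltnW mK).
  have [s2 H2] := Hm m (K.+2 - m.+1)%N _ eta0.
  exists (maxn s1 s2) => s; rewrite geq_max => /andP[ss1 ss2] k.
  rewrite ltnS leq_eqVlt => /orP[/eqP-> | km]; last exact: H1.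
  have := H2 s ss2; rewrite -subSn // subSS subnKC; last exact: ltnW.
  by under eq_bigr do rewrite -mulr_natr; under [X in _ - X]eq_bigr do rewrite -mulr_natr.
(* The [.+2] makes room for a sample of size [K.+2]. *)
exists (maxn s1 (maxn K0 K).+2) => s; rewrite geq_max => /andP[ss1].
case: s ss1 => [|[|s]] ss1 //; rewrite !ltnS geq_max => /andP[sK0 sK].
apply: le_trans (urn_bernstein (eta := eta) (eps := eps / 4) (delta := delta)
  (M := M) sK (q0 s.+2) (T0 s.+2) (Hs1 _ ss1) (ltW e4) delta0 fM Hd) _.
rewrite -/L mulrDr.
have h1 := HK0 K.+1 (leqW KK).
have h2 := HK0 s.+2 (leqW (leqW sK0)).
have h3 : K.+3%:R * (K.+2%:R * eta * M) <= eps / 4.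
  have -> : K.+3%:R * (K.+2%:R * eta * M) = (K.+3%:R * (K.+2%:R * M)) * eta by ring.
  rewrite /eta mulrCA ger_pMr // ler_pdivrMr // mul1r !ler_wpM2l //.
  by rewrite lerDl.
move: (L * _) (L * _) (_ * (_ * M)) h1 h2 h3 => a b c'; lra.
Qed.

(* Convergence in distribution *)
From mathcomp Require Import all_classical all_reals all_analysis measurable_realfun.
Import Order.TTheory GRing.Theory Num.Theory.
Import numFieldNormedType.Exports.
Local Open Scope classical_set_scope.
Local Open Scope ring_scope.

Lemma continuous_uniform_segment (R : realType) (f : R -> R) (a b : R) :
  continuous f -> forall eps, 0 < eps -> exists2 delta, 0 < delta &
    forall x y, a <= x <= b -> a <= y <= b -> `|x - y| <= delta ->
    `|f x - f y| <= eps.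
Proof.
move=> cf eps eps0.
have /compact_near_coveringP cov := @segment_compact R a b.
have e2 : 0 < eps / 2 by rewrite divr_gt0.
have := cov R 0^'+ (fun d x => forall y, `|x - y| <= d -> `|f x - f y| <= eps) _.
case.
  move=> x _; have /cvgrPdist_lt/(_ _ e2) := cf x.
  rewrite nearE /= -nearE => /nbhs_ballP[r /= r0 Hr].
  have r2 : 0 < r / 2 by rewrite divr_gt0.
  exists (ball x (r / 2), [set d | 0 < d < r / 2]); rewrite /=.
    split; first exact: nbhsx_ballx.
    near=> d; apply/andP; split; near: d; [exact: nbhs_right_gt | exact: nbhs_right_lt].
  case=> y d [/= yb /andP[d0 dr]] z yz.
  have yb' : ball x r y by rewrite /ball /= (lt_le_trans yb) // ler_pdivrMr // ler_peMr ?(ltW r0) // ler1n.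
  have zb : ball x r z.
    rewrite /ball /= (le_lt_trans (ler_distD y _ _)) // [ltRHS](splitr r).
    by rewrite ltrD // (le_lt_trans yz).
  rewrite (le_trans (ler_distD (f x) _ _)) // [leRHS](splitr eps) lerD // ltW //.
    by rewrite distrC; exact: Hr.
  exact: Hr.
move=> r /= r0 Hr; exists (r / 2); first by rewrite divr_gt0.
move=> x y xab _ xy; apply: (Hr (r / 2)) => //=.
- rewrite sub0r normrN gtr0_norm ?divr_gt0 //.
  by rewrite ltr_pdivrMr // ltr_pMr // ltr1n.
- by rewrite divr_gt0.
Unshelve. all: end_near.
Qed.

Section SimpleExpectation.
Context d (T : measurableType d) (R : realType) (P : probability T R).

Lemma expectation_simple (B : finType) (c : B -> R) (A : B -> set T) :
  (forall b, measurable (A b)) ->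
  'E_P[fun w => (\sum_b c b * \1_(A b) w)%R]%E = (\sum_b c b * fine (P (A b)))%:E.
Proof.
move=> mA.
have int1 b : P.-integrable setT (EFin \o \1_(A b)).
  exact: integrable_indic.
rewrite unlock.
under eq_integral do rewrite -sumEFin.
rewrite integral_sum //; last first.
  by move=> b; rewrite (_ : (fun x => _) = (fun x => (c b)%:E * (EFin \o \1_(A b)) x)%E) //; exact: integrableZl.
rewrite -sumEFin; apply: eq_bigr => b _.
under eq_integral do rewrite EFinM.
rewrite integralZl //; last exact: int1.
rewrite integral_indic // setIT EFinM fineK //.
exact: fin_num_measure.
Qed.

Lemma expectation_finite (B : finType) (X : T -> B) (c : B -> R) :
  (forall b, measurable [set w | X w = b]) ->
  measurable_fun setT (fun w => c (X w)) /\
  'E_P[fun w => c (X w)]%E = (\sum_b c b * fine (P [set w | X w = b]))%:E.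
Proof.
move=> mX.
have E : (fun w => c (X w)) = (fun w => \sum_b c b * \1_[set w | X w = b] w).
  apply/funext => w; rewrite (bigD1 (X w)) //= big1 => [|b bX].
    by rewrite indicE mem_set // mulr1 addr0.
  by rewrite indicE memNset ?mulr0 //= => Xb; rewrite Xb eqxx in bX.
split; last by rewrite E expectation_simple.
rewrite E; apply: measurable_sum => b.
by apply: measurable_funM => //; exact: measurable_indic.
Qed.

End SimpleExpectation.

Lemma integrable_bounded d (T : measurableType d) (R : realType)
    (P : probability T R) (f : T -> R) (M : R) :
  measurable_fun setT f -> (forall x, `|f x| <= M) ->
  P.-integrable setT (EFin \o f).
Proof.
move=> mf fM.
have PT : (P setT < +oo)%E by rewrite probability_setT ltry.
apply: measurable_bounded_integrable => //.
exists M; split; first exact: num_real.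
by move=> z Mz x _; apply: le_trans (fM x) (ltW Mz).
Qed.

Lemma expectation_bounded_fin_num d (T : measurableType d) (R : realType)
    (P : probability T R) (f : T -> R) (M : R) :
  measurable_fun setT f -> (forall x, `|f x| <= M) -> 'E_P[f]%E \is a fin_num.
Proof.
move=> mf fM; rewrite unlock integrable_fin_num //.
exact: integrable_bounded mf fM.
Qed.

(** The comparison excludes the point 1, which has measure zero, because the cells of the step
    function used later are half-open. *)
Lemma expectation_uniform_close (R : realType) (f g : R -> R) (M eps : R) :
  measurable_fun setT f -> measurable_fun setT g ->
  (forall x, `|f x| <= M) -> (forall x, `|g x| <= M) ->
  0 <= eps ->
  (forall x, 0 <= x < 1 -> `|f x - g x| <= eps) ->
  `|fine 'E_(uniform_prob (@ltr01 R))[f] - fine 'E_(uniform_prob (@ltr01 R))[g]| <= eps.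
Proof.
move=> mf mg bf bg eps0 fg.
pose U : probability (measurableTypeR R) R := uniform_prob (@ltr01 R).
rewrite -/U.
have jf : U.-integrable setT (EFin \o f) by exact: (integrable_bounded U mf bf).
have jg : U.-integrable setT (EFin \o g) by exact: (integrable_bounded U mg bg).
rewrite unlock -fineB ?integrable_fin_num //= -integralB_EFin //.
have mfg : measurable_fun setT (fun x => (f x - g x)%:E).
  by apply/measurable_EFinP/measurable_funB.
have E : (`|\int[U]_x (f x - g x)%:E| <= eps%:E)%E.
  apply: (le_trans (le_abse_integral _ _ _)) => //.
  rewrite integral_uniform //; last exact: measurableT_comp.
  rewrite subr0 invr1 mul1e -integral_itv_bndo_bndc; last first.
    by apply: measurable_funTS; exact: measurableT_comp.
  apply: (@le_trans _ _ (\int[lebesgue_measure]_(x in `[0%R, 1%R[) (cst eps%:E x))%E).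
    by apply: ge0_le_integral => //; apply: measurable_funTS; exact: measurableT_comp.
  by rewrite integral_cst //= lebesgue_measure_itv /= lte_fin ltr01 oppr0 adde0 mule1.
have Ifin : (\int[U]_x (f x - g x)%:E)%E \is a fin_num.
  by rewrite fin_num_abs; apply: le_lt_trans E _; rewrite ltry.
rewrite -fine_abse // -lee_fin fineK; first exact: E.
by rewrite fin_num_abs abse_id -fin_num_abs.
Qed.

Lemma uniform_prob01_itv (R : realType) (x y : R) : 0 <= x -> x <= y -> y <= 1 ->
  uniform_prob (@ltr01 R) `[x, y[ = (y - x)%:E.
Proof.
move=> x0 xy y1; rewrite /uniform_prob.
rewrite (eq_integral (cst 1%:E)); last first.
  move=> z; rewrite inE /= in_itv /= => /andP[xz zy].
  by rewrite /uniform_pdf (le_trans x0 xz) (le_trans (ltW zy) y1) subr0 invr1.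
rewrite integral_cst //= mul1e lebesgue_measure_itv /= lte_fin.
case: ltgtP xy => // -> _; by rewrite subrr.
Qed.

(** The node [k / K.+1] lies between [k / K.+2] and [k.+1 / K.+2], so the mean over the [K.+2] nodes
    is a Riemann sum of mesh [1 / K.+2]. *)
Lemma uniform_riemann_sum (R : realType) (f : R -> R) (M eps delta : R) (K : nat) :
  continuous f -> (forall x, `|f x| <= M) -> 0 <= eps ->
  (forall x y, 0 <= x <= 1 -> 0 <= y <= 1 -> `|x - y| <= delta ->
     `|f x - f y| <= eps) ->
  K.+2%:R^-1 <= delta ->
  `|K.+2%:R^-1 * \sum_(k < K.+2) f (k%:R / K.+1%:R) -
    fine 'E_(uniform_prob (@ltr01 R))[f]| <= eps.
Proof.
move=> cf fM eps0 fuc Kd.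
pose h : R := K.+2%:R^-1.
have h0 : 0 < h by rewrite invr_gt0 ltr0n.
have hK : h * K.+2%:R = 1 by rewrite mulVf // pnatr_eq0.
have kh1 k : (k <= K.+2)%N -> k%:R * h <= 1.
  by move=> kK; rewrite ler_pdivrMr ?ltr0n // mul1r ler_nat.
pose A (k : 'I_K.+2) : set R := `[k%:R * h, k.+1%:R * h[%classic.
pose g x := \sum_(k < K.+2) f (k%:R / K.+1%:R) * \1_(A k) x.
have mA k : measurable (A k) by exact: measurable_itv.
have gx (k : 'I_K.+2) x : A k x -> g x = f (k%:R / K.+1%:R).
  rewrite /A /= in_itv /= => /andP[kx xk].
  rewrite /g (bigD1 k) //= big1 ?addr0 => [|i ik].
    by rewrite indicE mem_set ?mulr1 // /A /= in_itv /= kx.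
  rewrite indicE memNset ?mulr0 // /A /= in_itv /= => /andP[ix xi].
  move: ik; rewrite -val_eqE /= neq_ltn => /orP[ik|ki].
    have : i.+1%:R * h <= k%:R * h by rewrite ler_pM2r // ler_nat.
    by rewrite leNgt (le_lt_trans kx xi).
  have : k.+1%:R * h <= i%:R * h by rewrite ler_pM2r // ler_nat.
  by rewrite leNgt (le_lt_trans ix xk).
have mg : measurable_fun setT g.
  by apply: measurable_sum => k; apply: measurable_funM.
have Eg : fine 'E_(uniform_prob (@ltr01 R))[g] = h * \sum_(k < K.+2) f (k%:R / K.+1%:R).
  rewrite /g expectation_simple //= mulr_sumr; apply: eq_bigr => k _.
  rewrite uniform_prob01_itv /=; last 3 first.
  - by rewrite mulr_ge0 // ltW.
  - by rewrite ler_pM2r // ler_nat.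
  - exact: kh1 (ltn_ord k).
  by rewrite -mulrBl -natrB ?leqnSn // subSnn mul1r mulrC.
have M0 : 0 <= M := le_trans (normr_ge0 _) (fM 0).
rewrite -/h -Eg distrC; apply: (@expectation_uniform_close _ _ _ (K.+2%:R * M)) => //.
- exact: continuous_measurable_fun.
- by move=> x; apply: le_trans (fM x) _; rewrite ler_peMl // ler1n.
- move=> x; apply: le_trans (ler_norm_sum _ _ _) _.
  apply: (@le_trans _ _ (\sum_(k < K.+2) M)); last by rewrite sumr_const card_ord -[leLHS]mulr_natl.
  apply: ler_sum => k _; apply: le_trans (fM (k%:R / K.+1%:R)).
  rewrite normrM ler_piMr // indicE.
  by case: (_ \in _); rewrite ?normr1 ?normr0.
move=> x /andP[x0 x1].
have x2 : 0 <= x * K.+2%:R by rewrite mulr_ge0.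
have /andP[tx xt] := truncn_itv x2.
set k := Num.truncn _ in tx xt.
have kK : (k < K.+2)%N.
  rewrite -(ltr_nat R); apply: le_lt_trans tx _.
  by rewrite gtr_pMl // ltr0n.
have Kp : 0 < K.+2%:R :> R by rewrite ltr0n.
have Kp1 : 0 < K.+1%:R :> R by rewrite ltr0n.
have kx : k%:R * h <= x by rewrite ler_pdivrMr.
have xk : x < k.+1%:R * h by rewrite ltr_pdivlMr.
rewrite (gx (Ordinal kK)) /=; last by rewrite /A /= in_itv /= kx.
have kh : k%:R * h <= k%:R / K.+1%:R.
  by rewrite ler_wpM2l // lef_pV2 ?posrE // ler_nat.
have kh2 : k%:R / K.+1%:R <= k.+1%:R * h.
  rewrite ler_pdivrMr // mulrAC ler_pdivlMr // -!natrM ler_nat.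
  by move: kK; clear; lia.
have k1 := kh1 _ kK.
apply: fuc.
- by rewrite x0 ltW.
- by rewrite divr_ge0 ?ler0n //= (le_trans kh2).
apply: le_trans Kd; rewrite -/h ler_norml.
move: kx xk kh kh2; rewrite -[k.+1]addn1 natrD mulrDl mul1r.
move: (k%:R * h) (k%:R / _) => a b; lra.
Qed.

(** Edgeless graphs witness that the counts are positive, as normalising requires. *)
Lemma cograph_set0 (T : finType) (V : {set T}) : V != finset.set0 -> cograph V finset.set0.
Proof.
have [m] := ubnP #|V|; elim: m V => // m IH V; rewrite ltnS => Vm V0.
have [x xV] := set0Pn _ V0.
have [W0|W0] := eqVneq (V :\ x)%SET finset.set0.
  by rewrite -(finset.setD1K xV) W0 finset.setU0; exact: cograph_vertex.
rewrite -(finset.setD1K xV) -[finset.set0]finset.setU0.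
apply: cograph_union; first by rewrite disjoints1 !inE eqxx.
- exact: cograph_vertex.
- by apply: IH W0; apply: leq_trans Vm; rewrite [ltnRHS](cardsD1 x) xV.
Qed.

Lemma strcnt_gt0 sym n : (0 < strcnt sym n.+1)%N.
Proof.
have := card_strs sym [set: 'I_n.+1]%SET; rewrite cardsT card_ord => <-.
apply/card_gt0P; exists (finset.set0, 1%g); apply/strsP; split.
- by left; apply: cograph_set0; apply/set0Pn; exists ord0; rewrite finset.in_setT.
- exact: perm_on1.
- by apply/autP => x y; rewrite !perm1.
- by rewrite eqxx orbT.
Qed.

Section DegreeLaw.
Variables (R : realType) (sym : bool).

Let q (s d : nat) : R := cnt_egf R sym d (s - d)%N.

Lemma cnt_egfE s d : (d <= s)%N -> q s d = (cnt sym s d)%:R / s`!%:R.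
Proof. by move=> ds; rewrite /q /= subnKC. Qed.

Lemma sum_cnt_egf s : \sum_(d < s.+1) q s d = (strcnt sym s.+1)%:R / s`!%:R.
Proof.
by rewrite -deriv_str_egfE deriv_str_egf fps_diagE.
Qed.

Lemma degree_limit (f : R -> R) (M : R) :
  continuous f -> (forall x, `|f x| <= M) ->
  (\sum_(d < s.+1) q s d / (\sum_(i < s.+1) q s i) * f (d%:R / s.+1%:R))
     @[s --> \oo] --> fine 'E_(uniform_prob (@ltr01 R))[f].
Proof.
move=> cf fM; apply/cvgrPdist_le => eps eps0.
have fuc := continuous_uniform_segment 0 1 cf.
pose e2 := eps / 2; have e20 : 0 < e2 by rewrite divr_gt0.
have e2E : e2 + e2 = eps by rewrite -splitr.
have q0 s d : 0 <= q s d by rewrite /q /= divr_ge0.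
have T0 s : 0 < \sum_(d < s.+1) q s d.
  by rewrite sum_cnt_egf divr_gt0 // ltr0n ?strcnt_gt0 // fact_gt0.
have A0 : fps_le 0 (str_egf R sym).
  by move=> [|m]; rewrite fps_coef0 //= divr_ge0.
have A1 : 1 <= str_egf R sym 1%N by rewrite /= divr1 ler1n strcnt_gt0.
have C0 d e : 0 <= core_egf R sym d e by rewrite /= divr_ge0.
have C1 : 1 <= core_egf R sym 0%N 0%N by rewrite /= divr1 ler1n corecnt0_gt0.
have Hm := bin_moment_limit A0 (erefl _) A1 (cnt_egf_core R sym) (deriv_str_egf R sym)
  C0 C1 (ler0n _ 2) (@core_egf_growth R sym).
have {}Hm k l eta : 0 < eta -> exists s0, forall s, (s0 <= s)%N ->
     `|\sum_(d < s.+1) q s d *+ ('C(d, k) * 'C(s - d, l.+1)) -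
       \sum_(d < s.+1) q s d *+ ('C(d, k.+1) * 'C(s - d, l))| <=
     eta * ('C(s, k + l.+1)%:R * \sum_(d < s.+1) q s d).
  move=> eta0; have [s0 Hs0] := Hm k l eta eta0; exists s0 => s ss.
  by have := Hs0 s ss; rewrite bin_moment_total fps_diagE.
have [K0 HK0] := urn_limit q0 T0 Hm fM fuc e20.
have [delta delta0 Hd] := fuc _ e20.
(* Large enough both for the sampling error and for the mesh of the Riemann sum. *)
pose K := maxn K0 (Num.bound delta^-1).
have [s0 Hs0] := HK0 K (leq_maxl _ _).
exists s0 => // s /= ss; rewrite distrC -e2E.
apply: le_trans (ler_distD _ _ _) (lerD (Hs0 s ss) _).
apply: (uniform_riemann_sum cf fM (ltW e20) Hd).
rewrite invf_ple ?posrE ?ltr0n //; apply: le_trans (ltW (archi_boundP _)) _.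
  by rewrite invr_ge0 ltW.
by rewrite ler_nat; apply: leq_trans (leq_maxr K0 _) _; rewrite -/K; lia.
Qed.
End DegreeLaw.

(** [D] is abstract because in the unlabeled model the degree is read on a representative. *)
Lemma expectation_degree d (T : measurableType d) (R : realType) (P : probability T R)
    (A : finType) (S : {set A}) (X : T -> A) (n : nat) (v : T -> 'I_n)
    (D : A -> 'I_n -> nat) (c : nat -> R) :
  uniform_in P S X -> uniform_vertex_given P X v ->
  (forall a i, a \in S -> (D a i < n)%N) ->
  measurable_fun setT (fun w => c (D (X w) (v w))) /\
  'E_P[fun w => c (D (X w) (v w))]%E =
    (\sum_(j < n) (\sum_(a in S) #|[set i | D a i == j]%SET|)%:R / (n%:R * #|S|%:R) * c j)%:E.
Proof.
move=> hX hv Dn.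
have EW (b : A * 'I_n) : [set w | (X w, v w) = b] = [set w | X w = b.1 /\ v w = b.2].
  by case: b => a i; apply/seteqP; split => w /= [] => [-> ->|->  ->].
have mW b : measurable [set w | (X w, v w) = b] by rewrite EW; exact: (hv b.1 b.2).1.
have [mE ->] := expectation_finite P (fun b => c (D b.1 b.2)) mW.
split=> //; congr _%:E.
pose p : R := (n%:R * #|S|%:R)^-1.
have E1 b : c (D b.1 b.2) * fine (P [set w | (X w, v w) = b]) =
    if b.1 \in S then p * c (D b.1 b.2) else 0.
  rewrite EW (hv b.1 b.2).2 (hX b.1).2 -EFinM /= /p invfM.
  by case: (b.1 \in S); rewrite ?mul0r ?mulr0 // mul1r mulrC.
under eq_bigr do rewrite E1.
rewrite -(pair_bigA _ (fun a i => if a \in S then p * c (D a i) else 0)) /=.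
transitivity (\sum_(a in S) \sum_i p * c (D a i)).
  rewrite [RHS]big_mkcond /=; apply: eq_bigr => a _; case: ifP => // _.
  by rewrite big1.
transitivity (\sum_(a in S) \sum_(j < n) #|[set i | D a i == j]%SET|%:R * (p * c j)).
  apply: eq_bigr => a aS.
  rewrite (partition_big (fun i => Ordinal (Dn a i aS)) xpredT) //=.
  apply: eq_bigr => j _; rewrite (eq_bigr (fun=> p * c j)) => [|i /eqP <-] //.
  rewrite sumr_const mulr_natl; congr (_ *+ _).
  by apply: eq_card => i; rewrite !inE.
rewrite exchange_big /=; apply: eq_bigr => j _.
by rewrite -mulr_suml -natr_sum mulrA.
Qed.

Lemma cvg_degree (R : realType) (sym : bool) (d : nat -> measure_display)
    (T : forall k, measurableType (d k)) (P : forall k, probability (T k) R)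
    (A : nat -> finType) (S : forall k, {set A k}) (X : forall k, T k -> A k)
    (v : forall k, T k -> 'I_k.+1) (D : forall k, A k -> 'I_k.+1 -> nat) (r : nat -> R) :
  (forall k, uniform_in (P k) (S k) (X k)) ->
  (forall k, uniform_vertex_given (P k) (X k) (v k)) ->
  (forall k a i, a \in S k -> (D k a i < k.+1)%N) ->
  (forall k, r k != 0) ->
  (forall k j, (\sum_(a in S k) #|[set i | D k a i == j]%SET|)%:R =
     r k * (cnt sym k j)%:R) ->
  cvg_in_distribution P (fun k w => (D k (X k w) (v k w))%:R / k.+1%:R)
    (uniform_prob (@ltr01 R)).
Proof.
move=> hX hv hD r0 hr.
have E k c := expectation_degree c (hX k) (hv k) (hD k).
split=> [k|f cf [M fM]]; first exact: (E k (fun j => j%:R / k.+1%:R)).1.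
have law k : 'E_(P k)[fun w => (f ((D k (X k w) (v k w))%:R / k.+1%:R))%R]%E =
    (\sum_(j < k.+1) cnt_egf R sym j (k - j)%N / (\sum_(i < k.+1) cnt_egf R sym i (k - i)%N)
       * f (j%:R / k.+1%:R))%:E.
  rewrite (E k (fun j => f (j%:R / k.+1%:R))).2; congr _%:E.
  pose w j := (\sum_(a in S k) #|[set i | D k a i == j]%SET|)%:R : R.
  pose Z : R := k.+1%:R * #|S k|%:R.
  (* The constant function 1 identifies the denominator [Z] with the sum of the weights, so neither
     [S k] nor [r k] has to be computed. *)
  have := (E k (cst 1)).2; rewrite expectation_cst => -[] /esym.
  rewrite -/Z; under eq_bigr do rewrite mulr1 -/(w _); rewrite -mulr_suml => wZ.
  have Z0 : Z != 0 by apply/eqP => Z0; move/eqP: wZ; rewrite Z0 invr0 mulr0 eq_sym oner_eq0.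
  have {wZ} wZ : \sum_(j < k.+1) w j = Z by rewrite -[LHS](divfK Z0) wZ mul1r.
  have wE j : (j <= k)%N -> w j = r k * k`!%:R * cnt_egf R sym j (k - j)%N.
    move=> jk; rewrite cnt_egfE // /w hr mulrACA mulfV ?mulr1 // fact_neq0.
  have rk0 : r k * k`!%:R != 0 by rewrite mulf_neq0 // fact_neq0.
  apply: eq_bigr => j _; rewrite -/(w j) -/Z -wZ; congr (_ * _).
  rewrite wE -1?ltnS // (eq_bigr (fun i : 'I_k.+1 => r k * k`!%:R * cnt_egf R sym i (k - i)%N)).
    by rewrite -mulr_sumr invfM mulrACA mulfV ?mul1r.
  by move=> i _; rewrite wE // -ltnS.
have Efin : 'E_(uniform_prob (@ltr01 R))[f]%E \is a fin_num.
  have mf : measurable_fun setT (f : measurableTypeR R -> measurableTypeR R) by exact: continuous_measurable_fun.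
  exact: expectation_bounded_fin_num mf fM.
rewrite -(fineK Efin).
apply: (@cvg_trans _ ((\sum_(j < k.+1) cnt_egf R sym j (k - j)%N / (\sum_(i < k.+1) cnt_egf R sym i (k - i)%N)
       * f (j%:R / k.+1%:R))%:E @[k --> \oo])).
  by apply: near_eq_cvg; apply: nearW => k; rewrite -law.
by apply: cvg_EFin; [exact: nearW | exact: degree_limit cf fM].
Qed.

(* The number of vertices is n = k.+1.  As an unlabeled graph has no vertex set
   of its own, vu k is a vertex of a representative of the class Gu k, for an
   arbitrary choice rep of representatives. *)
Theorem theorem1p2 (R : realType)
  (d : nat -> measure_display) (T : forall k, measurableType (d k))
  (P : forall k, probability (T k) R)
  (G : forall k, T k -> graph_on k.+1) (v : forall k, T k -> 'I_k.+1)
  (du : nat -> measure_display) (Tu : forall k, measurableType (du k))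
  (Pu : forall k, probability (Tu k) R)
  (Gu : forall k, Tu k -> {set graph_on k.+1})
  (vu : forall k, Tu k -> 'I_k.+1)
  (rep : forall k, {set graph_on k.+1} -> graph_on k.+1)
  (hG : forall k, uniform_in (P k) (labeled_cographs k.+1) (G k))
  (hv : forall k, uniform_vertex_given (P k) (G k) (v k))
  (hGu : forall k, uniform_in (Pu k) (unlabeled_cographs k.+1) (Gu k))
  (hvu : forall k, uniform_vertex_given (Pu k) (Gu k) (vu k))
  (hrep : forall k C, C \in unlabeled_cographs k.+1 -> rep k C \in C) :
  cvg_in_distribution P
    (fun k w => (degree (G k w) (v k w))%:R / k.+1%:R)
    (uniform_prob (@ltr01 R)) /\
  cvg_in_distribution Pu
    (fun k w => (degree (rep k (Gu k w)) (vu k w))%:R / k.+1%:R)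
    (uniform_prob (@ltr01 R)).
Proof.
have deg_lt k (E : graph_on k.+1) i : E \in labeled_cographs k.+1 ->
    (degree E i < k.+1)%N.
  move/mem_labeled/cograph_wf => W.
  by have := degree_lt W (finset.in_setT i); rewrite cardsT card_ord.
split.
- apply: (@cvg_degree R false d T P (fun k => graph_on k.+1)
    (fun k => labeled_cographs k.+1) G v (fun k E i => degree E i)
    (fun k => k.+1%:R)) => //.
  by move=> k j; rewrite -natrM -labeled_count.
- apply: (@cvg_degree R true du Tu Pu (fun k => {set graph_on k.+1})
    (fun k => unlabeled_cographs k.+1) Gu vu (fun k C i => degree (rep k C) i)
    (fun k => k`!%:R^-1)) => //.
  + move=> k C i CU; apply: deg_lt; have := hrep k C CU.
    case/imsetP: CU => E /mem_labeled cE -> /imsetP[s _ ->].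
    exact/mem_labeled/cograph_relabel.
  + move=> k j; rewrite -(unlabeled_count j (hrep k)) natrM mulKf //.
Qed.
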